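(* Let $\mathcal{E}=(E_1,\ldots,E_k)$ be a collection of base-point free linear series on a quasi-projective irreducible complex variety $X$. Then the codimension of the consistency variety $R_{\mathcal E}$ in $\mathbf{E}=E_1\times\cdots\times E_k$ is equal to $-\mathrm{d}(\mathcal{E})$, where $\mathrm{d}(\mathcal{E})$ is the minimum of the defects $\mathrm{def}(E_J)$ over all $J\subset\{1,\ldots,k\}$.
   Context: Each $E_i$ is a finite-dimensional subspace of $H^0(X,\mathcal{L}_i)$ for a globally generated line bundle $\mathcal{L}_i$ on $X$, and is base-point free: there is no $x\in X$ at which all sections in $E_i$ vanish. The consistency variety $R_{\mathcal E}\subset\mathbf{E}$ is the Zariski closure of the set of $(s_1,\ldots,s_k)\in\mathbf{E}$ such that $s_1=\cdots=s_k=0$ has at least one root on $X$. For $J\subset\{1,\ldots,k\}$, $E_J=\prod_{j\in J}E_j\subset H^0(X,\bigotimes_{j\in J}\mathcal{L}_j)$ is the span of all products $\bigotimes_{j\in J}f_j$ with $f_j\in E_j$. The Kodaira map of a base-point free linear series $E$ is $\Phi_E:X\to\mathbb{P}(E^* )$, sending $x$ to the hyperplane $\{g\in E: g(x)=0\}$ of $E$. Put $\tau_J=\dim\Phi_{E_J}(X)$. The defect is $\mathrm{def}(E_J)=\tau_J-|J|$. The empty subset is allowed, with $\tau_\emptyset=0$ and defect $0$. *)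

(* Defs.v *)
(* [mpoly] must be imported before [classical_sets] and its
   dependents: in the other order the notation levels clash. *)
From mathcomp Require Import all_boot all_order all_algebra.
From mathcomp Require Import complex.
From mathcomp Require Import mpoly.
From mathcomp Require Import boolp classical_sets functions reals.
From mathcomp Require Import constructive_ereal ereal.

Set Implicit Arguments.
Unset Strict Implicit.
Unset Printing Implicit Defensive.

Import Order.TTheory GRing.Theory Num.Theory.

Local Open Scope classical_set_scope.
Local Open Scope ring_scope.

(* A topology on [T] is handled through its family [cl] of closed sets. *)
Section KrullDimension.
Variables (R : realType) (T : Type) (cl : set (set T)).

Definition irreducible_set (Z : set T) : Prop :=
  Z !=set0 /\
  forall A B, cl A -> cl B -> Z `<=` A `|` B -> Z `<=` A \/ Z `<=` B.

Definition closed_in (Y Z : set T) : Prop := exists2 F, cl F & Z = Y `&` F.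

(* Z 0 < Z 1 < ... < Z m, irreducible and closed in the subspace Y *)
Definition has_chain (Y : set T) (m : nat) : Prop :=
  exists Z : nat -> set T,
    (forall j, (j <= m)%N -> closed_in Y (Z j) /\ irreducible_set (Z j)) /\
    (forall j, (j < m)%N -> Z j `<` Z j.+1).

(* -oo for the empty set *)
Definition krull_dim (Y : set T) : \bar R :=
  ereal_sup [set (m%:R)%:E | m in has_chain Y].

End KrullDimension.

Section Linear.
Variables (K : fieldType) (V : lmodType K).

Definition linspan (S : set V) : set V :=
  [set v | exists m (c : 'I_m -> K) (f : 'I_m -> V),
     (forall i, S (f i)) /\ v = \sum_i c i *: f i].

Definition linear_on (W : set V) (l : V -> K) : Prop :=
  forall c u v, W u -> W v -> l (c *: u + v) = c * l u + l v.

Definition ker_on (W : set V) (l : V -> K) : set V :=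
  [set g | W g /\ l g = 0].

(* The points of P(W^* ) are the hyperplanes of W. *)
Definition dual_proj (W : set V) : set (set V) :=
  [set H | exists l, [/\ linear_on W l, (exists2 g, W g & l g != 0)
                       & H = ker_on W l]].

(* The elements of W are the linear forms on W^*, so a homogeneous polynomial
   function on W^* is a homogeneous polynomial in finitely many of them. *)
Definition homog_dual_fun (W : set V) (F : (V -> K) -> K) : Prop :=
  exists m d (f : 'I_m -> V) (p : {mpoly K[m]}),
    [/\ forall i, W (f i), p \is d.-homog
      & forall l, F l = p.@[fun i => l (f i)]].

(* [l] below ranges over the homogeneous coordinates of the point H. *)
Definition dual_proj_closed (W : set V) : set (set (set V)) :=
  [set Z | exists S : set ((V -> K) -> K), S `<=` homog_dual_fun W /\
     Z = [set H | dual_proj W H /\ forall l, linear_on W l ->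
            H = ker_on W l -> forall F, S F -> F l = 0]].

End Linear.

Section ProductSpace.
Variables (K : fieldType) (I : finType) (V : I -> lmodType K).
Variable E : forall i, set (V i).
Arguments E : clear implicits.

Definition prod_space : set (forall i, V i) :=
  [set s | forall i, E i (s i)].

(* polynomials in linear functionals of the factors *)
Definition polynomial_fun (F : (forall i, V i) -> K) : Prop :=
  exists m (h : 'I_m -> I) (l : forall r, V (h r) -> K) (p : {mpoly K[m]}),
    (forall r, linear_on (E (h r)) (l r)) /\
    (forall s, prod_space s -> F s = p.@[fun r => l r (s (h r))]).

Definition prod_closed : set (set (forall i, V i)) :=
  [set Z | exists S : set ((forall i, V i) -> K), S `<=` polynomial_fun /\
     Z = [set s | prod_space s /\ forall F, S F -> F s = 0]].

(* codimension in an affine space: difference of dimensions *)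
Definition codim (R : realType) (Z : set (forall i, V i)) : \bar R :=
  (krull_dim R prod_closed prod_space - krull_dim R prod_closed Z)%E.

End ProductSpace.

(* the lines of C^(n+1), where C = R[i] *)
Definition proj_space (R : realType) (n : nat) :=
  {x : {vspace 'rV[R[i]]_n.+1} | \dim x == 1%N}.

Section Varieties.
Variables (R : realType) (n : nat).
Local Notation C := (R[i]).
Local Notation P := (proj_space R n).

(* homogeneous coordinate vectors of a point *)
Definition hcoord (x : P) : set 'rV[C]_n.+1 :=
  [set v | v \in val x /\ v != 0].

Definition proj_closed : set (set P) :=
  [set Z | exists S : set {mpoly C[n.+1]},
     (forall p, S p -> exists d, p \is d.-homog) /\
     Z = [set x | forall p, S p -> forall v, hcoord x v -> p.@[v 0] = 0]].

Definition quasi_projective (X : set P) : Prop :=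
  exists A B, [/\ proj_closed A, proj_closed B & X = A `\` B].

Definition open_in (X U : set P) : Prop :=
  exists2 Z, proj_closed Z & U = X `\` Z.

Definition regular_on (U : set P) (f : P -> C) : Prop :=
  forall x, U x -> exists Z d (g h : {mpoly C[n.+1]}),
    [/\ proj_closed Z, ~ Z x, g \is d.-homog, h \is d.-homog
      & forall y v, U y -> ~ Z y -> hcoord y v ->
          h.@[v 0] != 0 /\ f y = g.@[v 0] / h.@[v 0]].

(* Cech data: a trivializing open cover of X and transition functions. *)
Record line_bundle (X : set P) := LineBundle {
  lb_idx : Type;
  lb_open : lb_idx -> set P;
  lb_trans : lb_idx -> lb_idx -> P -> C;
  lb_openP : forall a, open_in X (lb_open a);
  lb_cover : forall x, X x -> exists a, lb_open a x;
  lb_regular : forall a b,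
    regular_on (lb_open a `&` lb_open b) (lb_trans a b);
  lb_refl : forall a x, lb_open a x -> lb_trans a a x = 1;
  lb_cocycle : forall a b c x, lb_open a x -> lb_open b x -> lb_open c x ->
    lb_trans a b x * lb_trans b c x = lb_trans a c x }.

(* A section is given by its local expressions [s a] on the sets of the cover;
   they are extended by 0 so that equal sections are equal functions. *)
Definition sec (X : set P) (L : line_bundle X) : lmodType C :=
  lb_idx L -> P -> C^o.

Definition global_section (X : set P) (L : line_bundle X) : set (sec L) :=
  [set s | [/\ forall a, regular_on (lb_open a) (s a),
               forall a b x, lb_open a x -> lb_open b x ->
                 s a x = lb_trans a b x * s b x
             & forall a x, ~ lb_open a x -> s a x = 0]].

Arguments global_section {X} L.

Definition vanishes (X : set P) (L : line_bundle X) (s : sec L) (x : P) : Prop :=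
  forall a, lb_open a x -> s a x = 0.

Definition globally_generated (X : set P) (L : line_bundle X) : Prop :=
  forall x, X x -> exists2 s, global_section L s & ~ vanishes s x.

Definition linear_series (X : set P) (L : line_bundle X) (E : set (sec L)) :
    Prop :=
  E `<=` global_section L /\
  exists m (e : 'I_m -> sec L), E = linspan (range e).

Definition base_point_free (X : set P) (L : line_bundle X) (E : set (sec L)) :
    Prop :=
  forall x, X x -> exists2 s, E s & ~ vanishes s x.

Definition kodaira (X : set P) (L : line_bundle X) (E : set (sec L)) (x : P) :
    set (sec L) :=
  [set g | E g /\ vanishes g x].

(* Tensor products of line bundles: the tensor bundle is trivialized on the
   intersections of the given trivializing sets. *)

Lemma hcoordZ (x : P) u v : hcoord x u -> hcoord x v ->
  exists2 c : C, c != 0 & u = c *: v.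
Proof.
case: x => x dx [/= ux u0] [/= vx v0].
have ev : <[v]>%VS = x.
  by apply/eqP; rewrite eqEdim -memvE vx (eqP dx) dim_vline v0.
move: ux; rewrite -ev => /vlineP[c ec]; exists c => //.
by apply: contraNneq u0 => c0; rewrite ec c0 scale0r.
Qed.

Lemma homog_mevalZ d (p : {mpoly C[n.+1]}) (c : C) (v : 'rV[C]_n.+1) :
  p \is d.-homog -> p.@[(c *: v) 0] = c ^+ d * p.@[v 0].
Proof.
move=> /dhomogP hp; rewrite !mevalE mulr_sumr; apply: eq_big_seq => m /hp mm.
rewrite mulrCA; congr (_ * _).
under eq_bigr do rewrite mxE exprMn.
by rewrite big_split /= prodrXr -mdegE mm.
Qed.

Lemma proj_closedU (A B : set P) :
  proj_closed A -> proj_closed B -> proj_closed (A `|` B).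
Proof.
move=> [S [hS ->]] [S' [hS' ->]].
exists [set r | exists p q, [/\ S p, S' q & r = p * q]]; split.
  move=> _ [p [q [/hS[d pd] /hS'[e qe] ->]]]; exists (d + e)%N.
  exact: dhomogM.
apply/seteqP; split=> x /=.
  move=> hx _ [p [q [Sp Sq ->]]] v xv; rewrite mevalM.
  case: hx => hx; first by rewrite (hx _ Sp _ xv) mul0r.
  by rewrite (hx _ Sq _ xv) mulr0.
move=> hx; apply: contrapT => /not_orP[].
move=> /existsNP[p /not_implyP[Sp /existsNP[v /not_implyP[xv /eqP pv]]]].
move=> /existsNP[q /not_implyP[Sq /existsNP[w /not_implyP[xw /eqP qw]]]].
have [c c0 vw] := hcoordZ xv xw.
have [d pd] := hS _ Sp.
have := hx (p * q) (ex_intro _ p (ex_intro _ q (And3 Sp Sq erefl))) w xw.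
move/eqP; rewrite mevalM mulf_eq0 (negPf qw) orbF => /eqP pw.
by move/eqP: pv; apply; rewrite vw (homog_mevalZ _ _ pd) pw mulr0.
Qed.

Lemma proj_closed0 : proj_closed set0.
Proof.
exists [set 1]; split.
  by move=> p ->; exists 0%N; exact: dhomog1.
apply/seteqP; split=> x //= /(_ 1 erefl) h.
have xn0 : val x != 0%VS by rewrite -dimv_eq0 (eqP (valP x)).
have := h (vpick (val x)); rewrite meval1 => h1; case/negP: (oner_neq0 C).
by apply/eqP; apply: h1; split; rewrite ?memv_pick ?vpick0.
Qed.

Lemma open_in_bigcap (I : finType) (X : set P) (U : I -> set P) :
  (forall i, open_in X (U i)) -> open_in X [set x | X x /\ forall i, U i x].
Proof.
move=> oU; pose Z i := sval (cid2 (oU i)).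
have cZ i : proj_closed (Z i) by rewrite /Z; case: cid2.
have eU i : U i = X `\` Z i by rewrite /Z; case: cid2.
exists (\big[setU/set0]_i Z i).
  by elim/big_ind: _ => //; [exact: proj_closed0 | exact: proj_closedU].
apply/seteqP; split=> x /= [Xx h]; split=> //.
  elim/big_ind: _ => //; first by move=> A B hA hB [].
  by move=> i _; have := h i; rewrite eU => -[].
move=> i; rewrite eU; split=> // Zx; apply: h.
by rewrite (bigD1 i) //=; left.
Qed.

Lemma regular_onS (U U' : set P) (f : P -> C) :
  U' `<=` U -> regular_on U f -> regular_on U' f.
Proof.
move=> sU rf x /sU /rf[Z [d [g [h [cZ Zx gd hd H]]]]].
by exists Z, d, g, h; split=> // y v /sU; exact: H.
Qed.

Lemma regular_on_eq (U : set P) (f f' : P -> C) :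
  (forall x, U x -> f x = f' x) -> regular_on U f -> regular_on U f'.
Proof.
move=> ff' rf x /rf[Z [d [g [h [cZ Zx gd hd H]]]]].
by exists Z, d, g, h; split=> // y v Uy; rewrite -ff' //; exact: H.
Qed.

Lemma regular_on1 (U : set P) : regular_on U (fun=> 1).
Proof.
move=> x _; exists set0, 0%N, 1, 1; split=> //; first exact: proj_closed0.
- exact: dhomog1.
- exact: dhomog1.
by move=> y v _ _ _; rewrite meval1 divr1 oner_neq0.
Qed.

Lemma regular_onM (U : set P) (f f' : P -> C) :
  regular_on U f -> regular_on U f' -> regular_on U (fun x => f x * f' x).
Proof.
move=> rf rf' x Ux; have [Z [d [g [h [cZ Zx gd hd H]]]]] := rf x Ux.
have [Z' [d' [g' [h' [cZ' Zx' gd' hd' H']]]]] := rf' x Ux.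
exists (Z `|` Z'), (d + d')%N, (g * g'), (h * h'); split.
- exact: proj_closedU.
- by case.
- exact: dhomogM.
- exact: dhomogM.
move=> y v Uy /not_orP[nZ nZ'] yv; have [h0 ->] := H _ _ Uy nZ yv.
have [h0' ->] := H' _ _ Uy nZ' yv.
by rewrite !mevalM mulf_neq0 // invfM mulrACA.
Qed.

Lemma regular_on_prod (I : finType) (U : set P) (f : I -> P -> C) :
  (forall i, regular_on U (f i)) -> regular_on U (fun x => \prod_i f i x).
Proof.
move=> rf.
suff H (r : seq I) : regular_on U (fun x => \prod_(i <- r) f i x) by exact: H.
elim: r => [|i r IH].
  by apply: (regular_on_eq _ (@regular_on1 U)) => x _; rewrite big_nil.
apply: (regular_on_eq _ (regular_onM (rf i) IH)) => x _.
by rewrite big_cons.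
Qed.

Section Tensor.
Variables (X : set P) (I : finType) (L : I -> line_bundle X).

Let idx := forall i, lb_idx (L i).
Let U (a : idx) : set P := [set x | X x /\ forall i, lb_open (a i) x].
Let g (a b : idx) (x : P) : C := \prod_i lb_trans (a i) (b i) x.

Fact tensor_openP a : open_in X (U a).
Proof. by apply: open_in_bigcap => i; exact: lb_openP. Qed.

Fact tensor_cover x : X x -> exists a, U a x.
Proof.
move=> Xx; exists (fun i => sval (cid (lb_cover (L i) Xx))); split=> // i.
by case: cid.
Qed.

Fact tensor_regular a b : regular_on (U a `&` U b) (g a b).
Proof.
apply: (@regular_on_prod _ _ (fun i => lb_trans (a i) (b i))) => i.
apply: (regular_onS _ (@lb_regular _ (L i) (a i) (b i))) => x [[_ ha] [_ hb]].
by split.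
Qed.

Fact tensor_refl a x : U a x -> g a a x = 1.
Proof. by case=> _ h; rewrite /g big1 // => i _; exact: lb_refl. Qed.

Fact tensor_cocycle a b c x : U a x -> U b x -> U c x ->
  g a b x * g b c x = g a c x.
Proof.
move=> [_ ha] [_ hb] [_ hc]; rewrite /g -big_split; apply: eq_bigr => i _.
exact: lb_cocycle.
Qed.

Definition tensor_bundle : line_bundle X :=
  LineBundle tensor_openP tensor_cover tensor_regular tensor_refl
    tensor_cocycle.

Definition tensor_sec (s : forall i, sec (L i)) : sec tensor_bundle :=
  fun a x => if `[< U a x >] then \prod_i (s i (a i) x : C) else 0.

Lemma tensor_secP s :
  (forall i, global_section (L i) (s i)) -> global_section tensor_bundle (tensor_sec s).
Proof.
move=> hs; split=> [a|a b x ax bx|a x nax]; rewrite /tensor_sec.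
- apply: (@regular_on_eq _ (fun x => \prod_i (s i (a i) x : C))).
    by move=> x ax; rewrite asboolT.
  apply: (@regular_on_prod _ _ (fun i => s i (a i))) => i; have [r _ _] := hs i.
  by apply: (regular_onS _ (r (a i))) => x [_].
- rewrite !asboolT //= /g -big_split /=; apply: eq_bigr => i _.
  have [_ r _] := hs i; apply: r; first by case: ax.
  by case: bx.
- by rewrite asboolF.
Qed.

Definition series_prod (E : forall i, set (sec (L i))) :
    set (sec tensor_bundle) :=
  linspan [set tensor_sec f | f in prod_space E].

End Tensor.

Section Defect.
Variables (X : set P) (k : nat) (L : 'I_k -> line_bundle X).
Variable E : forall i, set (sec (L i)).
Arguments E : clear implicits.

Definition series_J (J : {set 'I_k}) :
    set (sec (tensor_bundle (fun j : {j | j \in J} => L (val j)))) :=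
  series_prod (fun j : {j | j \in J} => E (val j)).

Arguments series_J : clear implicits.

Definition tau (J : {set 'I_k}) : \bar R :=
  krull_dim R (dual_proj_closed (series_J J)) (kodaira (series_J J) @` X).

Definition defect (J : {set 'I_k}) : \bar R := (tau J - (#|J|%:R)%:E)%E.

Definition min_defect : \bar R := \big[mine/+oo%E]_(J : {set 'I_k}) defect J.

Definition consistency_variety : set (forall i, sec (L i)) :=
  smallest (prod_closed E)
    [set s | prod_space E s /\ exists2 x, X x & forall i, vanishes (s i) x].

End Defect.
End Varieties.

(* Main.v *)
Require Import Defs.
From HB Require Import structures.
From mathcomp Require Import all_boot all_order all_algebra.
From mathcomp Require Import complex mpoly closed_field zify.
From mathcomp Require Import boolp classical_sets functions filter reals.
From mathcomp Require Import constructive_ereal ereal.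

(** Write [e_r] for the members of bases of the [E_i], the index [r] running
    over [k] blocks. On a dense open subset [U] of [X] every block has a pivot,
    a member without zeros; let [x_r] be the quotient of [e_r] by the pivot of
    its block. A system with coefficients [u] has the root [x] in [U] exactly
    when in every block [i] the pivot coefficient is [- y_i], where [y_i] is
    the sum of [u_r x_r] over the other members of the block. Hence the systems
    with a root in [U] are the image of [U x C^M] under a rational map, and
    systems with a root elsewhere are limits of these
    ([consistency_dominant]). So the dimension of the consistency variety is
    the transcendence degree of the coefficients [w_r] off the pivots together
    with [y_1, ..., y_k], where the [w_r] are independent variables. In the same
    way [tau_J] is the transcendence degree of the [x_r] in the blocks of [J]
    ([tau_eq]): the products of pivots and of one other [e_r] give the [x_r]
    back from the product series.

    The rest is a computation in the algebraic matroid of the function field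
    of [U x C^M]. The element [y_i] is generic in the span of the [x_r] of its
    block: if it is algebraic over functions that do not involve the
    coefficients of the block, specializing these coefficients in two ways
    shows that all [x_r] of the block are algebraic over these functions
    ([acl_yfun]). Adjoining the [y_i] one after the other then gives Rado's
    formula: the [y_i] have rank [min_J (tau_J + k - |J|)] over the [w_r]
    ([rk_generic], [u_rk_le], [u_rk_ge]). There are [M - k] coefficients off
    the pivots, so the codimension is [k - min_J (tau_J + k - |J|)], which is
    the opposite of the least defect.

    Transcendence degrees enter through two facts about chains of irreducible
    closed sets. Functions vanishing on one member of a chain and not on the
    next are algebraically independent ([alg_indep_of_chain]). Conversely, [d]
    independent functions [f_j] produce a chain of length [d]: their image
    contains the complement of a hypersurface, by elimination of quantifiers,
    so on almost every level set of the last one the others stay independent,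
    and a minimal closed set with this property is irreducible
    ([rat_indep_slice], [chain_of_rat_indep]).

    The function field is replaced by an ultrapower of [C] over an ultrafilter
    that contains all dense open sets. Every function on [U x C^M], regular or
    not, has a class there, and a rational function is zero on the set where it
    is regular if and only if its class is zero; so germs are computed without
    choosing presentations, and one field serves all [J] at once. *)

Set Implicit Arguments.
Unset Strict Implicit.
Unset Printing Implicit Defensive.

Import Order.TTheory GRing.Theory Num.Theory.

Local Open Scope classical_set_scope.
Local Open Scope ring_scope.

(** * Polynomials in a distinguished last variable *)

Section LastVariable.
Variables (A : comNzRingType) (n : nat).
Implicit Types (p : {mpoly A[n.+1]}) (P : {poly {mpoly A[n]}}).

Let wid (i : 'I_n) : 'I_n.+1 := widen_ord (leqnSn n) i.

Definition poly_multi P : {mpoly A[n.+1]} := (map_poly (@mwiden n A) P).['X_ord_max].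

Lemma muniX (m : 'X_{1..n.+1}) :
  muni ('X_[m] : {mpoly A[n.+1]}) =
  'X_[[multinom (m (wid i)) | i < n]] *: 'X^(m ord_max).
Proof. by rewrite muniE msuppX big_seq1 mcoeffX eqxx scale1r. Qed.

Section Morphism.
Variables (B : comNzRingType) (f : {rmorphism A -> B}).

Lemma mmap_muni p (h : 'I_n.+1 -> B) :
  mmap f h p = (map_poly (mmap f (h \o wid)) (muni p)).[h ord_max].
Proof.
elim/mpolyind: p => [|c m p _ _ IH]; first by rewrite muni0 mmap0 rmorph0 horner0.
rewrite muniD mmapD rmorphD /= hornerD IH; congr (_ + _).
rewrite muniZ mmapZ muniX mmapX map_polyZ /= map_polyZ map_polyXn !hornerZ /= mmapC.
congr (_ * _); rewrite hornerXn /mmap1 big_ord_recr /=; congr (_ * _).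
by rewrite mmapX /mmap1; apply: eq_bigr => i _; rewrite mnmE.
Qed.

Lemma mmap_mwiden (p : {mpoly A[n]}) (h : 'I_n.+1 -> B) :
  mmap f h (mwiden p) = mmap f (h \o wid) p.
Proof.
elim/mpolyind: p => [|c m p _ _ IH]; first by rewrite mwiden0 !mmap0.
rewrite mwidenD !mmapD IH; congr (_ + _); rewrite mwidenZ !mmapZ mwidenX !mmapX /mmap1.
rewrite big_ord_recr /= mnmwiden_ordmax expr0 mulr1; congr (_ * _).
by apply: eq_bigr => i _; rewrite mnmwiden_widen.
Qed.

Lemma mmap_poly_multi P (h : 'I_n.+1 -> B) :
  mmap f h (poly_multi P) = (map_poly (mmap f (h \o wid)) P).[h ord_max].
Proof.
rewrite /poly_multi horner_coef size_map_inj_poly ?mwiden0 //; last exact: inj_mwiden.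
rewrite rmorph_sum /=.
rewrite [RHS](@horner_coef_wide _ (size P)); last exact: size_poly.
apply: eq_bigr => i _.
by rewrite rmorphM /= !coef_map mmap_mwiden rmorphXn /= mmapX mmap1U.
Qed.

End Morphism.

Lemma meval_muni p (v : 'I_n.+1 -> A) :
  p.@[v] = (map_poly (meval (v \o wid)) (muni p)).[v ord_max].
Proof. exact: mmap_muni. Qed.

Lemma muniK p : poly_multi (muni p) = p.
Proof.
elim/mpolyind: p => [|c m p _ _ IH].
  by rewrite muni0 /poly_multi rmorph0 horner0.
rewrite muniD /poly_multi rmorphD /= hornerD -[(_).[_] in X in _ + X]/(poly_multi _) IH.
congr (_ + _); rewrite muniZ muniX map_polyZ /= map_polyZ map_polyXn !hornerZ /= mwidenC.
rewrite mul_mpolyC hornerXn mwidenX; congr (_ *: _).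
rewrite mpolyXn -mpolyXD; congr 'X_[_]; apply/mnmP => i; rewrite mnmDE mulmnE mnm1E.
case: (unliftP ord_max i) => [j ->|->]; last first.
  by rewrite mnmwiden_ordmax eqxx mul1n.
have -> : lift ord_max j = wid j by apply/val_inj; exact: lift_max.
rewrite mnmwiden_widen mnmE (_ : _ == _ = false) ?mul0n ?addn0 //.
by apply/negbTE; apply/eqP => /(congr1 val) /= e; have := ltn_ord j; rewrite -e ltnn.
Qed.

Lemma poly_multiK P : muni (poly_multi P) = P.
Proof.
elim/poly_ind: P => [|P p IH]; first by rewrite /poly_multi rmorph0 horner0 muni0.
rewrite /poly_multi rmorphD rmorphM /= map_polyX map_polyC /= hornerMXaddC.
rewrite muniD muniM IH; congr (_ * _ + _).
  rewrite muniX mnm1E eqxx expr1 (_ : [multinom _ | _ < _] = 0%MM) ?mpolyX0 ?scale1r //.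
  apply/mnmP => i; rewrite mnmE mnm1E mnm0E; apply/eqP; rewrite eqb0.
  by apply/eqP => /(congr1 val) /= e; have := ltn_ord i; rewrite -e ltnn.
elim/mpolyind: p => [|c m p _ _ IHp]; first by rewrite mwiden0 muni0.
rewrite mwidenD muniD IHp polyCD; congr (_ + _).
rewrite mwidenZ mwidenX muniZ muniX mnmwiden_ordmax expr0 alg_polyC -mul_polyC -polyCM.
rewrite mul_mpolyC; congr ((_ *: 'X_[_])%:P).
by apply/mnmP => i; rewrite mnmE mnmwiden_widen.
Qed.

Lemma muni_eq0 p : (muni p == 0) = (p == 0).
Proof.
by apply/eqP/eqP => [h|->]; [rewrite -(muniK p) h /poly_multi rmorph0 horner0|rewrite muni0].
Qed.

Lemma poly_multi_eq0 P : (poly_multi P == 0) = (P == 0).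
Proof. by rewrite -muni_eq0 poly_multiK. Qed.

End LastVariable.

(** The new value is put last because [muni] singles out the last variable. *)
Definition ord_rcons (T : Type) n (v : 'I_n -> T) (t : T) : 'I_n.+1 -> T :=
  fun i => if insub (val i) is Some j then v j else t.

Lemma ord_rcons_widen T n (v : 'I_n -> T) t :
  ord_rcons v t \o widen_ord (leqnSn n) = v.
Proof. by apply/funext => i /=; rewrite /ord_rcons /= valK. Qed.

Lemma ord_rcons_max T n (v : 'I_n -> T) t : ord_rcons v t ord_max = t.
Proof. by rewrite /ord_rcons insubF //= ltnn. Qed.

Section NonZeroPoint.
Variable F : closedFieldType.

Lemma poly_avoid (p : {poly F}) : p != 0 -> exists x, p.[x] != 0.
Proof. by move=> /closed_nonrootP[x nx]; exists x. Qed.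

(** Choose a point where the leading coefficient in the last variable is
    nonzero, then a value of that variable. *)
Lemma mpoly_avoid n (p : {mpoly F[n]}) : p != 0 -> exists v, p.@[v] != 0.
Proof.
elim: n p => [|n IH] p p0.
  exists (fun=> 0); move: p0; rewrite (nvar0_mpolyC p) mevalC.
  by apply: contraNneq => ->.
move: p0; rewrite -muni_eq0 -lead_coef_eq0 => /IH[v pv].
have /poly_avoid[t pt] : map_poly (meval v) (muni p) != 0.
  by apply/eqP => /polyP/(_ (size (muni p)).-1); rewrite coef_map coef0; apply/eqP.
exists (ord_rcons v t); rewrite meval_muni ord_rcons_widen ord_rcons_max.
exact: pt.
Qed.

Lemma mpoly_eq0P n (p : {mpoly F[n]}) : (forall v, p.@[v] = 0) -> p = 0.
Proof.
by move=> h; apply/eqP; apply: contraT => /mpoly_avoid[v]; rewrite h eqxx.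
Qed.

End NonZeroPoint.

(** * Noetherianity of polynomial rings and of closed sets *)

Section Noetherian.

Definition is_ideal (A : comNzRingType) (J : set A) : Prop :=
  [/\ J 0, forall x y, J x -> J y -> J (x + y) & forall a x, J x -> J (a * x)].

(** The ideal is given by its universal property: no coefficients are carried
    around, and it can be tested directly on ideals of vanishing functions. *)
Definition gen_ideal (A : comNzRingType) (S : set A) : set A :=
  [set x | forall J, is_ideal J -> S `<=` J -> J x].

Definition noetherian (A : comNzRingType) : Prop :=
  forall S : set A, exists s : seq A,
    (forall x, x \in s -> S x) /\ S `<=` gen_ideal [set x | x \in s].

Lemma gen_idealP (A : comNzRingType) (S : set A) : is_ideal (gen_ideal S).
Proof.
split=> [J [] //|x y hx hy J iJ SJ|a x hx J iJ SJ].
  by case: (iJ) => _ + _; apply; [exact: hx|exact: hy].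
by case: (iJ) => _ _; apply; exact: hx.
Qed.

Lemma gen_idealS (A : comNzRingType) (S : set A) : S `<=` gen_ideal S.
Proof. by move=> x Sx J _; apply. Qed.

Lemma gen_ideal_sub (A : comNzRingType) (S T : set A) :
  S `<=` gen_ideal T -> gen_ideal S `<=` gen_ideal T.
Proof. by move=> ST x hx; apply: hx => //; exact: gen_idealP. Qed.

Lemma gen_ideal_finite (A : comNzRingType) (S : set A) x : gen_ideal S x ->
  exists s : seq A, (forall y, y \in s -> S y) /\ gen_ideal [set y | y \in s] x.
Proof.
move/(_ [set z | exists s : seq A, (forall y, y \in s -> S y) /\
  gen_ideal [set y | y \in s] z]); apply; first split.
- by exists [::]; split=> //; case: (gen_idealP [set y : A | y \in [::]]).
- move=> y z [s [sS hy]] [t [tS hz]]; exists (s ++ t); split.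
    by move=> u; rewrite mem_cat => /orP[/sS|/tS].
  case: (gen_idealP [set u | u \in s ++ t]) => _ + _; apply.
    by apply: gen_ideal_sub hy => u us; apply: gen_idealS; rewrite /= mem_cat us.
  by apply: gen_ideal_sub hz => u us; apply: gen_idealS; rewrite /= mem_cat us orbT.
- move=> a y [s [sS hy]]; exists s; split=> //.
  by case: (gen_idealP [set u | u \in s]) => _ _; apply.
move=> y Sy; exists [:: y]; split; first by move=> z; rewrite inE => /eqP->.
by apply: gen_idealS; rewrite /= inE.
Qed.

Lemma gen_ideal_finite_seq (A : comNzRingType) (S : set A) (l : seq A) :
  (forall x, x \in l -> gen_ideal S x) ->
  exists s : seq A, (forall y, y \in s -> S y) /\
    forall x, x \in l -> gen_ideal [set y | y \in s] x.
Proof.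
elim: l => [|a l IH] h; first by exists [::].
have [x xl|s [sS hs]] := IH; first by apply: h; rewrite inE xl orbT.
have [t [tS ht]] := gen_ideal_finite (h a (mem_head _ _)).
exists (t ++ s); split; first by move=> u; rewrite mem_cat => /orP[/tS|/sS].
move=> x; rewrite inE => /orP[/eqP->|/hs {}hs].
  by apply: gen_ideal_sub ht => u us; apply: gen_idealS; rewrite /= mem_cat us.
by apply: gen_ideal_sub hs => u us; apply: gen_idealS; rewrite /= mem_cat us orbT.
Qed.

(** Hilbert's basis theorem: a sequence of elements of an ideal, each of least
    degree outside the ideal of the previous ones, stops as soon as its leading
    coefficients generate all the later ones. *)
Theorem noetherian_poly (A : comNzRingType) : noetherian A -> noetherian {poly A}.
Proof.
move=> nA S; set I := gen_ideal S.
suff [l [lI Il]] : exists l : seq {poly A}, (forall x, x \in l -> I x) /\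
    I `<=` gen_ideal [set x | x \in l].
  have [s [sS hs]] := gen_ideal_finite_seq lI.
  exists s; split=> // x /gen_idealS /Il; exact: gen_ideal_sub.
apply: contrapT => /forallNP nol.
have step (l : seq {poly A}) : exists f, (forall x, x \in l -> I x) ->
    [/\ I f, ~ gen_ideal [set x | x \in l] f & forall g, I g ->
       ~ gen_ideal [set x | x \in l] g -> (size f <= size g)%N].
  have [lI|] := pselect (forall x, x \in l -> I x); last by exists 0.
  have /not_andP[//|/existsNP[f /not_implyP[If nf]]] := nol l.
  have: exists m, `[< exists g, [/\ I g, ~ gen_ideal [set x | x \in l] g & size g = m] >].
    by exists (size f); apply/asboolP; exists f.
  move=> exm; case: (ex_minnP exm) => m /asboolP[g [Ig ng sg]] hm.
  exists g => _; split=> // h Ih nh; rewrite sg; apply: hm; apply/asboolP.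
  by exists h.
pose nx l := sval (cid (step l)).
pose L := fix L n := if n is n'.+1 then rcons (L n') (nx (L n')) else [::].
have LI n x : x \in L n -> I x.
  elim: n x => //= n IH x; rewrite mem_rcons inE => /orP[/eqP->|/IH //].
  by rewrite /nx; case: cid => f /= /(_ IH)[].
pose f n := nx (L n).
have fP n : [/\ I (f n), ~ gen_ideal [set x | x \in L n] (f n) & forall g, I g ->
       ~ gen_ideal [set x | x \in L n] g -> (size (f n) <= size g)%N].
  by rewrite /f /nx; case: cid => g /=; apply; apply: LI.
have fL n m : (n < m)%N -> f n \in L m.
  elim: m => //= m IH; rewrite ltnS leq_eqVlt mem_rcons inE => /orP[/eqP->|/IH->].
    by rewrite eqxx.
  by rewrite orbT.
have LS n m : (n <= m)%N -> {subset L n <= L m}.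
  elim: m => [|m IH]; first by rewrite leqn0 => /eqP->.
  rewrite leq_eqVlt => /orP[/eqP-> //|/IH h x /h]; rewrite /= mem_rcons inE => ->.
  by rewrite orbT.
have fS n m : (n <= m)%N -> (size (f n) <= size (f m))%N.
  move=> nm; have [Im nIm _] := fP m; have [_ _ ->//] := fP n.
  by apply: contra_not nIm; apply: gen_ideal_sub => x xn; apply: gen_idealS; exact: LS xn.
have [s [sT Ts]] := nA [set lead_coef (f n) | n in setT].
have [N hN] : exists N, forall x, x \in s -> exists2 n, (n < N)%N & x = lead_coef (f n).
  elim: {Ts} s sT => [|a s IH] sT; first by exists 0%N.
  have [x xs|N hN] := IH; first by apply: sT; rewrite inE xs orbT.
  have [n _ en] := sT a (mem_head _ _).
  exists (maxn n.+1 N) => x; rewrite inE => /orP[/eqP->|/hN[k kN ->]].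
    by exists n; rewrite // leq_max ltnS leqnn.
  by exists k; rewrite // leq_max kN orbT.
set d := (size (f N)).-1.
have [IN nN mN] := fP N.
have fN0 : f N != 0.
  by apply/eqP => e; apply: nN; rewrite e; case: (gen_idealP [set x | x \in L N]).
have sN : size (f N) = d.+1 by rewrite prednK // size_poly_gt0.
pose G := gen_ideal [set x | x \in L N].
have [G0 GD GM] : is_ideal G := gen_idealP _.
(* coefficients of degree [d] of elements of [G] of size at most [d.+1]; the
   leading coefficients of the first [f n] are among them *)
pose J : set A := [set a | exists g, [/\ G g, (size g <= d.+1)%N & g`_d = a]].
have iJ : is_ideal J.
  split; first by exists 0; rewrite size_poly0 coef0.
    move=> x y [g [Gg sg gx]] [h [Gh sh hy]]; exists (g + h).
    rewrite coefD gx hy; split=> //; first exact: GD.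
    by rewrite (leq_trans (size_polyD _ _)) // geq_max sg sh.
  move=> a x [g [Gg sg gx]]; exists (a%:P * g); rewrite coefCM gx; split=> //.
    exact: GM.
  by rewrite mul_polyC (leq_trans (size_scale_leq _ _)).
have [|x xs|g [Gg sg gd]] := Ts (lead_coef (f N)) _ J iJ; first by exists N.
  have [n nN' ->] := hN _ xs.
  have sn : (size (f n) <= d.+1)%N by rewrite -sN fS // ltnW.
  have fn0 : f n != 0.
    have [_ nn _] := fP n.
    by apply/eqP => e; apply: nn; rewrite e; case: (gen_idealP [set x | x \in L n]).
  exists ('X^(d.+1 - size (f n)) * f n); split.
  - by apply: GM; apply: gen_idealS; exact: fL.
  - by rewrite mulrC size_mulXn // subnK.
  - rewrite coefXnM ltnNge leq_subLR -add1n leq_add2r size_poly_gt0 fn0 /=.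
    rewrite lead_coefE; congr (_`_ _).
    by rewrite -{1}[d]/(d.+1.-1) -{1}(subnK sn) -subn1 -addnBA ?size_poly_gt0 // addKn subn1.
have IG : G `<=` I by move=> x; apply; [exact: gen_idealP|exact: LI].
have [_ ID IM] : is_ideal I := gen_idealP _.
(* [f N - g] is outside [G] like [f N], but smaller *)
have h1 : I (f N - g) by apply: ID => //; rewrite -mulN1r; apply: IM; exact: IG.
have h2 : ~ G (f N - g).
  by move=> h; apply: nN; rewrite -[f N](subrK g); exact: GD.
have := mN _ h1 h2; rewrite leqNgt => /negP; apply.
rewrite sN ltnS; apply/leq_sizeP => j; rewrite leq_eqVlt => /orP[/eqP<-|dj].
  by rewrite coefB gd lead_coefE subrr.
by rewrite coefB !nth_default ?subrr ?sN // (leq_trans sg).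
Qed.

Lemma noetherian_surj (A B : comNzRingType) (f : A -> B) :
  f 0 = 0 -> {morph f : x y / x + y} -> {morph f : x y / x * y} ->
  (forall b, exists a, f a = b) -> noetherian A -> noetherian B.
Proof.
move=> f0 fD fM fs nA S; have [s [sS Ss]] := nA [set a | S (f a)].
exists (map f s); split=> [_ /mapP[x /sS Sx ->] //|b Sb J [J0 JD JM] sJ].
have [a fa] := fs b; rewrite -fa.
apply: (Ss a _ [set x | J (f x)]); first by rewrite /= fa.
  split=> /=; first by rewrite f0.
    by move=> x y; rewrite fD; exact: JD.
  by move=> c x; rewrite fM; exact: JM.
by move=> x xs; apply: sJ; exact: map_f.
Qed.

Lemma noetherian_field (F : fieldType) : noetherian F.
Proof.
move=> S; have [[x [Sx /eqP x0]]|h] := pselect (exists x, S x /\ x <> 0).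
  exists [:: x]; split=> [y|y Sy J [_ _ JM] sJ]; first by rewrite inE => /eqP->.
  by rewrite -(divfK x0 y); apply: JM; apply: sJ; rewrite /= inE.
exists [::]; split=> // x Sx J [J0 _ _] _.
by have [->//|/eqP nx] := eqVneq x 0; case: h; exists x.
Qed.

Lemma noetherian_mpoly (F : fieldType) n : noetherian {mpoly F[n]}.
Proof.
elim: n => [|n IH].
  apply: (@noetherian_surj F {mpoly F[0]} (@mpolyC 0 F) _ _ _ _ (@noetherian_field F)).
  - exact: mpolyC0.
  - exact: mpolyCD.
  - exact: mpolyCM.
  by move=> p; exists p@_0%MM; rewrite -nvar0_mpolyC.
apply: (@noetherian_surj {poly {mpoly F[n]}} {mpoly F[n.+1]} (@poly_multi F n) _ _ _ _ (noetherian_poly IH)).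
- by rewrite /poly_multi rmorph0 horner0.
- by move=> p q; rewrite /poly_multi rmorphD hornerD.
- by move=> p q; rewrite /poly_multi rmorphM hornerM.
by move=> p; exists (muni p); exact: muniK.
Qed.

End Noetherian.

Section Zariski.
Variables (F : closedFieldType) (N : nat).
Local Notation pt := ('I_N -> F).

Definition zclosed : set (set pt) :=
  [set Z | exists S : set {mpoly F[N]}, Z = [set v | forall p, S p -> p.@[v] = 0]].

Definition vanishing (V : set pt) : set {mpoly F[N]} :=
  [set p | forall v, V v -> p.@[v] = 0].

Lemma vanishing_ideal V : is_ideal (vanishing V).
Proof.
split=> [v _|p q hp hq v Vv|a p hp v Vv]; first exact: meval0.
  by rewrite mevalD hp ?hq ?addr0.
by rewrite mevalM hp ?mulr0.
Qed.

Lemma zclosed_vanishing V v : zclosed V -> (forall p, vanishing V p -> p.@[v] = 0) -> V v.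
Proof. by move=> [S ->] h p Sp; apply: h => w; apply. Qed.

Lemma zclosed_finite V : zclosed V ->
  exists s : seq {mpoly F[N]}, V = [set v | forall p, p \in s -> p.@[v] = 0].
Proof.
move=> [S ->]; have [s [sS Ss]] := @noetherian_mpoly F N S.
exists s; apply/seteqP; split=> v /= h p; first by move/sS; exact: h.
move=> Sp; apply: (Ss _ Sp (vanishing [set v])) => //.
- exact: vanishing_ideal.
- by move=> q qs w /= ->; exact: h.
Qed.

Lemma zclosedI A B : zclosed A -> zclosed B -> zclosed (A `&` B).
Proof.
move=> [S ->] [T ->]; exists (S `|` T); apply/seteqP; split=> v /=.
  by move=> [h h'] p [/h|/h'].
by move=> h; split=> p hp; apply: h; [left|right].
Qed.

Lemma zclosed_poly p : zclosed [set v | p.@[v] = 0].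
Proof.
by exists [set p]; apply/seteqP; split=> v /= h; [move=> q ->|apply: h].
Qed.

(** Descending chains of closed sets are finite because their ideals generate
    a finitely generated ideal. *)
Lemma zclosed_minimal (P : set (set pt)) : P !=set0 -> P `<=` zclosed ->
  exists2 V, P V & forall W, P W -> W `<=` V -> W = V.
Proof.
move=> [V0 PV0] Pz; apply: contrapT => nomin.
have step (V : {V | P V}) : exists W : {V | P V}, sval W `<` sval V.
  apply: contrapT => nW; apply: nomin; exists (sval V); first exact: svalP.
  move=> W PW WV; apply: contrapT => neq; apply: nW; exists (exist _ W PW) => /=.
  split=> // VW; apply: neq; exact/seteqP.
pose nx V := sval (cid (step V)).
pose s n : {V | P V} := iter n nx (exist _ V0 PV0).
have sS n : sval (s n.+1) `<` sval (s n) by rewrite /s /= /nx; case: cid.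
have sm n m : (n <= m)%N -> sval (s m) `<=` sval (s n).
  elim: m => [|m IH]; first by rewrite leqn0 => /eqP->.
  rewrite leq_eqVlt => /orP[/eqP->//|/IH h]; apply: subset_trans h.
  by case: (sS m).
have [l [lS Sl]] := @noetherian_mpoly F N [set p | exists n, vanishing (sval (s n)) p].
have [n hn] : exists n, forall p, p \in l -> vanishing (sval (s n)) p.
  elim: {Sl} l lS => [|a l IH] lS; first by exists 0%N.
  have [x xs|n hn] := IH; first by apply: lS; rewrite inE xs orbT.
  have [m hm] := lS a (mem_head _ _).
  exists (maxn n m) => p; rewrite inE => /orP[/eqP->|/hn hp] v.
    by move/(sm _ _ (leq_maxr _ _)); exact: hm.
  by move/(sm _ _ (leq_maxl _ _)); exact: hp.
have [_] := sS n; apply => v snv.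
apply: zclosed_vanishing => [|p hp]; first by apply: Pz; exact: svalP.
have: vanishing (sval (s n)) p; last by apply.
apply: (Sl p) => //; first by exists n.+1.
exact: vanishing_ideal.
Qed.

End Zariski.

(** * Images of rational maps *)

Section Constructible.
Variable F : closedFieldType.

Section TermOfPoly.
Variables (N off : nat).

(** The variables are shifted by [off]: the first ones are kept for the
    coordinates of the target of the map. *)
Definition mpoly_term (p : {mpoly F[N]}) : GRing.term F :=
  foldr (fun m t => GRing.Add (GRing.Mul (GRing.Const p@_m)
    (foldr (fun (i : 'I_N) u => GRing.Mul (GRing.Exp (GRing.Var F (off + i)) (m i)) u)
       (GRing.Const 1) (enum 'I_N))) t) (GRing.Const 0) (msupp p).

Lemma rterm_mpoly p : GRing.rterm (mpoly_term p).
Proof.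
rewrite /mpoly_term; elim: (msupp p) => //= m s ->; rewrite andbT.
by elim: (enum _) => //= i r ->.
Qed.

Lemma eval_mpoly_term p e :
  GRing.eval e (mpoly_term p) = p.@[fun i => nth 0 e (off + i)].
Proof.
rewrite mevalE /mpoly_term; elim: (msupp p) => [|m s IH] /=; first by rewrite big_nil.
rewrite big_cons IH; congr (_ * _ + _).
rewrite -big_enum /=; elim: (enum _) => [|i r IHr] /=; first by rewrite big_nil.
by rewrite big_cons IHr.
Qed.

End TermOfPoly.

Section PolyOfTerm.
Variable d : nat.

(** Variables from [d] on are read as 0, which is also their value in a list of
    length [d]. *)
Fixpoint term_mpoly (t : GRing.term F) : {mpoly F[d]} :=
  match t with
  | GRing.Var i => if insub i is Some j then 'X_j else 0
  | GRing.Const c => c%:MP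
  | GRing.NatConst n => n%:R
  | GRing.Add t1 t2 => term_mpoly t1 + term_mpoly t2
  | GRing.Opp t1 => - term_mpoly t1
  | GRing.NatMul t1 n => term_mpoly t1 *+ n
  | GRing.Mul t1 t2 => term_mpoly t1 * term_mpoly t2
  | GRing.Inv _ => 0
  | GRing.Exp t1 n => term_mpoly t1 ^+ n
  end.

Definition env (v : 'I_d -> F) : seq F := [seq v i | i <- enum 'I_d].

Lemma nth_env v (i : 'I_d) : nth 0 (env v) i = v i.
Proof. by rewrite (nth_map i) ?size_enum_ord // nth_ord_enum. Qed.

Lemma nth_env_default v i : (d <= i)%N -> nth 0 (env v) i = 0.
Proof. by move=> di; rewrite nth_default // size_map size_enum_ord. Qed.

Lemma meval_term_mpoly t v : GRing.rterm t ->
  (term_mpoly t).@[v] = GRing.eval (env v) t.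
Proof.
elim: t => //=.
- move=> i _; case: insubP => [j _ <-|]; first by rewrite mevalXU nth_env.
  by rewrite -leqNgt meval0 => /nth_env_default ->.
- by move=> c _; rewrite mevalC.
- by move=> n _; rewrite rmorph_nat.
- by move=> t IHt u IHu /andP[/IHt <- /IHu <-]; rewrite mevalD.
- by move=> t IHt /IHt <-; rewrite mevalN.
- by move=> t IHt n /IHt <-; rewrite mevalMn.
- by move=> t IHt u IHu /andP[/IHt <- /IHu <-]; rewrite mevalM.
- by move=> t IHt n /IHt <-; rewrite rmorphXn.
Qed.

(** A quantifier-free condition is decided by a nonzero polynomial: this is
    clear for one equation and is preserved by boolean combinations. *)
Lemma qf_generic f : GRing.qf_form f -> GRing.rformula f ->
  exists2 h : {mpoly F[d]}, h != 0 &
    (forall v, h.@[v] != 0 -> GRing.holds (env v) f) \/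
    (forall v, h.@[v] != 0 -> ~ GRing.holds (env v) f).
Proof.
elim: f => //=.
- by case=> _ _; exists 1; rewrite ?oner_eq0 //; [left|right].
- move=> t u _ /andP[rt ru].
  have [e|ne] := eqVneq (term_mpoly t - term_mpoly u) 0.
    exists 1; rewrite ?oner_eq0 //; left => v _.
    have := congr1 (meval v) e; rewrite mevalB meval0 !meval_term_mpoly //.
    by move/eqP; rewrite subr_eq0 => /eqP.
  exists (term_mpoly t - term_mpoly u) => //; right => v.
  by rewrite mevalB !meval_term_mpoly // subr_eq0 => /eqP.
- move=> f IHf g IHg /andP[qf qg] /andP[rf rg].
  have [h h0 hf] := IHf qf rf; have [k k0 kg] := IHg qg rg.
  exists (h * k); first exact: mulf_neq0.
  case: hf => hf; last by right=> v; rewrite mevalM mulf_eq0 negb_or => /andP[/hf + _] [].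
  case: kg => kg; last by right=> v; rewrite mevalM mulf_eq0 negb_or => /andP[_ /kg +] [].
  by left=> v; rewrite mevalM mulf_eq0 negb_or => /andP[/hf ? /kg].
- move=> f IHf g IHg /andP[qf qg] /andP[rf rg].
  have [h h0 hf] := IHf qf rf; have [k k0 kg] := IHg qg rg.
  exists (h * k); first exact: mulf_neq0.
  case: hf => hf; first by left=> v; rewrite mevalM mulf_eq0 negb_or => /andP[/hf]; left.
  case: kg => kg; first by left=> v; rewrite mevalM mulf_eq0 negb_or => /andP[_ /kg]; right.
  by right=> v; rewrite mevalM mulf_eq0 negb_or => /andP[/hf ? /kg ?] [].
- move=> f IHf g IHg /andP[qf qg] /andP[rf rg].
  have [h h0 hf] := IHf qf rf; have [k k0 kg] := IHg qg rg.
  exists (h * k); first exact: mulf_neq0.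
  case: hf => hf; last by left=> v; rewrite mevalM mulf_eq0 negb_or => /andP[/hf].
  case: kg => kg; first by left=> v; rewrite mevalM mulf_eq0 negb_or => /andP[_ /kg].
  by right=> v; rewrite mevalM mulf_eq0 negb_or => /andP[/hf ? /kg nk] /(_ _)/nk; apply.
- move=> f IHf qf rf; have [h h0 [hf|hf]] := IHf qf rf; exists h => //.
    by right=> v /hf ? /(_ _).
  by left.
Qed.

End PolyOfTerm.

Lemma rformula_foldr_and (fs : seq (GRing.formula F)) :
  GRing.rformula (foldr (@GRing.And F) (@GRing.Bool F true) fs) = all (@GRing.rformula F) fs.
Proof. by elim: fs => //= f fs ->. Qed.

Lemma holds_foldr_and e (T : eqType) (fs : T -> GRing.formula F) (s : seq T) :
  GRing.holds e (foldr (@GRing.And F) (@GRing.Bool F true) (map fs s)) <->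
  forall x, x \in s -> GRing.holds e (fs x).
Proof.
elim: s => [|x s IH] /=; first by split.
split=> [[fx /IH fss] y|h]; first by rewrite inE => /orP[/eqP->|/fss].
by split; [apply: h; exact: mem_head|apply/IH => y ys; apply: h; rewrite inE ys orbT].
Qed.

(** Quantifier elimination: the image of a constructible set under a rational
    map to an affine space contains, or avoids, the complement of a
    hypersurface. *)
Lemma image_generic N d (s : seq {mpoly F[N]}) (q : {mpoly F[N]})
    (a b : 'I_d -> {mpoly F[N]}) :
  let im (t : 'I_d -> F) := exists x : 'I_N -> F,
    [/\ forall p, p \in s -> p.@[x] = 0, q.@[x] != 0
      & forall i, (a i).@[x] = t i * (b i).@[x]] in
  exists2 h : {mpoly F[d]}, h != 0 &
    (forall t, h.@[t] != 0 -> im t) \/ (forall t, h.@[t] != 0 -> ~ im t).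
Proof.
move=> im.
pose mt := @mpoly_term N d; pose T := @GRing.Bool F true.
pose eq0 (t : GRing.term F) := GRing.Equal t (GRing.Const (0 : F)).
pose f1 := foldr (@GRing.And F) T (map (eq0 \o mt) s).
pose f3 := foldr (@GRing.And F) T [seq GRing.Equal (mt (a i))
  (GRing.Mul (GRing.Var F i) (mt (b i))) | i <- enum 'I_d].
pose f0 := GRing.And f1 (GRing.And (GRing.Not (eq0 (mt q))) f3).
pose f := foldr (fun i g => GRing.Exists i g) f0 (iota d N).
have rf : GRing.rformula f.
  suff h : GRing.rformula f0 by rewrite /f; elim: (iota _ _) => //= i l ->.
  rewrite /= /f1 /f3 !rformula_foldr_and rterm_mpoly !all_map /=; apply/andP; split.
    by apply/allP => p _ /=; rewrite rterm_mpoly.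
  by apply/allP => i _ /=; rewrite !rterm_mpoly.
have f0P e : GRing.holds e f0 <-> [/\ forall p, p \in s -> p.@[fun i => nth 0 e (d + i)] = 0,
    q.@[fun i => nth 0 e (d + i)] != 0
    & forall i, (a i).@[fun i => nth 0 e (d + i)] =
                nth 0 e i * (b i).@[fun i => nth 0 e (d + i)]].
  rewrite /f0 /= eval_mpoly_term /f1 /f3; split.
    move=> [/holds_foldr_and h1 [/eqP h2 /holds_foldr_and h3]]; split=> // [p /h1|i].
      by rewrite /= eval_mpoly_term.
    by have := h3 i (mem_enum _ i); rewrite /= !eval_mpoly_term.
  move=> [h1 /eqP h2 h3]; split; [|split=> //]; apply/holds_foldr_and.
    by move=> p /h1; rewrite /= eval_mpoly_term.
  by move=> i _; rewrite /= !eval_mpoly_term.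
have fP t : GRing.holds (env t) f <-> im t.
  rewrite /f -GRing.foldExistsP; split.
    move=> [e he /f0P[h1 h2 h3]]; exists (fun i : 'I_N => nth 0 e (d + i)); split=> // i.
    rewrite h3 -(nth_env t i) (he i) // inE mem_iota negb_and -ltnNge ltn_ord //.
  move=> [x [h1 h2 h3]].
  pose e := env t ++ [seq x i | i <- enum 'I_N].
  have se : size (env t) = d by rewrite size_map size_enum_ord.
  have ed i : nth 0 e (d + i) = if insub i is Some j then x j else 0.
    rewrite nth_cat se ltnNge leq_addr /= addKn; case: insubP => [j _ <-|].
      rewrite (nth_map j) ?size_enum_ord; last exact: ltn_ord.
      by congr (x _); exact: nth_ord_enum.
    by rewrite -leqNgt => Ni; rewrite nth_default // size_map size_enum_ord.
  have xe : (fun i : 'I_N => nth 0 e (d + i)) = x.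
    by apply/funext => i; rewrite ed valK.
  exists e; last first.
    apply/f0P; rewrite xe; split=> // i; rewrite h3; congr (_ * _).
    by rewrite nth_cat se ltn_ord nth_env.
  move=> i; rewrite inE mem_iota negb_and -ltnNge -leqNgt => /orP[id|id].
    by rewrite nth_cat se id.
  rewrite nth_env_default ?(leq_trans (leq_addr _ _) id) //.
  rewrite -(subnKC (leq_trans (leq_addr _ _) id)) ed insubF //.
  by apply/negbTE; rewrite -leqNgt leq_subRL // (leq_trans (leq_addr _ _) id).
have wf := @ClosedFieldQE.wf_ex_elim F.
have va := ClosedFieldQE.holds_ex_elim (@GRing.solve_monicpoly F).
set qf := GRing.quantifier_elim (@ClosedFieldQE.ex_elim F) f.
have /andP[qfq rq] : GRing.qf_form qf && GRing.rformula qf.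
  exact: GRing.quantifier_elim_wf.
have qP t : GRing.holds (env t) qf <-> im t.
  rewrite -fP; have P1 := GRing.qf_evalP (env t) qfq.
  have P2 := GRing.quantifier_elim_rformP wf va (env t) rf.
  by split; [move/P1/P2|move/P2/P1].
have [h h0 hh] := qf_generic d qfq rq; exists h => //.
by case: hh => hh; [left|right] => t /hh; rewrite qP.
Qed.

End Constructible.

(** * Chains of closed sets from independent functions *)

Section ChainLower.
Variables (F : closedFieldType) (N : nat).
Local Notation pt := ('I_N -> F).

Lemma zclosedU (A B : set pt) : zclosed A -> zclosed B -> zclosed (A `|` B).
Proof.
move=> [S ->] [T ->]; exists [set p * r | p in S & r in T]; apply/seteqP; split=> v /=.
  by move=> [h|h] _ [p Sp [r Tr <-]]; rewrite mevalM ?(h p Sp) ?(h r Tr) ?mul0r ?mulr0.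
move=> h; apply: contrapT => /not_orP[/existsNP[p /not_implyP[Sp /eqP pv]]].
move=> /existsNP[r /not_implyP[Tr /eqP rv]].
have /eqP := h (p * r) (ex_intro2 _ _ p Sp (ex_intro2 _ _ r Tr erefl)).
by rewrite mevalM mulf_eq0 (negPf pv) (negPf rv).
Qed.

Variable q : {mpoly F[N]}.

Definition principal_open (V : set pt) : set pt := [set x | V x /\ q.@[x] != 0].

Definition rat_indep d (a b : 'I_d -> {mpoly F[N]}) (V : set pt) : Prop :=
  forall P : {mpoly F[d]}, P != 0 ->
    exists2 x, principal_open V x & P.@[fun i => (a i).@[x] / (b i).@[x]] != 0.

(** If a minimal closed set on which the functions are independent were the
    union of two smaller ones, the product of a relation on each of these would
    be a relation on the whole. *)
Lemma rat_indep_minimal d (a b : 'I_d -> {mpoly F[N]}) V :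
  zclosed V -> rat_indep a b V ->
  exists V0, [/\ zclosed V0, V0 `<=` V, irreducible_set (@zclosed F N) V0 & rat_indep a b V0].
Proof.
move=> cV iV; pose fam W := [/\ zclosed W, W `<=` V & rat_indep a b W].
have [||V0 [cV0 V0V iV0] mV0] := @zclosed_minimal F N fam.
- by exists V; split.
- by move=> W [].
have mini W : zclosed W -> ~ V0 `<=` W -> ~ rat_indep a b (V0 `&` W).
  move=> cW nW iW; apply: nW; have <- : V0 `&` W = V0; last by move=> x [].
  apply: mV0; last by move=> x [].
  by split=> //; [exact: zclosedI|move=> x [/V0V]].
exists V0; split=> //; split.
  by have [x [V0x _] _] := iV0 1 (oner_neq0 _); exists x.
move=> A B cA cB sAB; apply: contrapT => /not_orP[nA nB].
have /existsNP[P /not_implyP[P0 hP]] := mini A cA nA.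
have /existsNP[Q /not_implyP[Q0 hQ]] := mini B cB nB.
have [x [V0x qx]] := iV0 (P * Q) (mulf_neq0 P0 Q0).
rewrite mevalM mulf_eq0 negb_or => /andP[Px Qx].
by case: (sAB x V0x) => hx; [apply: hP|apply: hQ]; exists x.
Qed.

(** A dominant map to affine space hits almost all points of almost every
    hyperplane, so the other coordinates stay independent on the fibre. *)
Lemma rat_indep_slice d (a b : 'I_d.+1 -> {mpoly F[N]}) V :
  zclosed V -> (forall i x, principal_open V x -> (b i).@[x] != 0) -> rat_indep a b V ->
  exists c, rat_indep (a \o widen_ord (leqnSn d)) (b \o widen_ord (leqnSn d))
     (V `&` [set x | (a ord_max).@[x] = c * (b ord_max).@[x]]).
Proof.
move=> cV hb iV; have [s sV] := zclosed_finite cV.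
have [h h0 [hh|hh]] := image_generic s q a b; last first.
  have [x [Vx qx] hx] := iV h h0; case: (hh _ hx); exists x; split=> // [|i].
    by move: Vx; rewrite sV; apply.
  by rewrite divfK //; apply: hb.
have [t ht] := mpoly_avoid h0; set c := t ord_max; exists c => P P0.
(* [h] restricted to the hyperplane where the last coordinate is [c] *)
pose hc := (muni h).[c%:MP].
have hcE v : hc.@[v] = h.@[ord_rcons v c].
  rewrite meval_muni ord_rcons_widen ord_rcons_max -horner_map /=.
  by rewrite mevalC.
have hc0 : hc != 0.
  apply: contraNneq ht => e; have := hcE (t \o widen_ord (leqnSn d)).
  rewrite e meval0 => /esym h1.
  rewrite (_ : t = ord_rcons (t \o widen_ord (leqnSn d)) c) ?h1 //.
  apply/funext => i; have [j ->|->] := unliftP ord_max i; last by rewrite ord_rcons_max.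
  have -> : lift ord_max j = widen_ord (leqnSn d) j by apply/val_inj; exact: lift_max.
  by rewrite -[RHS]/((ord_rcons _ c \o widen_ord (leqnSn d)) j) ord_rcons_widen.
have [v] := mpoly_avoid (mulf_neq0 P0 hc0).
rewrite mevalM mulf_eq0 negb_or hcE => /andP[Pv hv].
have [x [xs qx xE]] := hh _ hv.
have Dx : principal_open V x by split; rewrite ?sV.
exists x.
  by split=> //; split; [case: Dx|rewrite /= xE ord_rcons_max].
rewrite (_ : (fun i => _) = v) //; apply/funext => i /=.
rewrite xE mulfK; last by apply: hb.
by rewrite -[LHS]/((ord_rcons v c \o widen_ord (leqnSn d)) i) ord_rcons_widen.
Qed.

Variables (T : Type) (cl : set (set T)) (theta : pt -> T) (Y : set T).

Let D V := principal_open V.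

(** Cutting down by the equations [a i = c i * b i] one after the other gives a
    chain of irreducible closed sets downstairs; their images in [T] have
    irreducible closures, separated by the closed sets [a i = c i * b i]. *)
Lemma chain_of_rat_indep d (a b : 'I_d -> {mpoly F[N]}) V0 :
  (forall i x, D V0 x -> (b i).@[x] != 0) ->
  (forall x, D V0 x -> Y (theta x)) ->
  (forall A, cl A -> exists2 A', zclosed A' & forall x, D V0 x -> A (theta x) <-> A' x) ->
  (forall S, S `<=` theta @` D V0 ->
     exists G, [/\ cl G, S `<=` G & forall H, cl H -> S `<=` H -> G `<=` H]) ->
  (forall i c, exists2 G, cl G &
     forall x, D V0 x -> G (theta x) <-> (a i).@[x] = c * (b i).@[x]) ->
  zclosed V0 -> rat_indep a b V0 -> has_chain cl Y d.
Proof.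
move=> hb hY hcont hclo hlev cV0 iV0.
suff [Z [h1 h2 _]] : exists Z : nat -> set T,
    [/\ forall j, (j <= d)%N -> closed_in cl Y (Z j) /\ irreducible_set cl (Z j),
        forall j, (j < d)%N -> Z j `<` Z j.+1
      & forall G, cl G -> theta @` D V0 `<=` G -> Z d `<=` G] by exists Z.
have irr V : zclosed V -> irreducible_set (@zclosed F N) V -> V `<=` V0 ->
    D V !=set0 -> exists G, [/\ cl G, irreducible_set cl (Y `&` G),
     theta @` D V `<=` Y `&` G & forall H, cl H -> theta @` D V `<=` H -> G `<=` H].
  move=> cV iV VV0 [x0 Dx0].
  have DD x : D V x -> D V0 x by move=> [/VV0].
  have [|G [cG sG mG]] := hclo (theta @` D V); first by move=> _ [x /DD Dx <-]; exists x.
  have TY : theta @` D V `<=` Y `&` G.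
    by move=> _ [x Dx <-]; split; [apply: hY; exact: DD|apply: sG; exists x].
  exists G; split=> //; split; first by exists (theta x0); apply: TY; exists x0.
  move=> A B cA cB sAB.
  have [A' cA' hA'] := hcont A cA; have [B' cB' hB'] := hcont B cB.
  case: (iV) => _ /(_ A' (B' `|` [set x | q.@[x] = 0]) cA').
  case.
  - by apply: zclosedU => //; exact: zclosed_poly.
  - move=> x Vx; have [qx|qx] := eqVneq q.@[x] 0; first by right; right.
    have Dx : D V x by split.
    have [] := sAB (theta x) (TY _ (ex_intro2 _ _ x Dx erefl)).
      by move/(hA' _ (DD _ Dx)); left.
    by move/(hB' _ (DD _ Dx)); right; left.
  - move=> h; left=> y [_ Gy]; apply: mG Gy => // _ [x Dx <-].
    by apply/hA'; [exact: DD|apply: h; case: Dx].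
  - move=> h; right=> y [_ Gy]; apply: mG Gy => // _ [x Dx <-].
    apply/hB'; first exact: DD.
    by case: Dx => /h[//|/= ->]; rewrite eqxx.
elim: d a b V0 hb hY hcont hclo hlev cV0 iV0 irr => [|d IH] a b V0 hb hY hcont hclo hlev cV0 iV0 irr.
  have [V [cV VV0 iV indV]] := rat_indep_minimal cV0 iV0.
  have [|G [cG iG sG mG]] := irr V cV iV VV0.
    by have [x Dx _] := indV 1 (oner_neq0 _); exists x.
  exists (fun=> Y `&` G); split=> [j _|//|H cH hH]; first by split=> //; exists G.
  apply: subset_trans (mG H cH _); first by move=> x [].
  by apply: subset_trans hH => _ [x [/VV0 ? ?] <-]; exists x.
have [V [cV VV0 iV indV]] := rat_indep_minimal cV0 iV0.
have [|G [cG iG sG mG]] := irr V cV iV VV0.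
  by have [x Dx _] := indV 1 (oner_neq0 _); exists x.
have hbV i x : D V x -> (b i).@[x] != 0 by move=> [/VV0 ? ?]; apply: hb.
have [c indc] := rat_indep_slice cV hbV indV.
set V1 := V `&` _ in indc.
have V1V : V1 `<=` V by move=> x [].
have DD x : D V1 x -> D V0 x by move=> [/V1V/VV0].
have cV1 : zclosed V1.
  apply: zclosedI => //.
  have -> : [set x | (a ord_max).@[x] = c * (b ord_max).@[x]] =
            [set x | (a ord_max - c *: b ord_max).@[x] = 0].
    apply/seteqP; split=> x /=; rewrite mevalB mevalZ.
      by move=> ->; rewrite subrr.
    by move/eqP; rewrite subr_eq0 => /eqP.
  exact: zclosed_poly.
case: (IH (a \o widen_ord (leqnSn d)) (b \o widen_ord (leqnSn d)) V1).
- by move=> i x /DD; exact: hb.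
- by move=> x Dx; apply: hY; exact: DD.
- move=> A cA; have [A' cA' hA'] := hcont A cA; exists A' => // x /DD; exact: hA'.
- by move=> S sS; apply: hclo; apply: subset_trans sS _ => _ [x /DD Dx <-]; exists x.
- by move=> i e; have [H cH hH] := hlev (widen_ord (leqnSn d) i) e; exists H => // x /DD; exact: hH.
- exact: cV1.
- exact: indc.
- by move=> W cW iW WV1; apply: irr => //; move=> x /WV1/V1V/VV0.
move=> Z [Z1 Z2 Z3].
have [H cH hH] := hlev ord_max c.
exists (fun j => if (j <= d)%N then Z j else Y `&` G); split.
- move=> j; rewrite leq_eqVlt => /orP[/eqP->|]; rewrite ?ltnn ?ltnS.
    by split=> //; exists G.
  by move=> jd; rewrite jd; exact: Z1.
- move=> j; rewrite ltnS => jd; rewrite jd; case: ltnP => jd'; first exact: Z2.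
  have -> : j = d by apply/eqP; rewrite eqn_leq jd.
  have ZH : Z d `<=` H.
    apply: Z3 => // _ [x Dx <-]; apply/hH; first exact: DD.
    by case: Dx => -[_ /=].
  have ZYG : Z d `<=` Y `&` G.
    have [[W _ ZW] _] := Z1 d (leqnn d).
    move=> y Zy; split; first by move: Zy; rewrite ZW => -[].
    apply: (Z3 G) => //; apply: subset_trans (_ : theta @` D V `<=` G).
      by move=> _ [x [/V1V ? ?] <-]; exists x.
    by apply: subset_trans sG _ => z [].
  split=> // YGZ.
  have [|x [Vx qx]] := indV ('X_ord_max - c%:MP).
    apply/eqP => /(congr1 (fun p => p.@[fun=> c + 1])) /eqP.
    by rewrite mevalB mevalXU mevalC meval0 addrAC subrr add0r oner_eq0.
  rewrite mevalB mevalXU mevalC; have Dx : D V x by split.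
  have /hH -> : H (theta x) by apply: ZH; apply: YGZ; apply: sG; exists x.
    by rewrite mulfK ?subrr ?eqxx //; exact: hbV.
  by split=> //; exact: VV0.
- move=> K cK hK; rewrite ltnn; apply: subset_trans (mG K cK _); first by move=> y [].
  by apply: subset_trans hK => _ [x [/VV0 ? ?] <-]; exists x.
Qed.

End ChainLower.

(** * The algebraic matroid of a field extension *)

Section Subfield.
Variables (F K : fieldType) (iota : {rmorphism F -> K}).

Definition is_subfield (A : set K) : Prop :=
  [/\ forall c, A (iota c), forall x y, A x -> A y -> A (x - y)
    & forall x y, A x -> A y -> A (x / y)].

Definition subfield_pred (A : set K) (hA : is_subfield A) : {pred K} :=
  fun x => `[< A x >].

Fact subfield_predP A (hA : is_subfield A) : divring_closed (subfield_pred hA).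
Proof.
case: (hA) => h1 h2 h3; split; first by apply/asboolP; rewrite -(rmorph1 iota).
  by move=> x y /asboolP hx /asboolP hy; apply/asboolP; exact: h2.
by move=> x y /asboolP hx /asboolP hy; apply/asboolP; exact: h3.
Qed.

HB.instance Definition _ A (hA : is_subfield A) :=
  GRing.isDivringClosed.Build K (subfield_pred hA) (subfield_predP hA).

(** The theory of integral elements is stated for ring morphisms, so a subfield
    has to be made into a type of its own. *)
Record subfield_type A (hA : is_subfield A) :=
  SubfieldElt { subfield_val :> K; _ : subfield_val \in subfield_pred hA }.

HB.instance Definition _ A (hA : is_subfield A) :=
  [isSub for @subfield_val A hA].
HB.instance Definition _ A (hA : is_subfield A) :=
  [Choice of subfield_type hA by <:].
HB.instance Definition _ A (hA : is_subfield A) :=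
  [SubChoice_isSubIntegralDomain of subfield_type hA by <:].
HB.instance Definition _ A (hA : is_subfield A) :=
  [SubIntegralDomain_isSubField of subfield_type hA by <:].

Definition algebraic (A : set K) : set K :=
  [set y | exists2 p : {poly K}, p != 0 & (forall i, A p`_i) /\ root p y].

Lemma algebraicP A (hA : is_subfield A) y :
  algebraic A y <-> algebraicOver (\val : subfield_type hA -> K) y.
Proof.
split=> [[p p0 [Ap py]]|[p p0 py]].
  pose s i : subfield_type hA := insubd (0 : subfield_type hA) p`_i.
  have sE i : val (s i) = p`_i.
    by rewrite /s insubdK //; apply/asboolP.
  have pE : p = map_poly val (\poly_(i < size p) s i).
    apply/polyP => i; rewrite coef_map coef_poly; case: ltnP => h; first exact/esym/sE.
    by rewrite nth_default //= rmorph0.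
  exists (\poly_(i < size p) s i); last by rewrite -pE.
  by apply: contraNneq p0 => e; rewrite pE e rmorph0.
exists (map_poly val p); first by rewrite map_poly_eq0.
split=> // i; rewrite coef_map.
by have /asboolP := valP p`_i.
Qed.

Lemma is_subfield0 A : is_subfield A -> A 0.
Proof. by case=> h _ _; rewrite -(rmorph0 iota). Qed.

Lemma is_subfield1 A : is_subfield A -> A 1.
Proof. by case=> h _ _; rewrite -(rmorph1 iota). Qed.

Lemma is_subfieldD A x y : is_subfield A -> A x -> A y -> A (x + y).
Proof.
move=> hA Ax Ay; case: (hA) => _ hB _; rewrite -[y]opprK -[- y]sub0r; apply: (hB) => //.
by apply: (hB) => //; exact: is_subfield0.
Qed.

Lemma is_subfieldM A x y : is_subfield A -> A x -> A y -> A (x * y).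
Proof.
move=> hA Ax Ay; case: (hA) => _ _ hD; rewrite -[y]invrK -[y^-1]div1r; apply: (hD) => //.
by apply: (hD) => //; exact: is_subfield1.
Qed.

Lemma is_subfield_sum A n (f : nat -> K) : is_subfield A ->
  (forall i, (i < n)%N -> A (f i)) -> A (\sum_(i < n) f i).
Proof.
move=> hA hf; elim/big_ind: _ => //; first exact: is_subfield0.
  by move=> *; exact: is_subfieldD.
by move=> i _; exact: hf.
Qed.

Lemma is_subfieldX A x n : is_subfield A -> A x -> A (x ^+ n).
Proof.
move=> hA Ax; elim: n => [|n IH]; first exact: is_subfield1.
by rewrite exprS; exact: is_subfieldM.
Qed.

Lemma sub_algebraic A : is_subfield A -> A `<=` algebraic A.
Proof.
move=> hA x Ax; exists ('X - x%:P); first by rewrite polyXsubC_eq0.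
split; last by rewrite root_XsubC.
move=> i; case: (hA) => _ hB _; rewrite coefB coefX coefC.
apply: hB; first by case: eqP => _; [exact: is_subfield1|exact: is_subfield0].
by case: eqP => _ //; exact: is_subfield0.
Qed.

Lemma algebraicS A B : A `<=` B -> algebraic A `<=` algebraic B.
Proof. by move=> AB y [p p0 [Ap py]]; exists p => //; split=> // i; exact: AB. Qed.

Lemma algebraic_subfield A : is_subfield A -> is_subfield (algebraic A).
Proof.
move=> hA; split=> [c|x y /(algebraicP hA) hx /(algebraicP hA) hy|x y].
- by apply: sub_algebraic => //; case: hA.
- by apply/(algebraicP hA); exact: algebraic_sub.
by move=> /(algebraicP hA) hx /(algebraicP hA) hy; apply/(algebraicP hA); exact: algebraic_div.
Qed.

Lemma algebraic_idem A : is_subfield A -> algebraic (algebraic A) `<=` algebraic A.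
Proof.
move=> hA y [p p0 [Ap py]]; apply/(algebraicP hA)/integral_algebraic.
apply: integral_root p0 py _ => _ /(nthP 0)[i _ <-].
by apply/integral_algebraic/(algebraicP hA).
Qed.

Definition gen_subfield (S : set K) : set K :=
  [set x | forall A, is_subfield A -> S `<=` A -> A x].

Lemma gen_subfieldP S : is_subfield (gen_subfield S).
Proof.
split=> [c A hA _|x y hx hy A hA SA|x y hx hy A hA SA]; first by case: hA.
  by case: (hA) => _ h _; apply: h; [exact: hx|exact: hy].
by case: (hA) => _ _ h; apply: h; [exact: hx|exact: hy].
Qed.

Lemma gen_subfield_min A S : is_subfield A -> S `<=` A -> gen_subfield S `<=` A.
Proof. by move=> hA SA x; apply. Qed.

Lemma sub_gen_subfield S : S `<=` gen_subfield S.
Proof. by move=> x Sx A _; apply. Qed.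

(** The closure operator of the algebraic matroid of [K] over [F] *)
Definition acl (S : set K) : set K := algebraic (gen_subfield S).

Lemma acl_subfield S : is_subfield (acl S).
Proof. exact/algebraic_subfield/gen_subfieldP. Qed.

Lemma sub_acl S : S `<=` acl S.
Proof.
by move=> x Sx; apply: sub_algebraic; [exact: gen_subfieldP|exact: sub_gen_subfield].
Qed.

Lemma acl_sub S T : S `<=` acl T -> acl S `<=` acl T.
Proof.
move=> ST; apply: (@subset_trans _ (algebraic (acl T))); last first.
  exact/algebraic_idem/gen_subfieldP.
by apply: algebraicS; apply: gen_subfield_min => //; exact: acl_subfield.
Qed.

Lemma aclS S T : S `<=` T -> acl S `<=` acl T.
Proof. by move=> ST; apply: acl_sub; apply: subset_trans ST _; exact: sub_acl. Qed.

Definition is_subring (R : set K) : Prop :=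
  [/\ forall c, R (iota c), forall x y, R x -> R y -> R (x - y)
    & forall x y, R x -> R y -> R (x * y)].

Definition fractions (R : set K) : set K :=
  [set x | exists a b, [/\ R a, R b, b != 0 & x = a / b]].

Lemma fractions_subfield R : is_subring R -> is_subfield (fractions R).
Proof.
move=> [hC hB hM].
have R1 : R 1 by rewrite -(rmorph1 iota).
have R0 : R 0 by rewrite -(rmorph0 iota).
split=> [c|_ _ [a [b [Ra Rb b0 ->]]] [c [d [Rc Rd d0 ->]]]|
  _ _ [a [b [Ra Rb b0 ->]]] [c [d [Rc Rd d0 ->]]]].
- by exists (iota c), 1; rewrite oner_eq0 divr1.
- exists (a * d - c * b), (b * d); rewrite mulf_neq0 //; split=> //.
    by apply: (hB); exact: hM.
    exact: hM.
  by rewrite -mulNr addf_div // mulNr.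
have [->|c0] := eqVneq c 0.
  by rewrite mul0r invr0 mulr0; exists 0, 1; rewrite oner_eq0 mul0r.
exists (a * d), (b * c); rewrite mulf_neq0 //; split=> //; [exact: hM|exact: hM|].
by rewrite invf_div mulf_div.
Qed.

Lemma common_denominator R n (f : nat -> K) : is_subring R ->
  (forall i, (i < n)%N -> fractions R (f i)) ->
  exists v, [/\ R v, v != 0 & forall i, (i < n)%N -> R (f i * v)].
Proof.
move=> [hC hB hM]; elim: n => [|n IH] hf.
  by exists 1; rewrite oner_eq0 -(rmorph1 iota).
have [i ?|v [Rv v0 hv]] := IH; first by apply: hf; rewrite ltnS ltnW.
have [a [b [Ra Rb b0 fn]]] := hf n (ltnSn n).
exists (v * b); split; [exact: hM|exact: mulf_neq0|move=> i].
rewrite ltnS leq_eqVlt => /orP[/eqP->|/hv h].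
  by rewrite fn mulrCA divfK //; exact: hM.
by rewrite mulrA; exact: hM.
Qed.

Definition poly_values (A : set K) (x : K) : set K :=
  [set z | exists2 p : {poly K}, (forall i, A p`_i) & z = p.[x]].

Lemma poly_values_subring A x : is_subfield A -> is_subring (poly_values A x).
Proof.
move=> hA; split=> [c|_ _ [p hp ->] [r hr ->]|_ _ [p hp ->] [r hr ->]].
- exists (iota c)%:P; last by rewrite hornerC.
  by move=> i; rewrite coefC; case: eqP => _; [case: hA|exact: is_subfield0].
- exists (p - r); last by rewrite hornerD hornerN.
  by move=> i; rewrite coefB; case: hA => _ h _; exact: h.
exists (p * r); last by rewrite hornerM.
move=> i; rewrite coefM; apply: (is_subfield_sum (f := fun j => p`_j * r`_(i - j))) => // j _.
exact: is_subfieldM.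
Qed.

(** A relation that makes [y] algebraic over [x] may be read as a relation for
    [x]; its coefficients, polynomials in [y] over [gen_subfield S], do not all
    vanish unless [y] is algebraic over [S]. *)
Lemma acl_exchange S x y : acl (S `|` [set x]) y -> ~ acl S y -> acl (S `|` [set y]) x.
Proof.
move=> [p p0 [hp py]] ny; set A := gen_subfield S in ny.
have hA : is_subfield A := gen_subfieldP _.
have hR := poly_values_subring x hA.
have sub : gen_subfield (S `|` [set x]) `<=` fractions (poly_values A x).
  apply: gen_subfield_min; first exact: fractions_subfield.
  move=> z [Sz|->]; [exists z, 1|exists x, 1]; split; rewrite ?oner_eq0 ?divr1 //.
  - exists z%:P; last by rewrite hornerC.
    move=> i; rewrite coefC; case: eqP => _; last exact: is_subfield0.
    exact: sub_gen_subfield.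
  - by case: hR => h _ _; rewrite -(rmorph1 iota).
  - exists 'X; last by rewrite hornerX.
    by move=> i; rewrite coefX; case: eqP => _; [exact: is_subfield1|exact: is_subfield0].
  - by case: hR => h _ _; rewrite -(rmorph1 iota).
have [|v [_ v0 hv]] := @common_denominator _ (size p) (fun i => p`_i) hR.
  by move=> i _; apply: sub; exact: hp.
have /choice[P hP] : forall i, exists P : {poly K}, (forall j, A P`_j) /\ P.[x] = p`_i * v.
  move=> i; have [/hv[P hP ->]|ip] := ltnP i (size p); first by exists P.
  exists 0; rewrite nth_default // horner0 mul0r; split=> // j; rewrite coef0.
  exact: is_subfield0.
have rel : \sum_(i < size p) (P i).[x] * y ^+ i = 0.
  rewrite (eq_bigr (fun i : 'I__ => (p`_i * y ^+ i) * v)).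
    by rewrite -mulr_suml -horner_coef (rootP py) mul0r.
  by move=> i _; case: (hP i) => _ ->; rewrite mulrAC.
pose i0 := (size p).-1.
have Pi0 : P i0 != 0.
  apply/eqP => e; case: (hP i0) => _; rewrite e horner0 => /esym/eqP.
  by rewrite mulf_eq0 (negPf v0) orbF -lead_coefE lead_coef_eq0 (negPf p0).
pose d := \max_(i < size p) size (P i).
have sP i : (i < size p)%N -> (size (P i) <= d)%N.
  by move=> ip; exact: (@leq_bigmax _ (fun i : 'I_(size p) => size (P i)) (Ordinal ip)).
(* the same relation, ordered by powers of [x] *)
pose Q j := \poly_(i < size p) (P i)`_j.
have relQ : \sum_(j < d) (Q j).[y] * x ^+ j = 0.
  rewrite -[RHS]rel; transitivity (\sum_(i < size p) \sum_(j < d) (P i)`_j * x ^+ j * y ^+ i).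
    2: by apply: eq_bigr => i _; rewrite (horner_coef_wide _ (sP _ (ltn_ord i))) mulr_suml.
  rewrite exchange_big /=; apply: eq_bigr => j _.
  rewrite (horner_coef_wide _ (size_poly _ _)) mulr_suml; apply: eq_bigr => i _.
  by rewrite coef_poly ltn_ord mulrAC.
pose T := \poly_(j < d) (Q j).[y].
have [T0|T0] := eqVneq T 0; last first.
  exists T => //; split; last first.
    rewrite rootE (horner_coef_wide _ (size_poly _ _)); apply/eqP; rewrite -[RHS]relQ.
    by apply: eq_bigr => j _; rewrite coef_poly ltn_ord.
  have hG : is_subfield (gen_subfield (S `|` [set y])) := gen_subfieldP _.
  have AG : A `<=` gen_subfield (S `|` [set y]).
    apply: gen_subfield_min => // z Sz; apply: sub_gen_subfield; by left.
  move=> j; rewrite coef_poly; case: ltnP => _; last exact: is_subfield0.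
  rewrite (horner_coef_wide _ (size_poly _ _)).
  apply: (is_subfield_sum (f := fun i => (Q j)`_i * y ^+ i)) => // i _.
  apply: (is_subfieldM hG); last by apply: (is_subfieldX _ hG); apply: sub_gen_subfield; right.
  rewrite coef_poly; case: ltnP => _; last exact: is_subfield0.
  by apply: AG; case: (hP i) => h _; exact: h.
case: ny; have i0p : (i0 < size p)%N by rewrite /i0 prednK // size_poly_gt0.
pose j0 := (size (P i0)).-1.
exists (Q j0).
  apply/eqP => /polyP/(_ i0); rewrite coef_poly i0p coef0 /j0 -lead_coefE => /eqP.
  by rewrite lead_coef_eq0 (negPf Pi0).
split=> [i|].
  rewrite coef_poly; case: ltnP => _; last exact: is_subfield0.
  by case: (hP i) => h _; exact: h.
rewrite rootE; move/polyP/(_ j0): T0; rewrite coef_poly coef0.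
rewrite (leq_trans _ (sP _ i0p)) ?prednK ?size_poly_gt0 //.
by move=> ->.
Qed.

(** Rank of the matroid contracted by [B] *)
Fixpoint rk (B : set K) (s : seq K) : nat :=
  if s is x :: s' then (~~ `[< acl (B `|` [set y | y \in s']) x >] + rk B s')%N else 0%N.

Lemma rk_monoB B B' s : B `<=` B' -> (rk B' s <= rk B s)%N.
Proof.
move=> BB'; elim: s => //= x s IH; apply: leq_add IH.
case: asboolP => //= nh; case: asboolP => //= h; case: nh.
by apply: aclS h => y [/BB'|]; [left|right].
Qed.

(** The summand on the left makes the induction work: once [x] has become
    algebraic over [t], contracting it costs nothing any more. By exchange it
    becomes so exactly when contracting [x] first saves an element of [t]. *)
Lemma rk_add1 B x t :
  (rk B t + ~~ `[< acl (B `|` [set y | y \in t]) x >] <= (rk (B `|` [set x]) t).+1)%N.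
Proof.
elim: t => [|y t IH]; first by rewrite add0n /= leq_b1.
rewrite /=; set B1 := B `|` _; set B2 := B `|` [set z | z \in y :: t].
have B12 : B1 `<=` B2 by move=> z [|zt]; [left|right; rewrite /= inE zt orbT].
have B2E : B2 `<=` B1 `|` [set y].
  move=> z [|]; first by left; left.
  by rewrite /= inE => /orP[/eqP->|]; [right|left; right].
have BE : B `|` [set x] `|` [set z | z \in t] `<=` B1 `|` [set x].
  by move=> z [[|]|]; [left; left|right|left; right].
have EB : B1 `|` [set x] `<=` B `|` [set x] `|` [set z | z \in t].
  by move=> z [[|]|]; [left; left|right|left; right].
have mono : (~~ `[< acl B2 x >] <= ~~ `[< acl B1 x >])%N.
  by case: asboolP => // nx; case: asboolP => // h; case: nx; exact: aclS h.
case: (asboolP (acl B1 y)) => y1.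
  rewrite add0n (leq_trans (leq_add (leqnn _) mono)) // (leq_trans IH) // ltnS.
  exact: leq_addl.
case: (asboolP (acl (B `|` [set x] `|` _) y)) => y2 /=; last first.
  rewrite !add1n addSn ltnS (leq_trans (leq_add (leqnn _) mono)) //.
have x2 : acl B2 x.
  have := acl_exchange (aclS BE y2) y1; apply: aclS.
  by move=> z [/B12|->] //; right; rewrite /= inE eqxx.
have x1 : ~ acl B1 x.
  move=> h; apply: y1; move: y2; apply: acl_sub => z /BE[/sub_acl //|->] //.
rewrite (asboolT x2) addn0 add1n add0n.
by move: IH; rewrite (asboolF x1) addn1.
Qed.

(** Steinitz: pass from [B] to [B] with the head of [s] added. This decreases the
    rank of [t] by at most one, and that of [s] by at least one unless the head
    is algebraic over the rest of [s]. *)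
Lemma rk_le B s t : (forall x, x \in t -> acl (B `|` [set y | y \in s]) x) ->
  (rk B t <= rk B s)%N.
Proof.
elim: s B => [|x s IH] B h.
  elim: t h => //= y t IHt h.
  rewrite asboolT /= ?IHt // => [z zt|]; first by apply: h; rewrite inE zt orbT.
  have := h y (mem_head _ _); apply: aclS => z [|//]; by left.
rewrite /=; case: (asboolP (acl _ x)) => xs /=.
  apply: IH => y /h; apply: acl_sub => z [Bz|]; first by apply: sub_acl; left.
  by rewrite /= inE => /orP[/eqP->//|zs]; apply: sub_acl; right.
have h1 : (rk (B `|` [set x]) t <= rk (B `|` [set x]) s)%N.
  apply: IH => y /h; apply: aclS => z [|]; first by left; left.
  by rewrite /= inE => /orP[/eqP->|]; [left; right|right].
have h2 := rk_add1 B x t.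
rewrite add1n; apply: leq_trans (leq_addr _ _) (leq_trans h2 _).
rewrite ltnS (leq_trans h1) // rk_monoB // => z; by left.
Qed.

Lemma rk_eq B s t : s =i t -> rk B s = rk B t.
Proof.
by move=> st; apply/eqP; rewrite eqn_leq !rk_le // => x xs; apply: sub_acl; right; rewrite /= ?st // -st.
Qed.

Lemma rk_cat B s t : rk B (s ++ t) = (rk (B `|` [set y | y \in t]) s + rk B t)%N.
Proof.
elim: s => //= x s ->; rewrite addnA; congr (_ + _ + _)%N; congr (nat_of_bool (~~ _)).
congr `[< acl _ x >]; apply/seteqP; split=> y /=; rewrite mem_cat.
  by move=> [|/orP[]]; [left; left|right|left; right].
by move=> [[]|]; [left|right; apply/orP; right|right; apply/orP; left].
Qed.

Lemma rk_size B s : (rk B s <= size s)%N.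
Proof. by elim: s => //= x s IH; rewrite -add1n leq_add // leq_b1. Qed.

Definition alg_indep n (g : 'I_n -> K) : Prop :=
  forall P : {mpoly F[n]}, P != 0 -> mmap iota g P != 0.

Lemma mmap_gen_subfield n (g : 'I_n -> K) P : gen_subfield (range g) (mmap iota g P).
Proof.
have hG := gen_subfieldP (range g).
elim/mpolyind: P => [|c m p _ _ IH]; first by rewrite mmap0; exact: is_subfield0.
rewrite mmapD; apply: (is_subfieldD hG) => //; rewrite mmapZ mmapX.
apply: (is_subfieldM hG); first by case: hG.
rewrite /mmap1; elim/big_ind: _ => [|x y hx hy|i _]; first exact: is_subfield1.
  exact: (is_subfieldM hG).
by apply: (is_subfieldX _ hG); apply: sub_gen_subfield; exists i.
Qed.

Lemma mmap_subring n (g : 'I_n -> K) : is_subring (range (mmap iota g)).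
Proof.
split=> [c|_ _ [p _ <-] [r _ <-]|_ _ [p _ <-] [r _ <-]].
- by exists c%:MP; rewrite // mmapC.
- by exists (p - r); rewrite // mmapB.
- by exists (p * r); rewrite // rmorphM.
Qed.

Lemma acl_relation n (g : 'I_n -> K) y : acl (range g) y ->
  exists P : {poly {mpoly F[n]}},
    map_poly (mmap iota g) P != 0 /\ root (map_poly (mmap iota g) P) y.
Proof.
move=> [p p0 [hp py]]; have hR := mmap_subring g.
have sub : gen_subfield (range g) `<=` fractions (range (mmap iota g)).
  apply: gen_subfield_min; first exact: fractions_subfield.
  move=> _ [i _ <-]; exists (g i), 1; split; rewrite ?oner_eq0 ?divr1 //.
    by exists 'X_i; rewrite // mmapX mmap1U.
  by exists 1; rewrite // rmorph1.
have [|v [_ v0 hv]] := @common_denominator _ (size p) (fun i => p`_i) hR.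
  by move=> i _; apply: sub; exact: hp.
have /choice[P hP] : forall i, exists P : {mpoly F[n]}, mmap iota g P = p`_i * v.
  move=> i; have [/hv[P _ <-]|ip] := ltnP i (size p); first by exists P.
  by exists 0; rewrite nth_default // mmap0 mul0r.
have E : map_poly (mmap iota g) (\poly_(i < size p) P i) = v *: p.
  apply/polyP => i; rewrite coef_map coef_poly coefZ /=; case: ltnP => ip.
    by rewrite hP mulrC.
  by rewrite nth_default // mmap0 mulr0.
exists (\poly_(i < size p) P i); rewrite E; split; first by rewrite scaler_eq0 negb_or v0.
by rewrite rootE hornerZ (rootP py) mulr0.
Qed.

Lemma alg_indep_rcons n (g : 'I_n -> K) x :
  alg_indep g -> ~ acl (range g) x -> alg_indep (ord_rcons g x).
Proof.
move=> ig nx P P0; apply/eqP; rewrite mmap_muni ord_rcons_widen ord_rcons_max => h.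
apply: nx; exists (map_poly (mmap iota g) (muni P)).
  apply/eqP => /polyP/(_ (size (muni P)).-1); rewrite coef_map coef0; apply/eqP/ig.
  by rewrite -lead_coefE lead_coef_eq0 muni_eq0.
split; last exact/eqP.
by move=> i; rewrite coef_map; exact: mmap_gen_subfield.
Qed.

Lemma alg_indep_behead n (g : 'I_n.+1 -> K) : alg_indep g ->
  alg_indep (g \o widen_ord (leqnSn n)) /\
  ~ acl (range (g \o widen_ord (leqnSn n))) (g ord_max).
Proof.
move=> ig; split=> [P P0|/acl_relation[P [P0 hP]]].
  rewrite -mmap_mwiden; apply: ig; apply: contraNneq P0 => e.
  by apply/eqP/inj_mwiden; rewrite e mwiden0.
have: poly_multi P != 0 by rewrite poly_multi_eq0; apply: contraNneq P0 => ->; rewrite rmorph0.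
by move/ig; rewrite mmap_poly_multi; apply/negP; rewrite negbK.
Qed.

(** The members that are not algebraic over later ones are independent, and
    the others are algebraic over them. *)
Lemma rk_alg_indep (I : Type) (g : I -> K) (l : seq I) :
  exists j : 'I_(rk set0 (map g l)) -> I, alg_indep (g \o j).
Proof.
suff [n [j [nE ij _ _]]] : exists n (j : 'I_n -> I), [/\ n = rk set0 (map g l),
    alg_indep (g \o j), forall x, x \in map g l -> acl (range (g \o j)) x
    & forall k, g (j k) \in map g l].
  by move: j ij; rewrite nE => j ij; exists j.
elim: l => [|i l [n [j [nE ij sj js]]]].
  exists 0%N, (fun k : 'I_0 => match (notF (ltn_ord k)) with end).
  split=> [//|P P0|//|[]//]; rewrite (nvar0_mpolyC P) mmapC fmorph_eq0.
  by apply: contraNneq P0 => e; rewrite (nvar0_mpolyC P) e mpolyC0.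
rewrite /=; case: (asboolP (acl _ (g i))) => hi.
  exists n, j; split=> // [x|k]; last by rewrite inE js orbT.
  rewrite inE => /orP[/eqP->|/sj //].
  by move: hi; apply: acl_sub => z [//|/sj].
exists n.+1, (ord_rcons j i).
have rE : g \o ord_rcons j i = ord_rcons (g \o j) (g i).
  by apply/funext => k; rewrite /= /ord_rcons; case: insub.
have sub : range (g \o j) `<=` range (g \o ord_rcons j i).
  move=> _ [k _ <-]; exists (widen_ord (leqnSn n) k) => //.
  by rewrite -[LHS]/(g ((ord_rcons j i \o widen_ord (leqnSn n)) k)) ord_rcons_widen.
split.
- by rewrite nE add1n.
- rewrite rE; apply: alg_indep_rcons => //; apply: contra_not hi.
  by apply: aclS => _ [k _ <-]; right; exact: js.
- move=> x; rewrite inE => /orP[/eqP->|/sj]; last exact: aclS.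
  by apply: sub_acl; exists ord_max; rewrite //= ord_rcons_max.
- by move=> k; rewrite /ord_rcons; case: insub => [k'|]; rewrite inE ?eqxx // js orbT.
Qed.

Lemma alg_indep_le_rk n (g : 'I_n -> K) (l : seq K) : alg_indep g ->
  (forall i, acl [set y | y \in l] (g i)) -> (n <= rk set0 l)%N.
Proof.
move=> ig gl.
have [s sg ns] : exists2 s : seq K, (forall x, x \in s -> exists i, x = g i) &
    rk set0 s = n /\ range g `<=` [set y | y \in s].
  elim: n g ig {gl} => [|n IH] g ig; first by exists [::]; [|split=> // _ [[] []] //].
  have [ig' gn] := alg_indep_behead ig.
  have [s sg [ns rs]] := IH _ ig'.
  exists (g ord_max :: s).
    by move=> x; rewrite inE => /orP[/eqP->|/sg[i ->]]; [exists ord_max|exists (widen_ord (leqnSn n) i)].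
  split=> /=.
    rewrite ns asboolF // => h; apply: gn; apply: aclS h => z [//|/sg[i ->]].
    by exists i.
  move=> _ [i _ <-]; rewrite /= inE; have [k ->|->] := unliftP ord_max i; last by rewrite eqxx.
  apply/orP; right; apply: rs; exists k => //=; congr g; apply/val_inj => /=.
  by rewrite [RHS]lift_max.
case: ns => ns _; rewrite -[n in (n <= _)%N]ns; apply: rk_le => x /sg[i ->].
by apply: aclS (gl i) => y; right.
Qed.

(** If each [y i] is a generic member of the span of [X i], then [y i] is
    algebraic over a set independent of its coefficients only when all of [X i]
    is; adding the [y i] one by one gives Rado's formula for their rank. *)
Lemma rk_generic (I : eqType) (X : I -> seq K) (y : I -> K) (W : set K) :
  (forall i Y J, i \notin Y ->
     let S := W `|` [set z | z \in map y Y] `|` [set z | z \in flatten (map X J)] in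
     acl S (y i) -> forall x, x \in X i -> acl S x) ->
  forall L Y, uniq (L ++ Y) ->
  let B := W `|` [set z | z \in map y Y] in
  exists J, [/\ uniq J, {subset J <= L} &
    (rk B (flatten (map X J)) + size L <= rk B (map y L) + size J)%N].
Proof.
move=> free; elim=> [|i L IH] Y uLY B; first by exists [::].
have [iLY {}uLY] := andP (uLY : (i \notin L ++ Y) && uniq (L ++ Y)).
have iY : i \notin Y by move: iLY; rewrite mem_cat => /norP[].
have iL : i \notin L by move: iLY; rewrite mem_cat => /norP[].
have [|J [uJ JL]] := IH (i :: Y).
  by rewrite uniq_catC /= mem_cat negb_or iY iL uniq_catC.
have -> : W `|` [set z | z \in map y (i :: Y)] = B `|` [set z | z \in [:: y i]].
  apply/seteqP; split=> z /=; rewrite !inE.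
    by move=> [|/orP[]]; [left; left|right|left; right].
  by move=> [[|]|]; [left|right; apply/orP; right|right; apply/orP; left].
set B1 := B `|` _ => hJ.
have E s : rk B (y i :: s) = (rk B1 s + rk B [:: y i])%N.
  rewrite -rk_cat; apply: rk_eq => z; rewrite mem_cat !inE orbC //.
rewrite [map y (i :: L)]map_cons E.
set FJ := flatten _ in hJ.
have EJ := E FJ; rewrite [LHS]/= in EJ.
case: (asboolP (acl (B `|` [set z | z \in FJ]) (y i))) EJ => [h|nh] /= EJ.
  (* [X i] is already spanned, so it can be added to the chosen blocks *)
  exists (i :: J); split=> /=.
  - by rewrite uJ andbT; apply: contra iL; exact: JL.
  - by move=> j; rewrite !inE => /orP[->//|/JL->]; rewrite orbT.
  have -> : rk B (X i ++ flatten [seq X j | j <- J]) = rk B FJ.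
    apply/eqP; rewrite eqn_leq !rk_le // => z.
      by move=> zJ; apply: sub_acl; right; rewrite /= mem_cat zJ orbT.
    rewrite mem_cat => /orP[zi|zJ]; last by apply: sub_acl; right.
    exact: free iY h _ zi.
  by move: hJ EJ; rewrite /=; lia.
exists J; split=> //; first by move=> j /JL; rewrite inE => ->; rewrite orbT.
have nB : ~ acl (B `|` [set z | z \in [::]]) (y i).
  by apply: contra_not nh; apply: aclS => z [|//]; left.
by move: hJ EJ; rewrite /= (asboolF nB) /=; rewrite -/FJ; lia.
Qed.

End Subfield.

(** * Independent functions from chains of closed sets *)

Section ChainUpper.
Variables (F : fieldType) (T : Type) (cl : set (set T)) (Y O : set T).
Variable A : set (T -> F).
Hypothesis A_poly : forall n (g : 'I_n -> T -> F) (P : {mpoly F[n]}),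
  (forall i, A (g i)) -> A (fun x => P.@[fun i => g i x]).
Hypothesis A_zero : forall g, A g ->
  exists2 G, cl G & forall x, Y x -> (G x <-> (O x -> g x = 0)).
Hypothesis A_sep : forall Z x, closed_in cl Y Z -> Y x -> O x -> ~ Z x ->
  exists g, [/\ A g, forall z, Z z -> O z -> g z = 0 & g x != 0].

(** A function vanishing on [Z m] but not on [Z m.+1] is transcendental over
    functions that stay independent on [Z m]: in a relation, divided by the
    highest power of the new function, the constant term survives on [Z m]. *)
Lemma alg_indep_of_chain m (Z : nat -> set T) :
  (forall j, (j <= m)%N -> closed_in cl Y (Z j) /\ irreducible_set cl (Z j)) ->
  (forall j, (j < m)%N -> Z j `<` Z j.+1) ->
  (exists2 x, Z 0%N x & O x) ->
  exists g : 'I_m -> T -> F, (forall i, A (g i)) /\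
    forall P : {mpoly F[m]}, P != 0 -> exists x, [/\ Z m x, O x & P.@[fun i => g i x] != 0].
Proof.
elim: m => [|m IH] Zc Zs [x0 Z0 O0].
  exists (fun _ _ => 0); split=> [[]//|P P0]; exists x0; split=> //.
  rewrite (nvar0_mpolyC P) mevalC.
  by apply: contraNneq P0 => e; rewrite (nvar0_mpolyC P) e mpolyC0.
have [j jm|j jm||g [Ag ig]] := IH.
- by apply: Zc; rewrite leqW.
- by apply: Zs; rewrite ltnW.
- by exists x0.
have [[B cB ZB] _] := Zc m (leqnSn m).
have [[C cC ZC] [_ irr]] := Zc m.+1 (leqnn _).
have [Zmm nZ] := Zs m (ltnSn m).
have ZY x : Z m.+1 x -> Y x by rewrite ZC => -[].
have A1 : A (fun=> 1).
  rewrite (_ : (fun=> 1) = fun x : T => (1 : {mpoly F[0]}).@[fun i => (fun _ _ => 0) i x]).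
    by apply: A_poly => -[].
  by apply/funext => x; rewrite meval1.
have Z0m x : Z 0%N x -> Z m.+1 x.
  have : forall j, (j <= m.+1)%N -> Z 0%N `<=` Z j; last by apply.
  elim=> [_ //|j IHj jm]; apply: (@subset_trans _ (Z j)); first by apply: IHj; rewrite ltnW.
  by case: (Zs j jm).
have [x [Zx Ox nZx]] : exists x, [/\ Z m.+1 x, O x & ~ Z m x].
  apply: contrapT => /forallNP nx.
  have [G cG GP] := A_zero A1.
  have [x Zx|h|h] := irr B G cB cG.
  - have [Zmx|Zmx] := pselect (Z m x); first by left; move: Zmx; rewrite ZB => -[].
    right; apply/GP; first exact: ZY.
    by move=> Ox; case: (nx x).
  - by apply: nZ => x Zx; rewrite ZB; split; [exact: ZY|exact: h].
  - have /GP/(_ O0)/eqP := h x0 (Z0m _ Z0); first by move/(_ (ZY _ (Z0m _ Z0))); rewrite oner_eq0.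
have [h [Ah hZ hx]] : exists g, [/\ A g, forall z, Z m z -> O z -> g z = 0 & g x != 0].
  apply: A_sep => //; first by exists B.
  exact: ZY.
have Agh i : A (ord_rcons g h i) by rewrite /ord_rcons; case: insub.
exists (ord_rcons g h); split=> // P P0.
have : muni P != 0 by rewrite muni_eq0.
have rE z : (fun i => ord_rcons g h i z) = ord_rcons (g^~ z) (h z).
  by apply/funext => i; rewrite /ord_rcons; case: insub.
have PE Q z : (poly_multi Q).@[ord_rcons (g^~ z) (h z)] =
    (map_poly (meval (g^~ z)) Q).[h z].
  by rewrite [LHS](@mmap_poly_multi _ _ _ idfun) ord_rcons_widen ord_rcons_max.
rewrite -[in X in _ -> X](muniK P); move: (muni P) => {P P0} Q; move sQ: (size Q) => n.
elim: n Q sQ => [|n IHn] Q sQ Q0; first by move: Q0; rewrite -size_poly_eq0 sQ.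
(* if the constant term is nonzero, restrict to [Z m], where [h] is zero;
   otherwise divide the relation by [h] *)
have [c0|c0] := eqVneq Q`_0 0; last first.
  have [z [Zz Oz hz]] := ig _ c0.
  exists z; split=> //; first exact: Zmm.
  by rewrite rE PE hZ // horner_coef0 coef_map.
have [Q1 QE] : exists Q1, Q = Q1 * 'X.
  have /factor_theorem[Q1 ->] : root Q 0 by rewrite rootE horner_coef0 c0.
  by exists Q1; rewrite subr0.
have Q10 : Q1 != 0 by apply: contraNneq Q0 => e; rewrite QE e mul0r.
have sQ1 : size Q1 = n by move: sQ; rewrite QE size_mulX // => -[].
have [z1 [Zz1 Oz1 hz1]] := IHn Q1 sQ1 Q10.
apply: contrapT => /forallNP nz.
pose phi z := (poly_multi Q1).@[fun i => ord_rcons g h i z].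
have Aphi : A phi by exact: A_poly.
have [G cG GP] := A_zero Aphi; have [H cH HP] := A_zero Ah.
have [z Zz|hG|hH] := irr G H cG cH.
- have Yz := ZY _ Zz; have [Oz|nOz] := pselect (O z); last by left; apply/GP.
  have : phi z * h z = 0.
    apply: contrapT => /eqP e; case: (nz z); split=> //; move: e.
    by rewrite /phi rE !PE QE rmorphM /= map_polyX hornerM hornerX.
  by move/eqP; rewrite mulf_eq0 => /orP[]/eqP e; [left; apply/GP|right; apply/HP].
- have /GP/(_ Oz1) : G z1 by apply: hG.
  by move/(_ (ZY _ Zz1))/eqP; apply/negP.
- have /HP/(_ Ox) : H x by apply: hH.
  by move/(_ (ZY _ Zx))/eqP; apply/negP.
Qed.

End ChainUpper.

(** * Ultrapowers of a field *)

Section Ultrapower.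
Variables (T : Type) (F : fieldType) (U : set_system T).
Hypothesis UU : UltraFilter U.

Let FU : ProperFilter U. Proof. by case: UU. Qed.

Definition ueq (f g : T -> F) : Prop := U [set x | f x = g x].

Lemma ueq_refl f : ueq f f.
Proof. by apply: filterS filterT => x _. Qed.

Lemma ueq_sym f g : ueq f g -> ueq g f.
Proof. by apply: filterS => x /= ->. Qed.

Lemma ueq_trans f g h : ueq f g -> ueq g h -> ueq f h.
Proof. by move=> fg gh; apply: filterS (filterI fg gh) => x /= [-> ->]. Qed.

Definition ucanon (f : T -> F) : T -> F := xget (fun=> 0) (ueq f : set (T -> F)).

Lemma ucanonP f : ueq f (ucanon f).
Proof. by rewrite /ucanon; apply: xgetPex; exists f; exact: ueq_refl. Qed.

Lemma ucanon_eq f g : ueq f g -> ucanon f = ucanon g.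
Proof.
move=> fg; congr xget; apply/funext => h; apply/propext; split=> e.
  by apply: ueq_trans e; exact: ueq_sym.
exact: ueq_trans e.
Qed.

Lemma ucanonK f : ucanon (ucanon f) = ucanon f.
Proof. by apply: ucanon_eq; apply: ueq_sym; exact: ucanonP. Qed.

(** Elements of the ultrapower are represented by the functions that a choice
    of representatives fixes. *)
Definition ultrapower_of of UltraFilter U : Type := {f : T -> F | ucanon f = f}.

Local Notation ultrapower := (ultrapower_of UU).

Definition upi (f : T -> F) : ultrapower := exist _ (ucanon f) (ucanonK f).

Lemma upi_eq f g : upi f = upi g <-> ueq f g.
Proof.
split=> [/(congr1 sval) /= e|/ucanon_eq e]; last exact: eq_exist.
by apply: ueq_trans (ucanonP f) _; rewrite e; apply: ueq_sym; exact: ucanonP.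
Qed.

Lemma upi_sval k : upi (sval k) = k.
Proof. by case: k => f fE; exact: eq_exist. Qed.

HB.instance Definition _ := gen_eqMixin ultrapower.
HB.instance Definition _ := gen_choiceMixin ultrapower.

Definition ulift2 (op : F -> F -> F) (a b : ultrapower) : ultrapower :=
  upi (fun x => op (sval a x) (sval b x)).
Definition ulift1 (op : F -> F) (a : ultrapower) : ultrapower :=
  upi (fun x => op (sval a x)).

Lemma ulift2E op f g : ulift2 op (upi f) (upi g) = upi (fun x => op (f x) (g x)).
Proof.
apply/upi_eq; apply: filterS (filterI (ueq_sym (ucanonP f)) (ueq_sym (ucanonP g))).
by move=> x /= [-> ->].
Qed.

Lemma ulift1E op f : ulift1 op (upi f) = upi (fun x => op (f x)).
Proof. by apply/upi_eq; apply: filterS (ueq_sym (ucanonP f)) => x /= ->. Qed.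

Lemma upiW (P : ultrapower -> Prop) : (forall f, P (upi f)) -> forall k, P k.
Proof. by move=> h k; rewrite -(upi_sval k). Qed.

Fact uaddA : associative (ulift2 +%R).
Proof.
elim/upiW=> f; elim/upiW=> g; elim/upiW=> h; rewrite !ulift2E; congr upi.
by apply/funext => x; rewrite addrA.
Qed.
Fact uaddC : commutative (ulift2 +%R).
Proof.
elim/upiW=> f; elim/upiW=> g; rewrite !ulift2E; congr upi.
by apply/funext => x; rewrite addrC.
Qed.
Fact uadd0 : left_id (upi (fun=> 0)) (ulift2 +%R).
Proof. by elim/upiW=> f; rewrite ulift2E; congr upi; apply/funext => x; rewrite add0r. Qed.
Fact uaddN : left_inverse (upi (fun=> 0)) (ulift1 -%R) (ulift2 +%R).
Proof. by elim/upiW=> f; rewrite ulift1E ulift2E; congr upi; apply/funext => x; rewrite addNr. Qed.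

HB.instance Definition _ := GRing.isZmodule.Build ultrapower uaddA uaddC uadd0 uaddN.

Fact umulA : associative (ulift2 *%R).
Proof.
elim/upiW=> f; elim/upiW=> g; elim/upiW=> h; rewrite !ulift2E; congr upi.
by apply/funext => x; rewrite mulrA.
Qed.
Fact umulC : commutative (ulift2 *%R).
Proof.
elim/upiW=> f; elim/upiW=> g; rewrite !ulift2E; congr upi.
by apply/funext => x; rewrite mulrC.
Qed.
Fact umul1 : left_id (upi (fun=> 1)) (ulift2 *%R).
Proof. by elim/upiW=> f; rewrite ulift2E; congr upi; apply/funext => x; rewrite mul1r. Qed.
Fact umulD : left_distributive (ulift2 *%R) (ulift2 +%R).
Proof.
elim/upiW=> f; elim/upiW=> g; elim/upiW=> h; rewrite !ulift2E; congr upi.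
by apply/funext => x; rewrite mulrDl.
Qed.
Fact unonzero : upi (fun=> 1) != upi (fun=> 0).
Proof.
apply/eqP => /upi_eq h; have := @filter_not_empty _ U FU; apply.
by apply: filterS h => x /eqP; rewrite oner_eq0.
Qed.

HB.instance Definition _ :=
  GRing.Zmodule_isComNzRing.Build ultrapower umulA umulC umul1 umulD unonzero.

Fact umulV : forall k : ultrapower, k != 0 -> ulift1 GRing.inv k * k = 1.
Proof.
elim/upiW=> f f0; rewrite ulift1E [LHS]ulift2E; apply/upi_eq.
have [h|h] := in_ultra_setVsetC [set x | f x = 0] UU.
  by case/eqP: f0; apply/upi_eq.
by apply: filterS h => x /= /eqP fx; rewrite mulVf.
Qed.
Fact uinv0 : ulift1 GRing.inv (0 : ultrapower) = 0.
Proof. by rewrite [LHS]ulift1E; congr upi; apply/funext => x; rewrite invr0. Qed.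

HB.instance Definition _ := GRing.ComNzRing_isField.Build ultrapower umulV uinv0.

Definition uconst (c : F) : ultrapower := upi (fun=> c).

Lemma upiD f g : upi (fun x => f x + g x) = upi f + upi g.
Proof. by rewrite [RHS]ulift2E. Qed.
Lemma upiM f g : upi (fun x => f x * g x) = upi f * upi g.
Proof. by rewrite [RHS]ulift2E. Qed.
Lemma upiN f : upi (fun x => - f x) = - upi f.
Proof. by rewrite [RHS]ulift1E. Qed.
Lemma upiV f : upi (fun x => (f x)^-1) = (upi f)^-1.
Proof. by rewrite [RHS]ulift1E. Qed.

Fact uconst_additive : additive uconst.
Proof. by move=> c d; rewrite /uconst -upiN -upiD. Qed.
Fact uconst_multiplicative : multiplicative uconst.
Proof. by split=> // c d; rewrite /uconst -upiM. Qed.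
HB.instance Definition _ := GRing.isAdditive.Build F ultrapower uconst uconst_additive.
HB.instance Definition _ :=
  GRing.isMultiplicative.Build F ultrapower uconst uconst_multiplicative.

Lemma upi_sum (I : Type) (r : seq I) (f : I -> T -> F) :
  upi (fun x => \sum_(i <- r) f i x) = \sum_(i <- r) upi (f i).
Proof.
elim: r => [|i r IH]; first by rewrite big_nil; congr upi; apply/funext => x; rewrite big_nil.
by rewrite big_cons -IH -upiD; congr upi; apply/funext => x; rewrite big_cons.
Qed.

Lemma upiX f n : upi (fun x => f x ^+ n) = upi f ^+ n.
Proof.
elim: n => [|n IH] //; rewrite exprS -IH -upiM; congr upi.
by apply/funext => x; rewrite exprS.
Qed.

Lemma mmap_upi n (g : 'I_n -> T -> F) (P : {mpoly F[n]}) :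
  mmap uconst (fun i => upi (g i)) P = upi (fun x => P.@[fun i => g i x]).
Proof.
elim/mpolyind: P => [|c m P _ _ IH].
  by rewrite mmap0; congr upi; apply/funext => x; rewrite meval0.
rewrite mmapD IH mmapZ mmapX /mmap1.
have -> : \prod_i upi (g i) ^+ m i = upi (fun x => \prod_i g i x ^+ m i).
  elim: (index_enum _) => [|i r IHr].
    by rewrite big_nil; congr upi; apply/funext => x; rewrite big_nil.
  by rewrite big_cons IHr -upiX -upiM; congr upi; apply/funext => x; rewrite big_cons.
rewrite -upiM -upiD; congr upi; apply/funext => x.
by rewrite mevalD mevalZ mevalX.
Qed.

End Ultrapower.

(** * The generic point of an irreducible set *)

(** Irreducibility of the closure of [D], in the form in which it is used. *)
Definition poly_irreducible (F : fieldType) N (D : set ('I_N -> F)) : Prop :=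
  D !=set0 /\ forall p r : {mpoly F[N]},
    (exists2 x, D x & p.@[x] != 0) -> (exists2 x, D x & r.@[x] != 0) ->
    exists2 x, D x & (p * r).@[x] != 0.

(** Nonempty principal open subsets of [D] form a filter base. *)
Lemma generic_ultrafilter (F : fieldType) N (D : set ('I_N -> F)) :
  poly_irreducible D -> exists U : set_system ('I_N -> F), UltraFilter U /\
    forall p : {mpoly F[N]}, (exists2 x, D x & p.@[x] != 0) -> U [set x | D x /\ p.@[x] != 0].
Proof.
move=> [[x0 Dx0] Dirr].
pose I := [set p : {mpoly F[N]} | exists2 x, D x & p.@[x] != 0].
pose B (p : {mpoly F[N]}) := [set x | D x /\ p.@[x] != 0].
have FB : ProperFilter (filter_from I B).
  apply: filter_from_proper; last by move=> p [x Dx px]; exists x.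
  apply: filter_from_filter; first by exists 1; exists x0; rewrite // meval1 oner_eq0.
  move=> p r Ip Ir; exists (p * r); first exact: Dirr.
  by move=> x [Dx]; rewrite mevalM mulf_eq0 negb_or => /andP[px rx].
have [U [UU BU]] := ultraFilterLemma FB.
by exists U; split=> // p Ip; apply: BU; exists p.
Qed.

(** A nonempty principal open subset has the same generic point. *)
Lemma poly_irreducible_open (F : fieldType) N (D : set ('I_N -> F)) (a : {mpoly F[N]}) :
  poly_irreducible D -> (exists2 x, D x & a.@[x] != 0) ->
  poly_irreducible [set x | D x /\ a.@[x] != 0].
Proof.
move=> [_ Dirr] [x0 Dx0 ax0]; split; first by exists x0.
move=> p r [x [Dx ax] px] [y [Dy ay] ry].
have [||z Dz] := Dirr (a * p) (a * r).
- by exists x; rewrite // mevalM mulf_neq0.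
- by exists y; rewrite // mevalM mulf_neq0.
rewrite !mevalM !mulf_eq0 !negb_or => /andP[/andP[az pz] /andP[_ rz]].
by exists z; rewrite // mevalM mulf_neq0.
Qed.

Lemma generic_open (F : fieldType) N (D : set ('I_N -> F)) (a : {mpoly F[N]})
    (U : set_system ('I_N -> F)) : UltraFilter U ->
  (forall p : {mpoly F[N]}, (exists2 x, D x & p.@[x] != 0) -> U [set x | D x /\ p.@[x] != 0]) ->
  let D' := [set x | D x /\ a.@[x] != 0] in
  forall p : {mpoly F[N]}, (exists2 x, D' x & p.@[x] != 0) -> U [set x | D' x /\ p.@[x] != 0].
Proof.
move=> UU UD D' p [x [Dx ax] px]; have FU : ProperFilter U by case: UU.
have : U [set x | D x /\ (a * p).@[x] != 0] by apply: UD; exists x; rewrite // mevalM mulf_neq0.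
by apply: filterS => y /= [Dy]; rewrite mevalM mulf_eq0 negb_or => /andP[].
Qed.

Section GenericField.
Variables (F : closedFieldType) (N : nat) (D : set ('I_N -> F)).
Local Notation pt := ('I_N -> F).
Hypothesis Dirr : poly_irreducible D.
Variables (U : set_system pt).
Hypothesis UU : UltraFilter U.
Hypothesis UD : forall p : {mpoly F[N]},
  (exists2 x, D x & p.@[x] != 0) -> U [set x | D x /\ p.@[x] != 0].

Local Notation kappa := (@upi _ F _ UU).

(** Principal open sets belong to the ultrafilter, so the class of a function
    is determined by its values on any of them. *)
Lemma kappa_eq_on (p : {mpoly F[N]}) f g : (exists2 x, D x & p.@[x] != 0) ->
  (forall x, D x -> p.@[x] != 0 -> f x = g x) -> kappa f = kappa g.
Proof.
move=> hp fg; apply/upi_eq; have FU : ProperFilter U by case: UU.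
by apply: filterS (UD hp) => x [Dx px]; exact: fg.
Qed.

Lemma kappa_neq0_on (p : {mpoly F[N]}) f : (exists2 x, D x & p.@[x] != 0) ->
  (forall x, D x -> p.@[x] != 0 -> f x != 0) -> kappa f != 0.
Proof.
move=> hp fn; apply/eqP => /upi_eq e; have FU : ProperFilter U by case: UU.
have [x [[Dx px] fx]] := filter_ex (filterI (UD hp) e).
by have := fn x Dx px; rewrite fx eqxx.
Qed.

Lemma kappa_eq f g : (forall x, D x -> f x = g x) -> kappa f = kappa g.
Proof.
move=> fg; have [[x0 Dx0] _] := Dirr.
apply: (@kappa_eq_on 1); first by exists x0; rewrite // meval1 oner_eq0.
by move=> x Dx _; exact: fg.
Qed.

Definition rational (f : pt -> F) : Prop :=
  exists a b : {mpoly F[N]}, forall x, D x -> b.@[x] != 0 /\ f x = a.@[x] / b.@[x].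

Lemma rational_poly (p : {mpoly F[N]}) : rational (fun x => p.@[x]).
Proof. by exists p, 1 => x _; rewrite meval1 oner_eq0 divr1. Qed.

Lemma rational_const c : rational (fun=> c).
Proof. by exists c%:MP, 1 => x _; rewrite meval1 mevalC oner_eq0 divr1. Qed.

Lemma rationalD f g : rational f -> rational g -> rational (fun x => f x + g x).
Proof.
move=> [a [b h]] [c [d k]]; exists (a * d + c * b), (b * d) => x Dx.
have [b0 ->] := h x Dx; have [d0 ->] := k x Dx.
by rewrite mevalD !mevalM mulf_neq0 // addf_div.
Qed.

Lemma rationalM f g : rational f -> rational g -> rational (fun x => f x * g x).
Proof.
move=> [a [b h]] [c [d k]]; exists (a * c), (b * d) => x Dx.
have [b0 ->] := h x Dx; have [d0 ->] := k x Dx.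
by rewrite !mevalM mulf_neq0 // mulf_div.
Qed.

Lemma rationalX f n : rational f -> rational (fun x => f x ^+ n).
Proof.
move=> hf; elim: n => [|n IH]; first exact: rational_const.
by under eq_fun do rewrite exprS; exact: rationalM.
Qed.

Lemma rational_sum (I : Type) (r : seq I) (f : I -> pt -> F) :
  (forall i, rational (f i)) -> rational (fun x => \sum_(i <- r) f i x).
Proof.
move=> hf; elim: r => [|i r IH].
  by under eq_fun do rewrite big_nil; exact: rational_const.
by under eq_fun do rewrite big_cons; exact: rationalD.
Qed.

Lemma rational_prod (I : Type) (r : seq I) (f : I -> pt -> F) :
  (forall i, rational (f i)) -> rational (fun x => \prod_(i <- r) f i x).
Proof.
move=> hf; elim: r => [|i r IH].
  by under eq_fun do rewrite big_nil; exact: rational_const.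
by under eq_fun do rewrite big_cons; exact: rationalM.
Qed.

Lemma rational_meval n (g : 'I_n -> pt -> F) (P : {mpoly F[n]}) :
  (forall i, rational (g i)) -> rational (fun x => P.@[fun i => g i x]).
Proof.
move=> hg; under eq_fun do rewrite mevalE.
apply: rational_sum => m; apply: rationalM; first exact: rational_const.
by apply: rational_prod => i; exact: rationalX.
Qed.

(** Otherwise its numerator would define a nonempty principal open set, on which
    the function has no zeros. *)
Lemma kappa_eq0 f : rational f -> kappa f = 0 -> forall x, D x -> f x = 0.
Proof.
move=> [a [b h]] f0 x Dx; apply: contrapT => /eqP fx.
have [b0 fE] := h x Dx.
have: kappa f != 0; last by rewrite f0 eqxx.
apply: (@kappa_neq0_on a).
  by exists x => //; apply: contraNneq fx; rewrite fE => ->; rewrite mul0r.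
by move=> y Dy ay; have [by0 ->] := h y Dy; rewrite mulf_neq0 // invr_eq0.
Qed.

Lemma kappa_neq0 f : rational f -> kappa f != 0 ->
  exists2 p : {mpoly F[N]}, (exists2 x, D x & p.@[x] != 0) &
    forall x, D x -> p.@[x] != 0 -> f x != 0.
Proof.
move=> [a [b h]] f0; exists a; last first.
  by move=> y Dy ay; have [by0 ->] := h y Dy; rewrite mulf_neq0 // invr_eq0.
apply: contrapT => na; case/eqP: f0; apply: kappa_eq => x Dx.
have [_ ->] := h x Dx; have [->|ax] := eqVneq a.@[x] 0; first by rewrite mul0r.
by case: na; exists x.
Qed.

Local Notation iota := (@uconst _ F _ UU).

Definition kvals (I : Type) (phi : I -> pt -> F) (l : seq I) : seq (ultrapower_of F UU) :=
  [seq kappa (phi e) | e <- l].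

(** The value of an algebraic relation between rational functions is again a
    rational function, so the relation holds at all points of [D]; it is
    nontrivial where one of its coefficients is nonzero. *)
Lemma acl_spread n (g : 'I_n -> pt -> F) z :
  (forall i, rational (g i)) -> rational z ->
  acl iota (range (fun i => kappa (g i))) (kappa z) ->
  exists (P : {poly {mpoly F[n]}}) (H : {mpoly F[N]}),
    [/\ forall x, D x -> root (map_poly (meval (g^~ x)) P) (z x),
        exists2 x, D x & H.@[x] != 0
      & forall x, D x -> H.@[x] != 0 -> map_poly (meval (g^~ x)) P != 0].
Proof.
move=> hg hz /acl_relation[P [P0 Pz]].
have [j Pj] : exists j, mmap iota (fun i => kappa (g i)) P`_j != 0.
  exists (size (map_poly (mmap iota (fun i => kappa (g i))) P)).-1.
  by move: P0; rewrite -lead_coef_eq0 lead_coefE coef_map.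
rewrite mmap_upi in Pj.
have [H H0 HP] := kappa_neq0 (rational_meval _ hg) Pj.
exists P, H; split=> // [x Dx|x Dx /(HP x Dx)]; last first.
  by apply: contraNneq => /polyP/(_ j); rewrite coef_map coef0 => /= ->.
have zE : kappa (fun x => \sum_(i < size P) (P`_i).@[g^~ x] * z x ^+ i) = 0.
  rewrite upi_sum; move: Pz; rewrite rootE (horner_coef_wide _ (size_poly _ _)) => /eqP.
  move=> Pz; rewrite -[RHS]Pz; apply: eq_bigr => i _.
  by rewrite upiM upiX coef_map /= mmap_upi.
rewrite rootE (horner_coef_wide _ (size_poly _ _)).
have := kappa_eq0 _ zE Dx; move=> /(_ _)/eqP e.
have {}e : \sum_(i < size P) (P`_i).@[g^~ x] * z x ^+ i == 0.
  apply: e; apply: rational_sum => i; apply: rationalM; last exact: rationalX.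
  exact: rational_meval.
by apply/eqP; rewrite -[RHS](eqP e); apply: eq_bigr => i _; rewrite coef_map.
Qed.

(** A relation that holds at all points survives any substitution that does not
    make it trivial. *)
Lemma acl_specialize n (g : 'I_n -> pt -> F) z :
  (forall i, rational (g i)) -> rational z ->
  acl iota (range (fun i => kappa (g i))) (kappa z) ->
  exists2 H : {mpoly F[N]}, (exists2 x, D x & H.@[x] != 0) &
  forall sigma : pt -> pt, (forall x, D x -> D (sigma x)) ->
    (forall f, rational f -> rational (f \o sigma)) ->
    (exists2 x, D x & H.@[sigma x] != 0) ->
    acl iota (range (fun i => kappa (g i \o sigma))) (kappa (z \o sigma)).
Proof.
move=> hg hz /(acl_spread hg hz)[P [H [Pz H0 PH]]]; exists H => // s sD sr [x Dx Hx].
have := PH _ (sD x Dx) Hx; rewrite -lead_coef_eq0 lead_coefE coef_map /=.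
set j := _.-1 => Pj.
exists (map_poly (mmap iota (fun i => kappa (g i \o s))) P); last split.
- apply/eqP => /polyP/(_ j); rewrite coef_map coef0 /= mmap_upi => e.
  move/eqP: Pj; apply.
  have := kappa_eq0 _ e Dx; apply; apply: rational_meval => i; exact: sr.
- by move=> i; rewrite coef_map; exact: mmap_gen_subfield.
rewrite rootE (horner_coef_wide _ (size_poly _ _)).
rewrite (_ : \sum_(i < _) _ = kappa (fun=> 0)) //.
transitivity (kappa (fun x => \sum_(i < size P) (P`_i).@[fun k => g k (s x)] * z (s x) ^+ i)).
  rewrite upi_sum; apply: eq_bigr => i _.
  by rewrite upiM upiX coef_map /= mmap_upi.
apply: kappa_eq => y Dy; have := Pz _ (sD y Dy).
rewrite rootE (horner_coef_wide _ (size_poly _ _)) => /eqP e; rewrite -[RHS]e.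
by apply: eq_bigr => i _; rewrite coef_map.
Qed.

End GenericField.

(** * Generic sections and Rado's formula *)

Section Glue.
Variables (T : Type) (m M : nat).

Definition vpart (x : 'I_(m + M) -> T) : 'I_m -> T := fun i => x (lshift M i).
Definition wpart (x : 'I_(m + M) -> T) : 'I_M -> T := fun r => x (rshift m r).
Definition glue (v : 'I_m -> T) (w : 'I_M -> T) : 'I_(m + M) -> T :=
  fun j => match fintype.split j with inl i => v i | inr r => w r end.

Lemma vpart_glue v w : vpart (glue v w) = v.
Proof.
by apply/funext => i; rewrite /vpart /glue -[lshift M i]/(unsplit (inl i)) unsplitK.
Qed.

Lemma wpart_glue v w : wpart (glue v w) = w.
Proof.
by apply/funext => i; rewrite /wpart /glue -[rshift m i]/(unsplit (inr i)) unsplitK.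
Qed.

Lemma glue_parts x : glue (vpart x) (wpart x) = x.
Proof.
apply/funext => j; rewrite /glue /vpart /wpart -[in RHS](fintype.splitK j).
by case: (fintype.split j).
Qed.

End Glue.

Lemma meval_comp (A : comNzRingType) n m (p : {mpoly A[n]}) (f : 'I_n -> {mpoly A[m]}) x :
  (p \mPo [tuple f i | i < n]).@[x] = p.@[fun i => (f i).@[x]].
Proof. by rewrite comp_mpoly_meval; apply: meval_eq => i; rewrite tnth_mktuple. Qed.

Section GenericSections.
Variables (F : closedFieldType) (m M k : nat).
Local Notation pt := ('I_(m + M) -> F).
Variables (D1 : set ('I_m -> F)) (h : 'I_M -> 'I_k) (piv : 'I_k -> 'I_M).
Hypothesis h_piv : forall i, h (piv i) = i.
Variable X : 'I_M -> ('I_m -> F) -> F.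
Hypothesis X_rat : forall r, exists a b : {mpoly F[m]},
  forall v, D1 v -> b.@[v] != 0 /\ X r v = a.@[v] / b.@[v].
Hypothesis X_piv : forall i v, D1 v -> X (piv i) v = 1.

Definition cyl : set pt := [set x | D1 (vpart x)].
Hypothesis cyl_irr : poly_irreducible cyl.

Definition wfun (r : 'I_M) (x : pt) : F := wpart x r.
Definition xfun (r : 'I_M) (x : pt) : F := X r (vpart x).
Definition blk (i : 'I_k) : pred 'I_M := fun r => (h r == i) && (r != piv i).
Definition yfun (i : 'I_k) (x : pt) : F := \sum_(r | blk i r) wfun r x * xfun r x.
(** Coefficients of the general system with a root: those of the pivots are
    determined by the others. *)
Definition ufun (r : 'I_M) (x : pt) : F :=
  if r == piv (h r) then - yfun (h r) x else wfun r x.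

Local Notation rat := (rational cyl).

Lemma rational_w r : rat (wfun r).
Proof.
rewrite (_ : wfun r = fun x => ('X_(rshift m r) : {mpoly F[m + M]}).@[x]).
  exact: rational_poly.
by apply/funext => x; rewrite mevalXU.
Qed.

Lemma rational_x r : rat (xfun r).
Proof.
have [a [b hab]] := X_rat r.
pose L (p : {mpoly F[m]}) := p \mPo [tuple ('X_(lshift M i) : {mpoly F[m + M]}) | i < m].
have LE p x : (L p).@[x] = p.@[vpart x].
  by rewrite meval_comp; apply: meval_eq => i; rewrite mevalXU.
by exists (L a), (L b) => x /hab; rewrite !LE.
Qed.

Lemma rational_y i : rat (yfun i).
Proof.
rewrite (_ : yfun i = fun x => \sum_r (fun x => (blk i r)%:R * (wfun r x * xfun r x)) x).
  apply: rational_sum => r; apply: rationalM; first exact: rational_const.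
  by apply: rationalM; [exact: rational_w|exact: rational_x].
apply/funext => x; rewrite /yfun big_mkcond /=; apply: eq_bigr => r _.
by case: ifP => _; rewrite ?mul1r ?mul0r.
Qed.

Definition setw (b : pred 'I_M) (c : 'I_M -> F) (x : pt) : pt :=
  glue (vpart x) (fun r => if b r then c r else wpart x r).

Lemma setw_cyl b c x : cyl x -> cyl (setw b c x).
Proof. by rewrite /cyl /= /setw vpart_glue. Qed.

Lemma setw_rat b c f : rat f -> rat (f \o setw b c).
Proof.
move=> [p [q hpq]].
pose s (j : 'I_(m + M)) : {mpoly F[m + M]} :=
  match fintype.split j with inl _ => 'X_j | inr r => if b r then (c r)%:MP else 'X_j end.
have sE (P : {mpoly F[m + M]}) x : (P \mPo [tuple s j | j < m + M]).@[x] = P.@[setw b c x].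
  rewrite meval_comp; apply: meval_eq => j; rewrite /s /setw /glue.
  case: fintype.splitP => i ji; first by rewrite mevalXU /vpart; congr x; exact: val_inj.
  case: ifP => _; first by rewrite mevalC.
  by rewrite mevalXU /wpart; congr x; exact: val_inj.
exists (p \mPo [tuple s j | j < m + M]), (q \mPo [tuple s j | j < m + M]) => x Dx.
by rewrite !sE; apply: hpq; exact: setw_cyl.
Qed.

Lemma xfun_setw b c r : xfun r \o setw b c = xfun r.
Proof. by apply/funext => x; rewrite /xfun /= /setw vpart_glue. Qed.

Lemma wfun_setw b c r : wfun r \o setw b c = if b r then (fun=> c r) else wfun r.
Proof. by apply/funext => x; rewrite /wfun /= /setw wpart_glue; case: ifP. Qed.

Lemma yfun_setw b c i : (forall r, blk i r -> ~~ b r) -> yfun i \o setw b c = yfun i.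
Proof.
move=> hb; apply/funext => x; apply: eq_bigr => r ir.
by rewrite -[xfun r (setw b c x)]/((xfun r \o setw b c) x) -[wfun r (setw b c x)]/((wfun r \o setw b c) x)
  wfun_setw xfun_setw (negbTE (hb r ir)).
Qed.

Lemma yfun_setw_blk c i : yfun i \o setw (blk i) c = fun x => \sum_(r | blk i r) c r * xfun r x.
Proof.
apply/funext => x; apply: eq_bigr => r ir.
by rewrite -[xfun r (setw _ c x)]/((xfun r \o setw (blk i) c) x) -[wfun r (setw _ c x)]/((wfun r \o setw (blk i) c) x)
  wfun_setw xfun_setw ir.
Qed.

(** Along the line the polynomial is a nonzero polynomial in [t]; its product
    with [t] has a nonroot. *)
Lemma line_avoid N (H : {mpoly F[N]}) (x e : 'I_N -> F) : H.@[x] != 0 ->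
  exists2 t, t != 0 & H.@[fun j => x j + t * e j] != 0.
Proof.
move=> Hx; pose q : {poly F} := mmap (@polyC F) (fun j => (x j)%:P + (e j) *: 'X) H.
have qE t : q.[t] = H.@[fun j => x j + t * e j].
  rewrite /q; elim/mpolyind: H {Hx q} => [|c n p _ _ IH]; first by rewrite mmap0 meval0 horner0.
  rewrite mmapD mevalD hornerD IH mmapZ mevalZ hornerM hornerC mmapX mevalX; congr (_ * _ + _).
  rewrite /mmap1 horner_prod; apply: eq_bigr => j _.
  by rewrite horner_exp hornerD hornerC hornerZ hornerX mulrC.
have q0 : q != 0.
  apply: contraNneq Hx => q0; have := qE 0; rewrite q0 horner0 => e0.
  by rewrite [X in _ == X]e0; apply/eqP; apply: meval_eq => j; rewrite mul0r addr0.
have [t] := poly_avoid (mulf_neq0 q0 (negbT (polyX_eq0 F))).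
by rewrite hornerM hornerX mulf_eq0 negb_or qE => /andP[qt t0]; exists t.
Qed.

Variables (U : set_system pt).
Hypothesis UU : UltraFilter U.
Hypothesis UD : forall p : {mpoly F[m + M]},
  (exists2 x, cyl x & p.@[x] != 0) -> U [set x | cyl x /\ p.@[x] != 0].

Local Notation K := (@ultrapower_of _ F _ UU).
Local Notation kappa := (@upi _ F _ UU).
Local Notation iota := (@uconst _ F _ UU).
Local Notation acl := (acl iota).
Local Notation rk := (rk iota).
Local Notation kvals := (kvals UU).
Local Notation kset l := [set z : K | z \in l].

(** A nontrivial relation for [z] over the [phi e] stays nontrivial for almost
    all constants put in place of some of the coefficients. *)
Lemma acl_setw (I : eqType) (phi : I -> pt -> F) (l : seq I) z :
  (forall e, rat (phi e)) -> rat z -> acl (kset (kvals phi l)) (kappa z) ->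
  exists2 H : {mpoly F[m + M]}, (exists2 x, cyl x & H.@[x] != 0) &
  forall b c S, (exists2 x, cyl x & H.@[setw b c x] != 0) ->
    (forall e, e \in l -> acl S (kappa (phi e \o setw b c))) ->
    acl S (kappa (z \o setw b c)).
Proof.
move=> hphi hz hacl.
pose g (i : 'I_(size l)) := phi (tnth (in_tuple l) i).
have [||H H0 HP] := acl_specialize cyl_irr UD (g := g) _ hz _.
- by move=> i; exact: hphi.
- apply: aclS hacl => _ /= /mapP[e /(tnthP (in_tuple l))[i ->] ->].
  by exists i.
exists H => // b c S hx hS.
have := HP (setw b c) (fun x => @setw_cyl b c x) (fun f => @setw_rat b c f) hx.
by apply: acl_sub => _ [i _ <-]; apply: hS; exact: mem_tnth.
Qed.

(** If the generic combination [y i] is algebraic over functions that do not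
    involve its coefficients, so are its specializations at two sets of
    constants that differ only at [r]; their difference is a multiple of
    [x r]. *)
Lemma acl_yfun i (l : seq ('I_M + 'I_k + 'I_M)) :
  let phi e := match e with inl (inl r) => wfun r | inl (inr j) => yfun j | inr r => xfun r end in
  inl (inr i) \notin l -> acl (kset (kvals phi l)) (kappa (yfun i)) ->
  forall r, blk i r -> acl (kset (kvals phi l)) (kappa (xfun r)).
Proof.
move=> phi il hy r ir; set S := kset _ in hy *.
have hphi e : rat (phi e).
  by case: e => [[r'|j]|r']; [exact: rational_w|exact: rational_y|exact: rational_x].
have [H [x0 Dx0 Hx0] HP] := acl_setw hphi (rational_y i) hy.
have SF : is_subfield iota (acl S) := acl_subfield _ _.
have stable c e : e \in l -> acl S (kappa (phi e \o setw (blk i) c)).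
  case: e => [[s|j]|s] el; have := el; rewrite /phi.
  - rewrite wfun_setw; case: ifP => _ _; first by case: SF => hc _ _; exact: hc.
    by apply: sub_acl; apply/mapP; exists (inl (inl s)).
  - move=> _; rewrite yfun_setw; first by apply: sub_acl; apply/mapP; exists (inl (inr j)).
    move=> s /andP[/eqP hs _]; rewrite /blk hs negb_and; apply/orP; left.
    by apply: contraNneq il => <-.
  - move=> _; rewrite xfun_setw; by apply: sub_acl; apply/mapP; exists (inr s).
pose y c : pt -> F := fun x => \sum_(s | blk i s) c s * xfun s x.
have hyc c : H.@[setw (blk i) c x0] != 0 -> acl S (kappa (y c)).
  by move=> hc; rewrite /y -yfun_setw_blk; apply: HP => [|e]; [exists x0|exact: stable].
pose e := glue (fun=> 0 : F) (fun s : 'I_M => (s == r)%:R) : pt.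
have [t t0 Ht] := line_avoid e Hx0.
pose c s := wpart x0 s + t * (s == r)%:R.
have h1 : acl S (kappa (y c)).
  apply: hyc; rewrite (_ : setw _ _ _ = (fun j => x0 j + t * e j)) //.
  rewrite -[RHS]glue_parts /setw; congr glue; apply/funext => s.
    by rewrite /vpart /e -/(vpart (glue (fun=> 0 : F) (fun s : 'I_M => (s == r)%:R) : pt) s) vpart_glue mulr0 addr0.
  rewrite /c /wpart /e -/(wpart (glue (fun=> 0 : F) (fun s : 'I_M => (s == r)%:R) : pt) s) wpart_glue.
  case: ifP => // /negbT ns; rewrite (_ : s == r = false) ?mulr0 ?addr0 //.
  by apply/negbTE; apply: contraNneq ns => ->.
have h0 : acl S (kappa (y (wpart x0))).
  apply: hyc; rewrite (_ : setw _ _ _ = x0) // -[RHS]glue_parts /setw.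
  by congr glue; apply/funext => s; case: ifP.
have E : kappa (xfun r) = (kappa (y c) - kappa (y (wpart x0))) / iota t.
  rewrite -upiN -upiD -[(iota t)^-1]upiV -upiM; congr upi; apply/funext => x.
  rewrite /y -sumrB (bigD1 r) //= big1 ?addr0.
    by rewrite /c eqxx mulr1 -mulrBl addrAC subrr add0r mulrAC divff // mul1r.
  move=> s /andP[_ sr]; rewrite /c (negPf sr) mulr0 addr0 subrr //.
rewrite E; case: SF => hC hB hD; apply: (hD); [exact: (hB _ _ h1 h0)|exact: hC].
Qed.

Definition nonpiv : seq 'I_M := [seq r <- enum 'I_M | r != piv (h r)].

Lemma size_nonpiv : (size nonpiv + k)%N = M.
Proof.
have pinj : injective piv by move=> i j e; rewrite -(h_piv i) e h_piv.
rewrite /nonpiv size_filter -sum1_count big_enum_cond /= sum1_card.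
have -> : k = #|[pred r | r == piv (h r)]|.
  rewrite -{1}(card_ord k) -(card_codom pinj); apply: eq_card => r; rewrite inE.
  by apply/codomP/eqP => [[i ->]|->]; [rewrite h_piv|exists (h r)].
rewrite addnC -[RHS]card_ord -(cardC [pred r : 'I_M | r == piv (h r)]).
by congr (_ + _)%N; apply: eq_card => r; rewrite !inE.
Qed.

(** All coefficients may be specialized, and this does not affect [z]. *)
Lemma acl_wfun l (z : pt -> F) : rat z -> (forall b c, z \o setw b c = z) ->
  forall l' : seq 'I_M, acl (kset (kvals wfun l) `|` kset (kvals xfun l')) (kappa z) ->
  acl (kset (kvals xfun l')) (kappa z).
Proof.
move=> rz zs l' hz.
pose phi (e : 'I_M + 'I_M) := match e with inl r => wfun r | inr r => xfun r end.
have hphi e : rat (phi e) by case: e => r; [exact: rational_w|exact: rational_x].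
have [|H [x0 Dx0 Hx0] HP] := acl_setw (l := map inl l ++ map inr l') hphi rz.
  apply: aclS hz => u; rewrite /= /kvals map_cat mem_cat -!map_comp.
  by move=> [|] ->; rewrite ?orbT.
rewrite -(zs xpredT (wpart x0)); apply: HP; first by exists x0; rewrite // /setw glue_parts.
have SF := acl_subfield iota (kset (kvals xfun l')).
move=> e; rewrite mem_cat => /orP[/mapP[r _ ->]|/mapP[r rl ->]] /=.
  by rewrite wfun_setw; case: SF => hc _ _; exact: hc.
by rewrite xfun_setw; apply: sub_acl; exact: map_f.
Qed.

(** A relation of [wfun r] over the others would give, at some point, a nonzero
    polynomial with all elements of [F] as roots, because the coordinate [r]
    varies freely. *)
Lemma rk_wfun (l : seq 'I_M) : uniq l -> rk set0 (kvals wfun l) = size l.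
Proof.
elim: l => //= r l IH /andP[rl ul]; rewrite IH // asboolF ?add1n //.
rewrite set0U => hacl.
pose g (i : 'I_(size l)) := wfun (tnth (in_tuple l) i).
have [|||P [H [Pz [x0 Dx0 Hx0] PH]]] := acl_spread cyl_irr UD (g := g) (z := wfun r).
- by move=> i; exact: rational_w.
- exact: rational_w.
- apply: aclS hacl => _ /= /mapP[e /(tnthP (in_tuple l))[i ->] ->].
  by exists i.
have [t] := poly_avoid (PH _ Dx0 Hx0); rewrite -rootE => /negP; apply.
pose x := setw (pred1 r) (fun=> t) x0.
have := Pz x (setw_cyl _ _ Dx0).
have -> : (g^~ x) = (g^~ x0).
  apply/funext => i; rewrite /g -[wfun _ x]/((wfun _ \o setw _ _) x0) wfun_setw /=.
  by case: eqP => // e; move: rl; rewrite -e mem_tnth.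
by rewrite -[wfun r x]/((wfun _ \o setw _ _) x0) wfun_setw /= eqxx.
Qed.

Definition tau_rk (J : {set 'I_k}) : nat :=
  rk set0 (kvals xfun [seq r <- enum 'I_M | h r \in J]).
Definition u_rk : nat := rk set0 (kvals ufun (enum 'I_M)).

Lemma ufun_piv i : ufun (piv i) = fun x => - yfun i x.
Proof. by apply/funext => x; rewrite /ufun h_piv eqxx. Qed.

Lemma kappa_yfun i : kappa (yfun i) = \sum_(r | blk i r) kappa (wfun r) * kappa (xfun r).
Proof.
rewrite (_ : yfun i = fun x => \sum_(r <- [seq r <- index_enum 'I_M | blk i r]) (wfun r x * xfun r x)).
  by rewrite upi_sum big_filter; apply: eq_bigr => r _; rewrite upiM.
by apply/funext => x; rewrite big_filter.
Qed.

Lemma acl_bigsum (S : set K) (I : finType) (P : pred I) (f : I -> K) :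
  (forall r, P r -> acl S (f r)) -> acl S (\sum_(r | P r) f r).
Proof.
have SF := acl_subfield iota S.
move=> hf; elim/big_ind: _ => //; first exact: (is_subfield0 SF).
by move=> x y; exact: (is_subfieldD SF).
Qed.

(** The [ufun r] are polynomials in the coefficients off the pivots, the [x r]
    of the blocks in [J] and the [y i] of the other blocks. *)
Lemma u_rk_le (J : {set 'I_k}) : (u_rk + #|J| <= M + tau_rk J)%N.
Proof.
pose lx := kvals xfun [seq r <- enum 'I_M | h r \in J].
pose lw := kvals wfun nonpiv.
pose ly := kvals yfun (enum (~: J)).
have hle : (u_rk <= rk set0 ((lw ++ ly) ++ lx))%N.
  apply: rk_le => _ /mapP[r _ ->]; rewrite set0U; set S := kset _.
  have SF := acl_subfield iota S.
  rewrite /ufun; case: eqP => [e|/eqP ne].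
    have sub : acl S (kappa (yfun (h r))).
      have [hJ|hJ] := boolP (h r \in J); last first.
        have E : kappa (yfun (h r)) \in ly.
          by apply/mapP; exists (h r); rewrite // mem_enum finset.in_setC.
        by apply: sub_acl; rewrite /S /= !mem_cat E ?orbT.
      rewrite kappa_yfun; apply: acl_bigsum => s /andP[/eqP hs sp].
      have E1 : kappa (wfun s) \in lw.
        by apply: map_f; rewrite mem_filter mem_enum andbT hs.
      have E2 : kappa (xfun s) \in lx.
        by apply: map_f; rewrite mem_filter mem_enum andbT hs.
      by apply: (is_subfieldM SF); apply: sub_acl; rewrite /S /= !mem_cat ?E1 ?E2 ?orbT.
    rewrite upiN -sub0r; case: (SF) => _ hB _; apply: (hB) => //; exact: is_subfield0 SF.
  have E : kappa (wfun r) \in lw by apply: map_f; rewrite mem_filter ne mem_enum.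
  by apply: sub_acl; rewrite /S /= !mem_cat E.
have := rk_size iota (set0 `|` kset lx) (lw ++ ly).
move: hle; rewrite rk_cat -/(tau_rk J) size_cat !size_map -cardE.
have := size_nonpiv; have := cardsC J; rewrite card_ord; have aux (a b n s N u c t : nat) : (a + b = n -> s + n = N -> u <= c + t ->
    c <= s + b -> u + a <= N + t)%N by lia.
exact: aux.
Qed.

(** The set [J] comes from [rk_generic], applied over the coefficients off the
    pivots; these are independent and do not change the rank of the [x r]. *)
Lemma u_rk_ge : exists J : {set 'I_k}, (M + tau_rk J <= u_rk + #|J|)%N.
Proof.
pose W := kset (kvals wfun nonpiv).
pose XX i := kvals xfun [seq r <- enum 'I_M | blk i r].
have [||J [uJ _ hJ]] := @rk_generic F K iota _ XX (fun i => kappa (yfun i)) W _ (enum 'I_k) [::].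
- move=> i Y J iY S hy x /mapP[r]; rewrite mem_filter => /andP[ir _] ->.
  pose l : seq ('I_M + 'I_k + 'I_M) := map (inl \o inl) nonpiv ++ map (inl \o inr) Y ++
    map inr (flatten [seq [seq r <- enum 'I_M | blk i r] | i <- J]).
  have SE : S = kset (kvals (fun e => match e with inl (inl r) => wfun r
      | inl (inr j) => yfun j | inr r => xfun r end) l).
    apply/seteqP; rewrite /S /W /l /kvals; split=> u /=;
      rewrite !map_cat !mem_cat -!map_comp map_flatten -map_comp.
      by move=> [[|]|] ->; rewrite ?orbT.
    by move=> /orP[->|/orP[->|->]]; [left; left|left; right|right].
  rewrite SE in hy *; apply: acl_yfun hy _ ir.
  rewrite /l !mem_cat !negb_or; apply/and3P; split.
  - by apply/mapP => -[].
  - by apply/mapP => -[j jY [ij]]; move: iY; rewrite ij jY.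
  - by apply/mapP => -[].
- by rewrite cats0 enum_uniq.
rewrite size_enum_ord in hJ.
have BE : W `|` kset (map (fun i => kappa (yfun i)) [::]) = W.
  by apply/seteqP; split=> u /=; [move=> []|left].
rewrite BE in hJ; exists [set i in J].
set lx := flatten _ in hJ.
have tauE : tau_rk [set i in J] = rk set0 lx.
  have one i : kappa (xfun (piv i)) = iota 1.
    have e : forall x, cyl x -> xfun (piv i) x = (fun=> 1) x by move=> x; exact: X_piv.
    exact: (kappa_eq cyl_irr UU UD e).
  apply/eqP; rewrite eqn_leq !rk_le // => z.
    move=> /flattenP[_ /mapP[i iJ ->] /mapP[r]]; rewrite mem_filter => /andP[/andP[/eqP hr _] _] ->.
    apply: sub_acl; right; apply/mapP; exists r => //.
    by rewrite mem_filter mem_enum andbT inE hr.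
  move=> /mapP[r]; rewrite mem_filter inE => /andP[hrJ _] ->.
  have [/eqP rp|np] := boolP (r == piv (h r)).
    have [hc _ _] := acl_subfield iota (set0 `|` kset lx).
    by rewrite rp one; exact: hc.
  apply: sub_acl; right; apply/flattenP; exists (XX (h r)); first exact: map_f.
  by apply: map_f; rewrite mem_filter mem_enum andbT /blk eqxx np.
have lxE : exists l', lx = kvals xfun l'.
  exists (flatten [seq [seq r <- enum 'I_M | blk i r] | i <- J]).
  by rewrite /lx /kvals map_flatten -map_comp.
have tauW : (rk set0 lx <= rk W lx)%N.
  case: lxE => l' ->; elim: l' => //= r l' IH; apply: leq_add IH.
  case: asboolP => //= n1; case: asboolP => //= n2; case: n1; rewrite set0U.
  apply: acl_wfun n2; first exact: rational_x.
  by move=> b c; exact: xfun_setw.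
have uW : (rk W [seq kappa (yfun i) | i <- enum 'I_k] + size nonpiv <= u_rk)%N.
  rewrite -(rk_wfun (filter_uniq _ (enum_uniq _))) -(set0U W) -rk_cat.
  apply: rk_le => z; rewrite set0U mem_cat => /orP[/mapP[i _ ->]|/mapP[r]].
    set S := kset _; have SF := acl_subfield iota S.
    have : acl S (kappa (ufun (piv i))) by apply: sub_acl; apply: map_f; rewrite mem_enum.
    rewrite ufun_piv upiN => hN; rewrite -[kappa _]opprK -sub0r; case: (SF) => _ hB _.
    by apply: (hB) => //; exact: is_subfield0 SF.
  rewrite mem_filter => /andP[np _] ->; apply: sub_acl; apply/mapP; exists r; rewrite ?mem_enum //.
  by congr upi; apply/funext => x; rewrite /ufun (negPf np).
rewrite tauE cardsE (card_uniqP uJ).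
have aux (a b c n s N t u : nat) : (a + n <= b + c -> b + s <= u -> t <= a ->
    s + n = N -> N + t <= u + c)%N by lia.
exact: aux hJ uW tauW size_nonpiv.
Qed.

End GenericSections.

(** * Closed sets and regular functions in projective space *)

Section Projective.
Variables (R : realType) (n : nat).
Local Notation C := (R[i]).
Local Notation P := (proj_space R n).
Local Notation pclosed := (@proj_closed R n).

Lemma hcoordZl (x : P) (c : C) v : c != 0 -> hcoord x v -> hcoord x (c *: v).
Proof. by move=> c0 [xv v0]; split; [exact: memvZ|rewrite scaler_eq0 negb_or c0]. Qed.

Lemma hcoord_ex (x : P) : exists v : 'rV[C]_n.+1, hcoord x v.
Proof.
have xn0 : val x != 0%VS by rewrite -dimv_eq0 (eqP (valP x)).
by exists (vpick (val x)); split; rewrite ?memv_pick ?vpick0.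
Qed.

Lemma hcoord_inj (x y : P) v : hcoord x v -> hcoord y v -> x = y.
Proof.
move=> [xv v0] [yv _]; apply: val_inj.
have H (z : P) : v \in val z -> val z = <[v]>%VS.
  by move=> zv; apply/esym/eqP; rewrite eqEdim -memvE zv (eqP (valP z)) dim_vline v0.
by rewrite (H x xv) (H y yv).
Qed.

Lemma hcoord_line (v : 'rV[C]_n.+1) : v != 0 -> exists x : P, hcoord x v.
Proof.
move=> v0; have d : \dim <[v]>%VS == 1%N by rewrite dim_vline v0.
by exists (exist (fun x : {vspace 'rV[C]_n.+1} => \dim x == 1%N) _ d); split; rewrite //= memv_line.
Qed.

Lemma homog_eq0 d (p : {mpoly C[n.+1]}) (x : P) u v : p \is d.-homog ->
  hcoord x u -> hcoord x v -> p.@[u 0] = 0 -> p.@[v 0] = 0.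
Proof.
move=> hp xu xv pu; have [c _ ->] := hcoordZ xv xu.
by rewrite (homog_mevalZ _ _ hp) pu mulr0.
Qed.

Lemma homog_neq0 d (p : {mpoly C[n.+1]}) (x : P) u v : p \is d.-homog ->
  hcoord x u -> hcoord x v -> p.@[u 0] != 0 -> p.@[v 0] != 0.
Proof. by move=> hp xu xv; apply: contraNneq => h; apply/eqP; exact: homog_eq0 hp xv xu h. Qed.

Lemma proj_closed_bigcap (I : Type) (A : I -> set P) :
  (forall i, pclosed (A i)) -> pclosed [set x | forall i, A i x].
Proof.
move=> cA; exists [set p | exists i d, p \is d.-homog /\
    forall x, A i x -> forall v, hcoord x v -> p.@[v 0] = 0]; split.
  by move=> p [i [d [hp _]]]; exists d.
apply/seteqP; split=> x /=.
  by move=> h p [i [d [_ hp]]] v xv; exact: (hp x (h i)).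
move=> h i; have [S [hS AE]] := cA i; rewrite AE => p Sp v xv.
have [d hp] := hS p Sp; apply: h xv; exists i, d; split=> // y.
by rewrite AE => Ay w yw; exact: Ay.
Qed.

Lemma proj_closed_homog d (p : {mpoly C[n.+1]}) : p \is d.-homog ->
  pclosed [set x | forall v, hcoord x v -> p.@[v 0] = 0].
Proof.
move=> hp; exists [set p]; split; first by move=> _ ->; exists d.
by apply/seteqP; split=> x /= h; [move=> _ ->|exact: h].
Qed.

Lemma proj_closed_avoid (Z : set P) x : pclosed Z -> ~ Z x ->
  exists p d, [/\ p \is d.-homog,
    forall y, Z y -> forall v, hcoord y v -> p.@[v 0] = 0
    & forall v, hcoord x v -> p.@[v 0] != 0].
Proof.
move=> [S [hS ->]] /existsNP[p /not_implyP[Sp /existsNP[v /not_implyP[xv /eqP pv]]]].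
have [d hp] := hS p Sp; exists p, d; split=> // [y Zy w yw|w xw]; first exact: Zy.
exact: homog_neq0 hp xv xw pv.
Qed.

(** The condition bears on whole lines, hence on all homogeneous components. *)
Lemma proj_closed_poly (p : {mpoly C[n.+1]}) :
  pclosed [set x | forall v, hcoord x v -> p.@[v 0] = 0].
Proof.
pose pd d := pihomog mdeg d p.
have -> : [set x | forall v : 'rV[C]_n.+1, hcoord x v -> p.@[v 0] = 0] =
    [set x | forall d, [set x | forall v : 'rV[C]_n.+1, hcoord x v -> (pd d).@[v 0] = 0] x].
  have pE : p = \sum_(d < msize p) pd d by apply: pihomog_partitionE.
  apply/seteqP; split=> x /= h; last first.
    by move=> v xv; rewrite pE raddf_sum /= big1 // => d _; exact: h.
  (* along the line through [v] the polynomial has coefficients [(pd d).@[v 0]];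
     the factor ['X] discards the origin *)
  move=> d v xv; pose q : {poly C} := \poly_(d < msize p) (pd d).@[v 0].
  have qE c : q.[c] = p.@[(c *: v) 0].
    rewrite /q horner_poly [in RHS]pE raddf_sum /=; apply: eq_bigr => e _.
    by rewrite (homog_mevalZ _ _ (pihomogP _ _ _)) mulrC.
  have q0 : q * 'X = 0.
    apply/eqP; apply: contraT => /closed_nonrootP[c].
    rewrite rootE hornerM hornerX mulf_eq0 negb_or => /andP[+ c0].
    by rewrite qE h ?eqxx //; exact: hcoordZl.
  have {q0} : q = 0 by apply/eqP; move/eqP: q0; rewrite mulf_eq0 polyX_eq0 orbF.
  move/polyP/(_ d); rewrite coef_poly coef0; case: ltnP => // dp _.
  rewrite (_ : pd d = 0) ?meval0 // /pd pihomogE big_seq_cond big1 // => m /andP[mp /eqP md].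
  by have := msize_mdeg_lt mp; rewrite md ltnNge dp.
by apply: proj_closed_bigcap => d; apply: (@proj_closed_homog d); exact: pihomogP.
Qed.

Lemma regular_on_cst (U : set P) (c : C) : regular_on U (fun=> c).
Proof.
move=> x _; exists set0, 0%N, c%:MP, 1; split=> //; first exact: proj_closed0.
- by rewrite -[c%:MP]mulr1 mul_mpolyC; apply: rpredZ; exact: dhomog1.
- exact: dhomog1.
by move=> y v _ _ _; rewrite meval1 mevalC divr1 oner_neq0.
Qed.

Lemma regular_onD (U : set P) (f f' : P -> C) :
  regular_on U f -> regular_on U f' -> regular_on U (fun x => f x + f' x).
Proof.
move=> rf rf' x Ux; have [Z [d [g [h [cZ Zx gd hd H]]]]] := rf x Ux.
have [Z' [d' [g' [h' [cZ' Zx' gd' hd' H']]]]] := rf' x Ux.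
exists (Z `|` Z'), (d + d')%N, (g * h' + g' * h), (h * h'); split.
- exact: proj_closedU.
- by case.
- by apply: rpredD; [exact: dhomogM|rewrite addnC; exact: dhomogM].
- exact: dhomogM.
move=> y v Uy /not_orP[nZ nZ'] yv; have [h0 ->] := H _ _ Uy nZ yv.
have [h0' ->] := H' _ _ Uy nZ' yv.
by rewrite mevalD !mevalM mulf_neq0 // addf_div.
Qed.

Lemma regular_on_div (U : set P) (f f' : P -> C) :
  regular_on U f -> regular_on U f' -> (forall x, U x -> f' x != 0) ->
  regular_on U (fun x => f x / f' x).
Proof.
move=> rf rf' nf x Ux; have [Z [d [g [h [cZ Zx gd hd H]]]]] := rf x Ux.
have [Z' [d' [g' [h' [cZ' Zx' gd' hd' H']]]]] := rf' x Ux.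
exists (Z `|` Z'), (d + d')%N, (g * h'), (h * g'); split.
- exact: proj_closedU.
- by case.
- exact: dhomogM.
- exact: dhomogM.
move=> y v Uy /not_orP[nZ nZ'] yv; have [h0 ->] := H _ _ Uy nZ yv.
have [h0' f'E] := H' _ _ Uy nZ' yv; have := nf y Uy; rewrite f'E.
rewrite mulf_eq0 negb_or => /andP[g0 _].
by rewrite !mevalM mulf_neq0 // invf_div mulf_div.
Qed.

Lemma regular_on_meval (U : set P) m (f : 'I_m -> P -> C) (p : {mpoly C[m]}) :
  (forall i, regular_on U (f i)) -> regular_on U (fun x => p.@[fun i => f i x]).
Proof.
move=> rf; elim/mpolyind: p => [|c e p _ _ IH].
  by apply: (regular_on_eq _ (@regular_on_cst U 0)) => x _; rewrite meval0.
have rp : regular_on U (fun x => \prod_i f i x ^+ e i).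
  apply: (@regular_on_prod _ _ _ _ (fun i x => f i x ^+ e i)) => i.
  elim: (e i) => [|j IHj]; first exact: regular_on1.
  by apply: (regular_on_eq _ (regular_onM (rf i) IHj)) => x _; rewrite exprS.
apply: (regular_on_eq _ (regular_onD (regular_onM (@regular_on_cst U c) rp) IH)).
by move=> x _; rewrite mevalD mevalZ mevalX.
Qed.

Variable X : set P.
Hypothesis Xirr : irreducible_set pclosed X.

Lemma open_in_meet (U V : set P) : open_in X U -> open_in X V ->
  U !=set0 -> V !=set0 -> exists2 x, U x & V x.
Proof.
move=> [A cA ->] [B cB ->] [x [Xx nAx]] [y [Xy nBy]]; apply: contrapT => nxy.
have [_ /(_ A B cA cB)] := Xirr; case.
- move=> z Xz; have [Az|nAz] := pselect (A z); first by left.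
  by right; apply: contrapT => nBz; apply: nxy; exists z.
- by move/(_ x Xx).
- by move/(_ y Xy).
Qed.

(** Otherwise the numerator of [f] near a point where [f] is nonzero would define
    a nonempty open set disjoint from [U]. *)
Lemma regular_dense (N U : set P) f : open_in X N -> regular_on N f ->
  open_in X U -> U !=set0 -> (forall x, N x -> U x -> f x = 0) ->
  forall x, N x -> f x = 0.
Proof.
move=> [A cA NE] rf oU U0 f0 x Nx; apply: contrapT => /eqP fx.
have [Z [d [g [h [cZ Zx gd hd H]]]]] := rf x Nx.
pose G := [set y : P | forall v, hcoord y v -> g.@[v 0] = 0].
have [||y [[[Xy nAy] nZy] nGy] Uy] := @open_in_meet ((X `\` A) `\` Z `\` G) U _ oU _ U0.
- exists (A `|` Z `|` G); last by rewrite !setDDl setUA.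
  by apply: proj_closedU; [exact: proj_closedU|exact: proj_closed_homog gd].
- exists x; split; first by split=> //; rewrite -NE.
  move=> Gx; have [v xv] := hcoord_ex x.
  by move: fx; have [_ ->] := H x v Nx Zx xv; rewrite (Gx v xv) mul0r eqxx.
have Ny : N y by rewrite NE.
apply: nGy => v yv; have [h0 fy] := H y v Ny nZy yv.
have /eqP := f0 y Ny Uy; rewrite fy mulf_eq0 invr_eq0 (negPf h0) orbF => /eqP //.
Qed.

End Projective.

(** * Coordinates on a product of linear series *)

Lemma krull_dim_eq (R : realType) T (cl : set (set T)) Y d :
  has_chain cl Y d -> (forall m, has_chain cl Y m -> (m <= d)%N) ->
  krull_dim R cl Y = (d%:R)%:E.
Proof.
move=> hd ub; apply/eqP; rewrite eq_le; apply/andP; split.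
  by apply: ge_ereal_sup => _ [m /ub md <-]; rewrite lee_fin ler_nat.
by apply: ereal_sup_ubound; exists d.
Qed.

Section GenericChain.
Variables (F : closedFieldType) (N : nat) (D V0 : set ('I_N -> F)) (q : {mpoly F[N]}).
Local Notation pt := ('I_N -> F).
Hypothesis cV0 : zclosed V0.
Hypothesis DE : principal_open q V0 = D.
Hypothesis Dirr : poly_irreducible D.
Variables (U : set_system pt).
Hypothesis UU : UltraFilter U.
Hypothesis UD : forall p : {mpoly F[N]},
  (exists2 x, D x & p.@[x] != 0) -> U [set x | D x /\ p.@[x] != 0].

Local Notation rat := (rational D).

(** The zeros on [D] of a rational function are those of its numerator. *)
Lemma rational_zclosed (S : set (pt -> F)) : S `<=` rat ->
  exists2 A : set pt, zclosed A & forall x, D x -> (forall f, S f -> f x = 0) <-> A x.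
Proof.
move=> Sr; pose num := [set a : {mpoly F[N]} | exists f b, S f /\
  forall x, D x -> b.@[x] != 0 /\ f x = a.@[x] / b.@[x]].
exists [set x | forall a, num a -> a.@[x] = 0]; first by exists num.
move=> x Dx; split=> [h a [f [b [Sf hf]]]|h f Sf].
  have [b0 fE] := hf x Dx; have /eqP := h f Sf.
  by rewrite fE mulf_eq0 invr_eq0 (negPf b0) orbF => /eqP.
have [a [b hf]] := Sr f Sf; have [_ ->] := hf x Dx.
by rewrite h ?mul0r //; exists f, b.
Qed.

(** Lower bound for dimensions in the form used below: continuity of [theta]
    and closedness of level sets are expressed with rational functions. *)
Lemma has_chain_of_rk T (cl : set (set T)) (Y : set T) (theta : pt -> T)
    (I : Type) (phi : I -> pt -> F) (l : seq I) :
  (forall i, rat (phi i)) -> (forall x, D x -> Y (theta x)) ->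
  (forall A, cl A -> exists2 S, S `<=` rat &
     forall x, D x -> A (theta x) <-> (forall f, S f -> f x = 0)) ->
  (forall S, S `<=` theta @` D ->
     exists G, [/\ cl G, S `<=` G & forall H, cl H -> S `<=` H -> G `<=` H]) ->
  (forall i c, exists2 G, cl G & forall x, D x -> G (theta x) <-> phi i x = c) ->
  has_chain cl Y (rk (uconst UU) set0 (kvals UU phi l)).
Proof.
move=> hphi hY hcont hclo hlev.
have [j ij] := rk_alg_indep (uconst UU) (fun i => upi UU (phi i)) l.
have /choice[a /choice[b ab]] := fun i => hphi (j i).
apply: (@chain_of_rat_indep F N q T cl theta Y _ a b V0) => //; rewrite ?DE //.
- by move=> i x /(ab i)[].
- move=> A /hcont[S Sr SA]; have [B cB BS] := rational_zclosed Sr.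
  by exists B => // x Dx; rewrite SA // BS.
- move=> i c; have [G cG GP] := hlev (j i) c; exists G => // x Dx; rewrite GP //.
  have [b0 ->] := ab i x Dx; split=> [<-|->]; first by rewrite divfK.
  by rewrite mulfK.
move=> P /ij; rewrite mmap_upi => Pn; apply: contrapT => nx.
case/eqP: Pn; apply: (kappa_eq Dirr UU UD) => x Dx.
apply: contrapT => /eqP Px; apply: nx; exists x; rewrite ?DE //.
by apply: contraNneq Px => <-; apply/eqP; apply: meval_eq => i; have [_ ->] := ab i x Dx.
Qed.

Lemma alg_indep_le_kvals (I : Type) (phi : I -> pt -> F) (l : seq I) n (g : 'I_n -> pt -> F) :
  (forall P : {mpoly F[n]}, P != 0 ->
     exists2 p : {mpoly F[N]}, (exists2 x, D x & p.@[x] != 0) &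
       forall x, D x -> p.@[x] != 0 -> P.@[fun i => g i x] != 0) ->
  (forall i, acl (uconst UU) [set z | z \in kvals UU phi l] (upi UU (g i))) ->
  (n <= rk (uconst UU) set0 (kvals UU phi l))%N.
Proof.
move=> ig hg; apply: (alg_indep_le_rk (g := fun i => upi UU (g i))) => //.
move=> P /ig[p hp Pg]; rewrite mmap_upi.
exact: (kappa_neq0_on UU UD hp Pg).
Qed.

End GenericChain.

Section Coordinates.
Variables (K : fieldType) (k : nat) (V : 'I_k -> lmodType K) (E : forall i, set (V i)).
Arguments E : clear implicits.
Variables (m : 'I_k -> nat) (e : forall i, 'I_(m i) -> V i).
Arguments e : clear implicits.
Hypothesis Espan : forall i s, E i s <-> exists c, s = \sum_j c j *: e i j.
Hypothesis Efree : forall i c, \sum_j c j *: e i j = 0 -> forall j, c j = 0.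

(** The members of all bases are numbered by a single ordinal, so that the
    coordinates of a tuple of sections can be put in polynomials. *)
Definition idx_type := {i : 'I_k & 'I_(m i)}.
Definition nidx : nat := #|{: idx_type}|.
Definition idx i (j : 'I_(m i)) : 'I_nidx :=
  enum_rank (Tagged (fun i => 'I_(m i)) j : idx_type).
Definition grp (r : 'I_nidx) : 'I_k := tag (enum_val r).
Definition pos (r : 'I_nidx) : 'I_(m (grp r)) := tagged (enum_val r).

Lemma grp_idx i (j : 'I_(m i)) : grp (idx j) = i.
Proof. by rewrite /grp /idx enum_rankK. Qed.

Lemma idxK r : idx (pos r) = r.
Proof.
rewrite /idx /pos /grp -[RHS]enum_valK; congr enum_rank.
by case: (enum_val r).
Qed.

Lemma big_grp (A : nmodType) i (f : 'I_nidx -> A) :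
  \sum_(r | grp r == i) f r = \sum_(j < m i) f (idx j).
Proof.
transitivity (\sum_(t : idx_type | tag t == i) f (enum_rank t)).
  rewrite (reindex (@enum_rank idx_type)) /=; last first.
    by apply: onW_bij; exact: enum_rank_bij.
  by apply: eq_bigl => t; rewrite /grp enum_rankK.
transitivity (\sum_(i' | i' == i) \sum_(j < m i') f (idx j)); last by rewrite big_pred1_eq.
rewrite sig_big_dep /=; apply: eq_big => [[i' j]|[i' j] _] //=; first by rewrite andbT.
Qed.

Definition coord i (s : V i) : 'I_(m i) -> K :=
  if pselect (exists c, s = \sum_j c j *: e i j) is left h then sval (cid h) else fun=> 0.

Lemma coordP i s : E i s -> s = \sum_j coord s j *: e i j.
Proof.
move=> /Espan h; rewrite /coord; case: pselect => // h'.
by case: (cid h').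
Qed.

Lemma coord_unique i c : coord (\sum_j c j *: e i j) = c.
Proof.
have Es : E i (\sum_j c j *: e i j) by apply/Espan; exists c.
apply/funext => j; apply/eqP; rewrite -subr_eq0; apply/eqP.
apply: (Efree (c := fun j => coord (\sum_j c j *: e i j) j - c j)).
under eq_bigr do rewrite scalerBl.
by rewrite sumrB -(coordP Es) subrr.
Qed.

Lemma coord_linear i j : linear_on (E i) (fun s => coord s j).
Proof.
move=> a u v /Espan[c ->] /Espan[d ->].
have -> : a *: (\sum_j c j *: e i j) + \sum_j d j *: e i j =
    \sum_j (a * c j + d j) *: e i j.
  by rewrite scaler_sumr -big_split; apply: eq_bigr => l _; rewrite scalerDl scalerA.
by rewrite !coord_unique.
Qed.

Definition sect (u : 'I_nidx -> K) : forall i, V i := fun i => \sum_j u (idx j) *: e i j.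
Definition coords (s : forall i, V i) (r : 'I_nidx) : K := coord (s (grp r)) (pos r).

Lemma prod_sect u : prod_space E (sect u).
Proof. by move=> i; apply/Espan; exists (fun j => u (idx j)). Qed.

Lemma coords_sect u : coords (sect u) = u.
Proof. by apply/funext => r; rewrite /coords coord_unique idxK. Qed.

Lemma coordsE s i j : coords s (idx j) = coord (s i) j.
Proof.
rewrite /coords /pos /grp /idx; set t := Tagged (fun i => 'I_(m i)) j.
have -> : enum_val (enum_rank (t : idx_type)) = t by rewrite enum_rankK.
by [].
Qed.

Lemma sect_coords s : prod_space E s -> sect (coords s) = s.
Proof.
move=> Es; apply/functional_extensionality_dep => i; rewrite /sect.
by under eq_bigr do rewrite coordsE; rewrite -coordP //; exact: Es.
Qed.

Lemma linear_on_sum i l n (f : 'I_n -> V i) c : linear_on (E i) l -> (forall j, E i (f j)) ->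
  l (\sum_j c j *: f j) = \sum_j c j * l (f j).
Proof.
move=> hl hf; have E0 : E i 0.
  by apply/Espan; exists (fun=> 0); rewrite big1 // => j _; rewrite scale0r.
have l0 : l 0 = 0.
  by have := hl (-1) 0 0 E0 E0; rewrite scaler0 addr0 mulN1r addNr.
have ED a u v : E i u -> E i v -> E i (a *: u + v).
  move=> /Espan[d ->] /Espan[d' ->]; apply/Espan; exists (fun j => a * d j + d' j).
  by rewrite scaler_sumr -big_split; apply: eq_bigr => b _; rewrite scalerDl scalerA.
have H : E i (\sum_j c j *: f j) /\ l (\sum_j c j *: f j) = \sum_j c j * l (f j).
  elim: (index_enum _) => [|j r [IH1 IH2]]; first by rewrite !big_nil; split; [exact: E0|exact: l0].
  rewrite !big_cons (hl _ _ _ (hf j) IH1) IH2; split=> //; exact: ED (hf j) IH1.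
exact: (proj2 H).
Qed.

Lemma mem_basis i j : E i (e i j).
Proof.
apply/Espan; exists (fun l => (l == j)%:R); rewrite (bigD1 j) //= eqxx scale1r big1 ?addr0 //.
by move=> l /negPf->; rewrite scale0r.
Qed.

Lemma polynomial_fun_coords f : polynomial_fun E f ->
  exists p : {mpoly K[nidx]}, forall s, prod_space E s -> f s = p.@[coords s].
Proof.
move=> [n [hh [l [p [hl fE]]]]].
exists (p \mPo [tuple \sum_(j < m (hh r)) l r (e (hh r) j) *: 'X_(idx j) | r < n]) => s Es.
rewrite fE // comp_mpoly_meval; apply: meval_eq => r; rewrite tnth_mktuple.
rewrite raddf_sum /= (coordP (Es (hh r))) linear_on_sum //; last exact: mem_basis.
by apply: eq_bigr => j _; rewrite mevalZ mevalXU coordsE mulrC.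
Qed.

Lemma coords_polynomial_fun (p : {mpoly K[nidx]}) :
  polynomial_fun E (fun s => p.@[coords s]).
Proof.
exists nidx, grp, (fun r s => coord s (pos r)), p; split=> // r.
exact: coord_linear.
Qed.

Lemma prod_closed_zero (S : set {mpoly K[nidx]}) :
  prod_closed E [set s | prod_space E s /\ forall p, S p -> p.@[coords s] = 0].
Proof.
exists [set f | exists2 p, S p & f = fun s => p.@[coords s]]; split.
  by move=> _ [p _ ->]; exact: coords_polynomial_fun.
apply/seteqP; split=> s /= [Es h]; split=> //; first by move=> _ [p Sp ->]; exact: h.
by move=> p Sp; apply: (h (fun s => p.@[coords s])); exists p.
Qed.

Lemma prod_closedP Z : prod_closed E Z -> exists S : set {mpoly K[nidx]},
  Z = [set s | prod_space E s /\ forall p, S p -> p.@[coords s] = 0].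
Proof.
move=> [S [SE ->]].
exists [set p | exists2 f, S f & forall s, prod_space E s -> f s = p.@[coords s]].
apply/seteqP; split=> s [Es h]; split=> //.
  by move=> p [f Sf fE]; rewrite -fE //; exact: h.
move=> f Sf; have [p fE] := polynomial_fun_coords (SE _ Sf).
by rewrite fE //; apply: h; exists f.
Qed.

End Coordinates.

Lemma linspan_rangeP (K : fieldType) (V : lmodType K) n (f : 'I_n -> V) v :
  linspan (range f) v <-> exists c, v = \sum_j c j *: f j.
Proof.
split; last by move=> [c ->]; exists n, c, f; split=> // i; exists i.
move=> [p [c [g [gf ->]]]]; elim: p c g gf => [|p IH] c g gf.
  by exists (fun=> 0); rewrite big_ord0 big1 // => j _; rewrite scale0r.
have [c' E'] := IH (fun i => c (lift ord0 i)) (fun i => g (lift ord0 i)) (fun i => gf _).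
have [j _ gj] := gf ord0.
exists (fun l => c ord0 * (l == j)%:R + c' l); rewrite big_ord_recl E'.
under [RHS]eq_bigr do rewrite scalerDl.
rewrite big_split /=; congr (_ + _); rewrite (bigD1 j) //= eqxx mulr1 gj big1 ?addr0 //.
by move=> l /negPf->; rewrite mulr0 scale0r.
Qed.

(** A spanning family of least size is free: otherwise one member is a
    combination of the others. *)
Lemma linspan_basis (K : fieldType) (V : lmodType K) n (f : 'I_n -> V) :
  exists m (b : 'I_m -> V), linspan (range b) = linspan (range f) /\
    forall c, \sum_j c j *: b j = 0 -> forall j, c j = 0.
Proof.
have ex : exists m, `[< exists b : 'I_m -> V, linspan (range b) = linspan (range f) >].
  by exists n; apply/asboolP; exists f.
case: (ex_minnP ex) => m /asboolP[b bE] mm; exists m, b; split=> // c c0 j.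
apply: contrapT => /eqP cj; case: m b bE mm c c0 j cj => [|m] b bE mm c c0 j cj; first by case: j {cj}.
suff /mm : `[< exists b : 'I_m -> V, linspan (range b) = linspan (range f) >].
  by rewrite ltnn.
apply/asboolP; exists (fun l => b (lift j l)); rewrite -bE.
apply/seteqP; split=> v.
  move=> [p [d [g [hg ->]]]]; exists p, d, g; split=> // i.
  by have [l _ <-] := hg i; exists (lift j l).
move=> /linspan_rangeP[d ->]; apply/linspan_rangeP.
exists (fun l => d (lift j l) - d j / c j * c (lift j l)).
have bj : b j = - \sum_(l < m) (c (lift j l) / c j) *: b (lift j l).
  have {c0} : c j *: b j + \sum_(l < m) c (lift j l) *: b (lift j l) = 0.
    by rewrite -[RHS]c0 (bigD1_ord j).
  move/eqP; rewrite addr_eq0 => /eqP e.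
  rewrite -[LHS]scale1r -(mulVf cj) -scalerA e scalerN scaler_sumr; congr (- _).
  by apply: eq_bigr => l _; rewrite scalerA mulrC.
rewrite (bigD1_ord j) //= bj scalerN scaler_sumr -sumrN -big_split /=.
apply: eq_bigr => l _; rewrite scalerA -scaleNr -scalerDl addrC; congr (_ *: _).
by rewrite mulrA mulrAC.
Qed.

(** * Dimensions in a product of linear series *)

Section ProductDimension.
Variables (F : closedFieldType) (N : nat) (D V0 : set ('I_N -> F)) (q : {mpoly F[N]}).
Local Notation pt := ('I_N -> F).
Hypothesis cV0 : zclosed V0.
Hypothesis DE : principal_open q V0 = D.
Hypothesis Dirr : poly_irreducible D.
Variables (U : set_system pt).
Hypothesis UU : UltraFilter U.
Hypothesis UD : forall p : {mpoly F[N]},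
  (exists2 x, D x & p.@[x] != 0) -> U [set x | D x /\ p.@[x] != 0].

Variables (k : nat) (V : 'I_k -> lmodType F) (E : forall i, set (V i)).
Arguments E : clear implicits.
Variables (m : 'I_k -> nat) (e : forall i, 'I_(m i) -> V i).
Arguments e : clear implicits.
Hypothesis Espan : forall i s, E i s <-> exists c, s = \sum_j c j *: e i j.
Hypothesis Efree : forall i c, \sum_j c j *: e i j = 0 -> forall j, c j = 0.

Local Notation M := (nidx m).
Local Notation crd := (coords e).

Variables (Y : set (forall i, V i)) (phi : 'I_M -> pt -> F).
Hypothesis Yprod : Y `<=` prod_space E.
Hypothesis phi_rat : forall r, rational D (phi r).
Let theta (z : pt) := sect e (fun r => phi r z).
Hypothesis Ytheta : forall z, D z -> Y (theta z).
Hypothesis theta_dominant : forall p : {mpoly F[M]},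
  (exists2 s, Y s & p.@[crd s] != 0) -> exists2 z, D z & p.@[fun r => phi r z] != 0.

Lemma kappa_meval_acl (I : eqType) (psi : I -> pt -> F) n (j : 'I_n -> I) (l : seq I)
    (p : {mpoly F[n]}) : (forall i, j i \in l) ->
  acl (uconst UU) [set z | z \in kvals UU psi l]
    (upi UU (fun z => p.@[fun i => psi (j i) z])).
Proof.
move=> jl; rewrite -mmap_upi; have := @mmap_gen_subfield _ _ (uconst UU) _ (fun i => upi UU (psi (j i))) p.
move/(sub_algebraic (gen_subfieldP _ _)); apply: aclS => _ [i _ <-].
exact: map_f.
Qed.

(** A chain in [Y] gives independent polynomials in the coordinates, which stay
    independent after composition with the dominant map [theta] and are
    algebraic over the [phi r]; conversely independent [phi r] give a chain. *)
Lemma krull_dim_prod (R : realType) : krull_dim R (prod_closed E) Y =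
  ((rk (uconst UU) set0 (kvals UU phi (enum 'I_M)))%:R)%:E.
Proof.
have Eth z : crd (theta z) = fun r => phi r z by rewrite /theta (coords_sect Espan Efree).
apply: krull_dim_eq.
  apply: (has_chain_of_rk cV0 DE Dirr UU UD (theta := theta)) => //.
  - move=> A /(prod_closedP Espan)[S ->].
    exists [set f | exists2 p, S p & f = fun z => p.@[fun r => phi r z]].
      by move=> _ [p _ ->]; exact: rational_meval.
    move=> z Dz /=; split; first by move=> [_ h] _ [p Sp ->]; rewrite -Eth; exact: h.
    move=> h; split; first exact: prod_sect.
    by move=> p Sp; rewrite Eth; apply: (h (fun z => p.@[fun r => phi r z])); exists p.
  - move=> S Sth; pose I := [set p : {mpoly F[M]} | forall s, S s -> p.@[crd s] = 0].
    exists [set s | prod_space E s /\ forall p, I p -> p.@[crd s] = 0]; split.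
    + exact: prod_closed_zero.
    + move=> s Ss; split; first by have [z Dz <-] := Sth s Ss; exact: prod_sect.
      by move=> p; apply.
    + move=> H /(prod_closedP Espan)[T ->] ST s [Es Is]; split=> // p Tp.
      by apply: Is => s' /ST[_]; apply.
  - move=> r c; exists [set s | prod_space E s /\ forall p, [set 'X_r - c%:MP] p -> p.@[crd s] = 0].
      exact: (prod_closed_zero Espan Efree).
    move=> z Dz /=; split.
      by move=> [_ /(_ _ erefl)]; rewrite Eth mevalB mevalXU mevalC => /eqP; rewrite subr_eq0 => /eqP.
    move=> <-; split; first exact: prod_sect.
    by move=> _ ->; rewrite Eth mevalB mevalXU mevalC subrr.
move=> d [Z [Z1 Z2]].
pose A : set ((forall i, V i) -> F) :=
  [set g | exists p : {mpoly F[M]}, forall s, prod_space E s -> g s = p.@[crd s]].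
have [||||g [Ag ig]] := @alg_indep_of_chain F _ (prod_closed E) Y setT A _ _ _ d Z Z1 Z2.
- move=> n g P Ag; have /choice[p hp] := Ag.
  exists (P \mPo [tuple p i | i < n]) => s Es; rewrite comp_mpoly_meval.
  by apply: meval_eq => i; rewrite tnth_mktuple hp.
- move=> g [p gp]; exists [set s | prod_space E s /\ forall r, [set p] r -> r.@[crd s] = 0].
    exact: (prod_closed_zero Espan Efree).
  move=> s Ys; have Es := Yprod Ys; rewrite gp //=; split; first by move=> [_ h] _; exact: h.
  by move=> h; split=> // _ ->; exact: h.
- move=> W s [G cG ->] Ys _ nG; have [S GE] := prod_closedP Espan cG.
  have Es := Yprod Ys.
  have /existsNP[p /not_implyP[Sp /eqP ps]] : ~ forall p, S p -> p.@[crd s] = 0.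
    by move=> h; apply: nG; split=> //; rewrite GE.
  exists (fun s => p.@[crd s]); split=> //; first by exists p.
  by move=> t [Yt]; rewrite GE => -[_ h] _; exact: h.
- by have [[x Z0x] _] := (Z1 0%N (leq0n _)).2; exists x.
have /choice[p hp] := Ag.
apply: (@alg_indep_le_kvals F N D U UU UD _ phi (enum 'I_M) d (fun i z => g i (theta z))).
- move=> P /ig[s [Zs _ gs]].
  have Ys : Y s by have [[G _ ZE] _] := Z1 d (leqnn d); move: Zs; rewrite ZE => -[].
  pose Q := P \mPo [tuple p i | i < d].
  have QE u : Q.@[u] = P.@[fun i => (p i).@[u]].
    by rewrite comp_mpoly_meval; apply: meval_eq => i; rewrite tnth_mktuple.
  have [|z Dz Qz] := theta_dominant (p := Q).
    exists s => //; rewrite QE; apply: contraNneq gs => <-.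
    by apply/eqP; apply: meval_eq => i; rewrite hp //; exact: Yprod.
  have rQ : rational D (fun z => Q.@[fun r => phi r z]) by exact: rational_meval.
  have : upi UU (fun z => Q.@[fun r => phi r z]) != 0.
    by apply: contraNneq Qz => /(kappa_eq0 UD rQ) ->.
  move=> /(kappa_neq0 Dirr UD rQ)[a a0 ha]; exists a => // x Dx /(ha x Dx).
  rewrite QE; apply: contraNneq => <-; apply/eqP; apply: meval_eq => i.
  by rewrite hp ?Eth //; exact: prod_sect.
move=> i.
have -> : upi UU (fun z => g i (theta z)) = upi UU (fun z => (p i).@[fun r => phi r z]).
  by congr upi; apply/funext => z; rewrite hp ?Eth //; exact: prod_sect.
by apply: (@kappa_meval_acl _ phi M id) => r; rewrite mem_enum.
Qed.

End ProductDimension.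

(** * Affine charts of a quasi-projective variety *)

Section Chart.
Variables (R : realType) (n : nat).
Local Notation C := (R[i]).
Local Notation P := (proj_space R n).
Local Notation pclosed := (@proj_closed R n).

Definition rowv (v : 'I_n.+1 -> C) : 'rV[C]_n.+1 := \row_j v j.

Lemma rowvE v : rowv v 0 = v.
Proof. by apply/funext => j; rewrite mxE. Qed.

Lemma rowvK (v : 'rV[C]_n.+1) : rowv (v 0) = v.
Proof. by apply/rowP => j; rewrite mxE. Qed.

Lemma homog_prod (I : finType) (p : I -> {mpoly C[n.+1]}) :
  (forall t, exists d, p t \is d.-homog) -> exists d, \prod_t p t \is d.-homog.
Proof.
move=> hp; elim: (index_enum _) => [|t r [d hd]].
  by exists 0%N; rewrite big_nil; exact: dhomog1.
have [d' hd'] := hp t; exists (d' + d)%N; rewrite big_cons; exact: dhomogM.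
Qed.

Lemma meval_prod_neq0 (I : finType) (p : I -> {mpoly C[n.+1]}) v :
  (\prod_t p t).@[v] != 0 <-> forall t, (p t).@[v] != 0.
Proof.
rewrite rmorph_prod /=; split=> [/prodf_neq0 h t|h]; first exact: h.
by apply/prodf_neq0 => t _; exact: h.
Qed.

Variable X : set P.

(** Finitely many regular functions are quotients of forms near [x1]. The form
    [q] collects everything that must not vanish: the forms that bound the
    neighbourhoods, a form vanishing on [B0] where [X] is [A0] minus [B0], and a
    coordinate, which keeps the origin of the cone away. The equations [S] of
    [A0] then describe the cone over the neighbourhood. *)
Lemma exists_chart (x1 : P) (I : finType) (f : I -> P -> C) (A : I -> set P) :
  quasi_projective X -> X x1 ->
  (forall t, open_in X (A t) /\ A t x1) -> (forall t, regular_on (A t) (f t)) ->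
  exists (q : {mpoly C[n.+1]}) (g h : I -> {mpoly C[n.+1]}) (S : set {mpoly C[n.+1]}),
    [/\ exists d, q \is d.-homog,
        forall v, hcoord x1 v -> q.@[v 0] != 0,
        forall t, exists d, g t \is d.-homog,
        forall x (v : 'rV[C]_n.+1), X x -> hcoord x v -> q.@[v 0] != 0 -> forall t,
          [/\ A t x, (h t).@[v 0] != 0 & f t x = (g t).@[v 0] / (h t).@[v 0]]
      & (forall p, S p -> forall x v, X x -> hcoord x v -> p.@[v 0] = 0) /\
        forall v : 'rV[C]_n.+1, q.@[v 0] != 0 -> (forall p, S p -> p.@[v 0] = 0) ->
          exists2 x, X x & hcoord x v].
Proof.
move=> [A0 [B0 [cA cB XE]]] Xx1 hA hf.
have [v1 xv1] := hcoord_ex x1.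
have [qB [dB [hB zB nB]]] : exists p d, [/\ p \is d.-homog,
    forall y, B0 y -> forall v, hcoord y v -> p.@[v 0] = 0
    & forall v, hcoord x1 v -> p.@[v 0] != 0].
  by apply: proj_closed_avoid => //; move: Xx1; rewrite XE => -[].
have [j0 hj0] : exists j, v1 0 j != 0.
  apply: contrapT => h; have [_ /eqP] := xv1; apply; apply/rowP => j; rewrite mxE.
  by apply: contrapT => /eqP hj; apply: h; exists j.
have loc t : exists gh : {mpoly C[n.+1]} * {mpoly C[n.+1]}, exists z : {mpoly C[n.+1]},
    [/\ exists d, gh.1 \is d.-homog, exists d, z \is d.-homog,
      forall v, hcoord x1 v -> z.@[v 0] != 0
    & forall x v, X x -> hcoord x v -> z.@[v 0] != 0 ->
      [/\ A t x, gh.2.@[v 0] != 0 & f t x = gh.1.@[v 0] / gh.2.@[v 0]]].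
  have [[Z1 cZ1 AE] Ax1] := hA t.
  have nZ1 : ~ Z1 x1 by move: Ax1; rewrite AE => -[].
  have [p1 [d1 [hp1 zp1 np1]]] := proj_closed_avoid cZ1 nZ1.
  have [Z [d [g [h [cZ Zx1 hg hh H]]]]] := hf t x1 Ax1.
  have [p2 [d2 [hp2 zp2 np2]]] := proj_closed_avoid cZ Zx1.
  exists (g, h), (p1 * p2); split.
  - by exists d.
  - by exists (d1 + d2)%N; exact: dhomogM.
  - by move=> v xv; rewrite mevalM mulf_neq0 ?np1 ?np2.
  move=> x v Xx xv; rewrite mevalM mulf_eq0 negb_or => /andP[p1v p2v] /=.
  have Ax : A t x.
    rewrite AE; split=> // Z1x; by move: p1v; rewrite (zp1 x Z1x v xv) eqxx.
  have nZx : ~ Z x by move=> Zx; move: p2v; rewrite (zp2 x Zx v xv) eqxx.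
  by have [? ?] := H x v Ax nZx xv.
have /choice[gh /choice[z hz]] := loc.
have [dz hdz] : exists d, \prod_t z t \is d.-homog.
  by apply: homog_prod => t; have [_ ? _ _] := hz t.
have [S [hS AE]] := cA.
exists (qB * ('X_j0 * \prod_t z t)), (fun t => (gh t).1), (fun t => (gh t).2), S.
have qE v : (qB * ('X_j0 * \prod_t z t)).@[v] != 0 ->
    [/\ qB.@[v] != 0, v j0 != 0 & forall t, (z t).@[v] != 0].
  rewrite !mevalM mevalXU !mulf_eq0 !negb_or => /and3P[h1 h2 h3]; split=> //.
  exact/meval_prod_neq0.
split.
- exists (dB + (1 + dz))%N; apply: dhomogM => //; apply: dhomogM => //.
  by rewrite dhomogX /= mdeg1.
- have qv1 : (qB * ('X_j0 * \prod_t z t)).@[v1 0] != 0.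
    rewrite !mevalM mevalXU !mulf_neq0 ?nB //; apply/meval_prod_neq0 => t.
    by have [_ _ + _] := hz t; apply.
  move=> v xv; apply: (homog_neq0 _ xv1 xv qv1).
  apply: dhomogM; first exact: hB.
  by apply: dhomogM; [|exact: hdz]; rewrite dhomogX /= mdeg1.
- by move=> t; have [? _ _ _] := hz t.
- by move=> x v Xx xv /qE[_ _ zv] t; have [_ _ _ H] := hz t; exact: H.
split.
  by move=> p Sp x v; rewrite XE AE => -[Ax _]; exact: Ax.
move=> v /qE[qv vj _] pv.
have v0 : v != 0 by apply: contraNneq vj => ->; rewrite mxE.
have [x xv] := hcoord_line v0; exists x => //; rewrite XE; split.
  rewrite AE => p Sp w xw; have [d hp] := hS p Sp.
  exact: homog_eq0 hp xv xw (pv p Sp).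
by move=> Bx; move: qv; rewrite (zB x Bx v xv) eqxx.
Qed.

Variable q : {mpoly C[n.+1]}.

Definition cone : set ('I_n.+1 -> C) :=
  [set v | q.@[v] != 0 /\ exists2 x, X x & hcoord x (rowv v)].

Hypothesis Xirr : irreducible_set pclosed X.
Hypothesis q_homog : exists d, q \is d.-homog.
Hypothesis cone0 : cone !=set0.
Variable M : nat.
Local Notation pt := ('I_(n.+1 + M) -> C).
Local Notation cyl := (cyl (M := M) cone).

(** The values of a polynomial along a line through the origin and along all of
    the second factor form a polynomial in [1 + M] variables, so if a product
    vanishes on the cylinder then one of the factors vanishes over each point. *)
Lemma cylinder_irreducible : poly_irreducible cyl.
Proof.
have [v0 Dv0] := cone0; split.
  by exists (glue v0 (fun=> 0)); rewrite /cyl /= vpart_glue.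
move=> p r [z1 Dz1 pz1] [z2 Dz2 rz2]; apply: contrapT => npr.
pose part (p : {mpoly C[n.+1 + M]}) (w : 'I_M -> C) : {mpoly C[n.+1]} :=
  p \mPo [tuple match fintype.split j with inl i => 'X_i | inr r => (w r)%:MP end | j < n.+1 + M].
have partE p' w v : (part p' w).@[v] = p'.@[glue v w].
  rewrite meval_comp; apply: meval_eq => j; rewrite /glue.
  by case: (fintype.split j) => i; rewrite ?mevalXU ?mevalC.
pose Ap p' := [set x : P | forall w, [set x : P | forall v : 'rV[C]_n.+1, hcoord x v -> (part p' w).@[v 0] = 0] x].
have cAp p' : pclosed (Ap p') by apply: proj_closed_bigcap => w; exact: proj_closed_poly.
pose Zq := [set x : P | forall v : 'rV[C]_n.+1, hcoord x v -> q.@[v 0] = 0].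
have cZq : pclosed Zq by case: q_homog => d; exact: proj_closed_homog.
have cover x : X x -> (Ap p `|` (Ap r `|` Zq)) x.
  move=> Xx; have [Zx|nZx] := pselect (Zq x); first by right; right.
  have [u xu] := hcoord_ex x.
  have qx v : hcoord x v -> q.@[v 0] != 0.
    move=> xv; apply: contra_notN nZx => /eqP qv w xw; case: q_homog => d hq.
    exact: homog_eq0 hq xv xw qv.
  pose along (p' : {mpoly C[n.+1 + M]}) : {mpoly C[1 + M]} :=
    p' \mPo [tuple match fintype.split j with
      | inl i => u 0 i *: 'X_(lshift M 0) | inr r => 'X_(rshift 1 r) end | j < n.+1 + M].
  have alongE p' y : (along p').@[y] = p'.@[glue ((y (lshift M 0) *: u) 0) (wpart y)].
    rewrite meval_comp; apply: meval_eq => j; rewrite /glue /wpart.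
    by case: (fintype.split j) => i; rewrite ?mevalZ !mevalXU // mxE mulrC.
  have : along p * along r * 'X_(lshift M 0) = 0.
    apply: mpoly_eq0P => y; rewrite !mevalM mevalXU !alongE.
    have [->|y0] := eqVneq (y (lshift M 0)) 0; first by rewrite mulr0.
    have xyu := hcoordZl y0 xu.
    rewrite -mevalM (_ : (p * r).@[_] = 0) ?mul0r //; apply: contrapT => /eqP prz.
    apply: npr; eexists; last exact: prz.
    by rewrite /cyl /cone /= vpart_glue rowvK; split; [exact: qx|exists x].
  have inA p' : along p' = 0 -> Ap p' x.
    move=> a0 w v xv; have [c _ ->] := hcoordZ xv xu.
    have := congr1 (meval (glue (fun=> c) w)) a0; rewrite meval0 alongE wpart_glue partE.
    by rewrite -[glue (fun=> c) w (lshift M 0)]/(vpart (glue (fun=> c) w) 0) vpart_glue.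
  have X0 : 'X_(lshift M 0) != 0 :> {mpoly C[1 + M]}.
    apply/eqP => /(congr1 (meval (fun=> 1))) /eqP.
    by rewrite mevalXU meval0 oner_eq0.
  move/eqP; rewrite mulf_eq0 (negPf X0) orbF mulf_eq0.
  by move=> /orP[]/eqP/inA; [left|right; left].
have pos z p' : p'.@[z] != 0 -> cyl z -> ~ X `<=` Ap p'.
  move=> pz [_ [x Xx xz]] /(_ x Xx)/(_ (wpart z) _ xz)/eqP.
  by rewrite partE rowvE glue_parts (negPf pz).
have [_ irr] := Xirr.
case: (irr _ _ (cAp p) (proj_closedU (cAp r) cZq) cover) => [h|{}cover].
  exact: (pos z1 p).
case: (irr _ _ (cAp r) cZq cover) => [h|h]; first exact: (pos z2 r).
case: Dv0 => qv [x Xx xv]; have := h x Xx _ xv; rewrite rowvE => /eqP.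
by rewrite (negPf qv).
Qed.

(** The closed set is the closure of the cylinder; it may be smaller than the
    zero set of [S], which need not be irreducible. *)
Lemma cylinder_principal_open (S : set {mpoly C[n.+1]}) :
  (forall p, S p -> forall x v, X x -> hcoord x v -> p.@[v 0] = 0) ->
  (forall v : 'rV[C]_n.+1, q.@[v 0] != 0 -> (forall p, S p -> p.@[v 0] = 0) ->
    exists2 x, X x & hcoord x v) ->
  exists (V0 : set pt) (q' : {mpoly C[n.+1 + M]}), zclosed V0 /\ principal_open q' V0 = cyl.
Proof.
move=> SX XS; pose lift (p : {mpoly C[n.+1]}) : {mpoly C[n.+1 + M]} :=
  p \mPo [tuple 'X_(lshift M i) | i < n.+1].
have liftE p z : (lift p).@[z] = p.@[vpart z].
  by rewrite meval_comp; apply: meval_eq => i; rewrite mevalXU.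
exists [set z | forall p, vanishing cyl p -> p.@[z] = 0], (lift q); split.
  by exists (vanishing cyl).
apply/seteqP; split=> z.
  move=> [Vz]; rewrite liftE => qz; split=> //.
  apply: XS; rewrite ?rowvE // => p Sp; rewrite -liftE; apply: Vz => y [_ [x Xx xy]].
  by rewrite liftE -[vpart y]rowvE; exact: SX p Sp x _ Xx xy.
move=> Dz; split; first by move=> p; apply.
by rewrite liftE; case: Dz.
Qed.

End Chart.

(** * The projective space of hyperplanes of a vector space *)

Section DualProj.
Variables (K : fieldType) (V : lmodType K) (W : set V).
Hypothesis W_lin : forall c u v, W u -> W v -> W (c *: u + v).

(** Every [f] differs from a multiple of [g] by an element of the common
    kernel. *)
Lemma linear_proportional l l' g f : linear_on W l -> linear_on W l' ->
  ker_on W l = ker_on W l' -> W g -> l g != 0 -> W f -> l' f = (l' g / l g) * l f.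
Proof.
move=> hl hl' ll' Wg lg Wf.
have Wu : W (- (l f / l g) *: g + f) by exact: W_lin.
have : ker_on W l (- (l f / l g) *: g + f).
  by split=> //; rewrite hl // mulNr divfK // addNr.
rewrite ll' => -[_]; rewrite hl' // mulNr addrC => /eqP; rewrite subr_eq0 => /eqP ->.
by rewrite mulrAC [RHS]mulrAC [l f * _]mulrC.
Qed.

Lemma meval_homogZ n d (p : {mpoly K[n]}) c v : p \is d.-homog ->
  p.@[fun i => c * v i] = c ^+ d * p.@[v].
Proof.
move=> /dhomogP hp; rewrite !mevalE mulr_sumr; apply: eq_big_seq => m /hp mm.
rewrite mulrCA; congr (_ * _).
under eq_bigr do rewrite exprMn.
by rewrite big_split /= prodrXr -mdegE mm.
Qed.

(** Functionals with the same kernel are proportional. *)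
Lemma homog_dual_fun_eq0 F l l' : homog_dual_fun W F -> linear_on W l -> linear_on W l' ->
  ker_on W l = ker_on W l' -> (exists2 g, W g & l g != 0) -> F l = 0 -> F l' = 0.
Proof.
move=> [n [d [f [p [Wf hp FE]]]]] hl hl' ll' [g Wg lg]; rewrite !FE => pl.
rewrite (_ : (fun i => l' (f i)) = fun i => (l' g / l g) * l (f i)).
  by rewrite (meval_homogZ _ _ hp) pl mulr0.
by apply/funext => i; exact: linear_proportional.
Qed.

Lemma dual_proj_closed_of (S : set ((V -> K) -> K)) : S `<=` homog_dual_fun W ->
  dual_proj_closed W [set H | dual_proj W H /\ forall l, linear_on W l ->
            H = ker_on W l -> forall F, S F -> F l = 0].
Proof. by move=> hS; exists S. Qed.

Lemma dual_proj_closure (S : set (set V)) : S `<=` dual_proj W ->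
  exists G, [/\ dual_proj_closed W G, S `<=` G &
    forall H, dual_proj_closed W H -> S `<=` H -> G `<=` H].
Proof.
move=> SW; pose I := [set F | homog_dual_fun W F /\
  forall H, S H -> forall l, linear_on W l -> H = ker_on W l -> F l = 0].
exists [set H | dual_proj W H /\ forall l, linear_on W l ->
            H = ker_on W l -> forall F, I F -> F l = 0]; split.
- by apply: dual_proj_closed_of => F [].
- by move=> H SH; split; [exact: SW|move=> l hl Hl F [_ hF]; exact: hF Hl].
move=> H [T [hT ->]] ST G [dG hG]; split=> // l hl Gl F TF.
have IF : I F.
  split; first exact: hT.
  by move=> H' /ST[_ h] l' hl' H'l'; exact: h l' hl' H'l' F TF.
exact: hG l hl Gl F IF.
Qed.

Variable g : V.
Hypothesis Wg : W g.

Definition off_g : set (set V) := [set H | ~ H g].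

Lemma normalized_ex H : dual_proj W H -> off_g H ->
  exists l, [/\ linear_on W l, H = ker_on W l & l g = 1].
Proof.
move=> [l [hl _ HE]] nHg.
have lg : l g != 0 by apply/eqP => lg; apply: nHg; rewrite HE.
exists (fun f => (l g)^-1 * l f); split; last by rewrite mulVf.
  by move=> c u v Wu Wv; rewrite hl // mulrDr mulrCA.
rewrite HE; apply/seteqP; split=> f [Wf lf]; split=> //; first by rewrite lf mulr0.
by apply/eqP; move/eqP: lf; rewrite mulf_eq0 invr_eq0 (negPf lg).
Qed.

(** The homogeneous coordinates of [H] that take the value 1 at [g] *)
Definition nrm (H : set V) : V -> K :=
  if pselect (dual_proj W H /\ off_g H) is left h
  then sval (cid (normalized_ex (proj1 h) (proj2 h))) else fun=> 0.

Lemma nrmP H : dual_proj W H -> off_g H ->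
  [/\ linear_on W (nrm H), H = ker_on W (nrm H) & nrm H g = 1].
Proof.
move=> dH oH; rewrite /nrm; case: pselect => [h|[]//].
by case: (cid _).
Qed.

Lemma nrmE l f : linear_on W l -> l g != 0 -> W f -> nrm (ker_on W l) f = l f / l g.
Proof.
move=> hl lg Wf; have dH : dual_proj W (ker_on W l) by exists l; split=> //; exists g.
have oH : off_g (ker_on W l) by move=> [_ /eqP]; apply/negP.
have [hn nE n1] := nrmP dH oH.
by rewrite (linear_proportional hl hn nE Wg lg Wf) n1 mul1r mulrC.
Qed.

(** Polynomial functions on the affine chart of the hyperplanes that miss [g] *)
Definition chart_fun : set (set V -> K) :=
  [set phi | exists n (f : 'I_n -> V) (p : {mpoly K[n]}), (forall i, W (f i)) /\
     forall H, dual_proj W H -> off_g H -> phi H = p.@[fun i => nrm H (f i)]].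

Lemma chart_fun_poly n (phi : 'I_n -> set V -> K) (P : {mpoly K[n]}) :
  (forall i, chart_fun (phi i)) -> chart_fun (fun H => P.@[fun i => phi i H]).
Proof.
move=> /choice[m hm].
have h i : {fp : ('I_(m i) -> V) * {mpoly K[m i]} | (forall j, W (fp.1 j)) /\
     forall H, dual_proj W H -> off_g H -> phi i H = fp.2.@[fun j => nrm H (fp.1 j)]}.
  by apply: cid; have [f [p fp]] := hm i; exists (f, p).
pose T := {i : 'I_n & 'I_(m i)}.
exists #|{: T}|, (fun r => (sval (h (tag (enum_val r)))).1 (tagged (enum_val r))).
exists (P \mPo [tuple (sval (h i)).2 \mPo
   [tuple 'X_(enum_rank (Tagged (fun i => 'I_(m i)) j : T)) | j < m i] | i < n]).
split=> [r|H dH oH]; first by case: (h _) => fp [].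
rewrite meval_comp; apply: meval_eq => i; rewrite meval_comp.
have [_ ->] // := svalP (h i); apply: meval_eq => j.
by rewrite mevalXU enum_rankK.
Qed.

(** Homogenization with respect to [g]; the extra factor [g] adds the
    complement of the chart to the zero set. *)
Lemma chart_fun_closed phi : chart_fun phi ->
  exists2 G, dual_proj_closed W G &
    forall H, dual_proj W H -> (G H <-> (off_g H -> phi H = 0)).
Proof.
move=> [n [f [p [Wf phiE]]]].
pose D := msize p.
pose mon (m : 'X_{1..n}) : 'X_{1..n.+1} :=
  (mnmwiden m + (U_(ord_max) *+ (D.+1 - mdeg m)))%MM.
pose P : {mpoly K[n.+1]} := \sum_(m <- msupp p) p@_m *: 'X_[mon m].
have degw (m : 'X_{1..n}) : mdeg (mnmwiden m) = mdeg m.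
  rewrite !mdegE big_ord_recr /= mnmwiden_ordmax addn0.
  by apply: eq_bigr => i _; rewrite mnmwiden_widen.
have hP : P \is D.+1.-homog.
  rewrite /P big_seq; apply: rpred_sum => m mp; apply: rpredZ; rewrite dhomogX /=.
  rewrite mdegD mdegMn mdeg1 mul1n degw subnKC //.
  by rewrite leqW // ltnW // msize_mdeg_lt.
pose F (l : V -> K) := P.@[fun i => l (ord_rcons f g i)].
have FE l : F l = \sum_(m <- msupp p) p@_m *
    ((\prod_i l (f i) ^+ m i) * l g ^+ (D.+1 - mdeg m)).
  rewrite /F /P raddf_sum /=; apply: eq_bigr => m _; rewrite mevalZ; congr (_ * _).
  rewrite /mon mpolyXD mevalM -mpolyXn rmorphXn /= mevalXU ord_rcons_max; congr (_ * _).
  rewrite -mwidenX [LHS](@mmap_mwiden _ _ _ idfun) -[LHS]/(meval _ _) mevalX.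
  apply: eq_bigr => i _; congr (l _ ^+ _).
  by rewrite -[LHS]/((ord_rcons f g \o widen_ord (leqnSn n)) i) ord_rcons_widen.
have hF : homog_dual_fun W F.
  exists n.+1, D.+1, (ord_rcons f g), P; split=> // i.
  by rewrite /ord_rcons; case: insub.
exists [set H | dual_proj W H /\ forall l, linear_on W l ->
            H = ker_on W l -> forall F', [set F] F' -> F' l = 0].
  by apply: dual_proj_closed_of => _ ->.
move=> H dH; split.
  move=> [_ h] oH; have [hn HE n1] := nrmP dH oH.
  have := h _ hn HE F erefl; rewrite FE phiE // mevalE => e0; rewrite -[RHS]e0.
  by apply: eq_bigr => m _; rewrite n1 expr1n mulr1.
move=> h; split=> // l hl HE _ ->.
have [lg|lg] := eqVneq (l g) 0.
  rewrite FE big1_seq // => m /andP[_ mp]; rewrite lg expr0n subn_eq0.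
  by rewrite leqNgt ltnS ltnW ?msize_mdeg_lt // !mulr0.
have oH : off_g H by rewrite HE => -[_ /eqP]; apply/negP.
have [hn nE n1] := nrmP dH oH.
apply: (homog_dual_fun_eq0 hF hn hl); [by rewrite -nE|by exists g; rewrite // n1 oner_eq0|].
rewrite FE -[RHS](h oH) phiE // mevalE.
by apply: eq_bigr => m _; rewrite n1 expr1n mulr1.
Qed.

Lemma chart_fun_sep Z H : dual_proj_closed W Z -> dual_proj W H -> off_g H -> ~ Z H ->
  exists phi, [/\ chart_fun phi, forall H', Z H' -> off_g H' -> phi H' = 0 & phi H != 0].
Proof.
move=> [S [hS ->]] dH oH nZ.
have /existsNP[l /not_implyP[hl /not_implyP[HE /existsNP[F /not_implyP[SF /eqP Fl]]]]] :
    ~ (forall l, linear_on W l -> H = ker_on W l -> forall F, S F -> F l = 0).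
  by move=> h; apply: nZ.
have hF := hS F SF; have [n [d [f [p [Wf hp FE]]]]] := hF.
exists (fun H => F (nrm H)); split.
- by exists n, f, p; split=> // H' _ _; rewrite FE.
- move=> H' [dH' h] oH'; have [hn nE _] := nrmP dH' oH'.
  exact: h.
have [hn nE n1] := nrmP dH oH.
apply: contraNneq Fl => e; apply/eqP; apply: (homog_dual_fun_eq0 hF hn hl) e.
  by rewrite -nE.
by exists g; rewrite // n1 oner_eq0.
Qed.

End DualProj.

(** * Dimension of the Kodaira images *)

Lemma linspan_ind (K : fieldType) (V : lmodType K) (S T : set V) :
  T 0 -> (forall c u v, T u -> T v -> T (c *: u + v)) -> S `<=` T -> linspan S `<=` T.
Proof.
move=> T0 TD ST _ [p [c [f [Sf ->]]]]; elim: (index_enum _) => [|i r IH]; first by rewrite big_nil.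
by rewrite big_cons; apply: TD => //; exact: ST.
Qed.

Lemma linspan_linear (K : fieldType) (V : lmodType K) (S : set V) c u v :
  linspan S u -> linspan S v -> linspan S (c *: u + v).
Proof.
move=> [p [d [f [Sf ->]]]] [p' [d' [f' [Sf' ->]]]].
exists (p + p')%N, (fun i => match fintype.split i with inl j => c * d j | inr j => d' j end),
  (fun i => match fintype.split i with inl j => f j | inr j => f' j end).
split; first by move=> i; case: (fintype.split i) => j.
rewrite big_split_ord /= scaler_sumr; congr (_ + _); apply: eq_bigr => j _.
  by rewrite -[lshift _ j]/(unsplit (inl j)) unsplitK scalerA.
by rewrite -[rshift _ j]/(unsplit (inr j)) unsplitK.
Qed.

Lemma linspan_sub (K : fieldType) (V : lmodType K) (S : set V) : S `<=` linspan S.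
Proof.
move=> v Sv; exists 1%N, (fun=> 1), (fun=> v); split=> //.
by rewrite big_ord1 scale1r.
Qed.

Local Notation gsec L := (@global_section _ _ _ L).

Section Sections.
Variables (R : realType) (n : nat) (X : set (proj_space R n)).
Local Notation C := (R[i]).
Local Notation P := (proj_space R n).

Lemma global_section0 (L : line_bundle X) : gsec L (0 : sec L).
Proof.
split=> [a|a b x _ _|a x _] //; last by rewrite mulr0.
exact: (@regular_on_cst _ _ _ 0).
Qed.

Lemma global_section_linear (L : line_bundle X) (c : C) (u v : sec L) :
  gsec L u -> gsec L v -> gsec L (c *: u + v).
Proof.
move=> [u1 u2 u3] [v1 v2 v3]; split=> [a|a b x ax bx|a x nx].
- apply: (@regular_on_eq _ _ _ (fun x => c * u a x + v a x)) => //.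
  by apply: regular_onD => //; apply: regular_onM => //; exact: regular_on_cst.
- rewrite -[LHS]/(c * u a x + v a x) -[(c *: u + v) b x]/(c * u b x + v b x).
  by rewrite (u2 a b) // (v2 a b) // mulrDr mulrCA.
- by rewrite -[LHS]/(c * u a x + v a x) u3 // v3 // mulr0 addr0.
Qed.

Lemma vanishes_at (L : line_bundle X) (s : sec L) a x : gsec L s ->
  lb_open a x -> vanishes s x <-> s a x = 0.
Proof.
move=> [_ h _] ax; split=> [|sx b bx]; first by apply.
by rewrite (h b a) // sx mulr0.
Qed.

End Sections.

Section Tau.
Variables (R : realType) (n k : nat) (X : set (proj_space R n)).
Variables (L : 'I_k -> line_bundle X) (E : forall i, set (sec (L i))).
Arguments E : clear implicits.
Local Notation C := (R[i]).
Local Notation P := (proj_space R n).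
Local Notation pclosed := (@proj_closed R n).
Hypothesis Xirr : irreducible_set pclosed X.
Hypothesis Eglob : forall i, E i `<=` gsec (L i).
Hypothesis Ebpf : forall i, base_point_free (E i).
Variables (m : 'I_k -> nat) (e : forall i, 'I_(m i) -> sec (L i)).
Arguments e : clear implicits.
Hypothesis Espan : forall i s, E i s <-> exists c, s = \sum_j c j *: e i j.
Hypothesis Efree : forall i c, \sum_j c j *: e i j = 0 -> forall j, c j = 0.
Local Notation M := (nidx m).

Variable J : {set 'I_k}.
Let TJ := {j : 'I_k | j \in J}.
Let LJ (j : TJ) := L (val j).
Let W := @series_J R n X k L E J.
Local Notation LT := (tensor_bundle LJ).

Lemma W_linear c u v : W u -> W v -> W (c *: u + v).
Proof. exact: linspan_linear. Qed.

Lemma W_global : W `<=` gsec LT.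
Proof.
apply: linspan_ind; [exact: global_section0|exact: global_section_linear|].
by move=> _ [f Ef <-]; apply: tensor_secP => j; apply: Eglob; exact: Ef.
Qed.

Lemma eval_linear (b : lb_idx LT) x : linear_on W (fun f => f b x).
Proof. by []. Qed.

Lemma kodaira_ker (b : lb_idx LT) x : lb_open b x -> kodaira W x = ker_on W (fun f => f b x).
Proof.
move=> bx; apply/seteqP; split=> f [Wf h]; split=> //.
  by apply/(vanishes_at (W_global Wf) bx).
by apply/(vanishes_at (W_global Wf) bx).
Qed.

Lemma W_nonzero (b : lb_idx LT) x : X x -> lb_open b x -> exists2 f, W f & f b x != 0.
Proof.
move=> Xx bx.
have h (j : TJ) : {s : sec (LJ j) | E (val j) s /\ s (b j) x != 0}.
  apply: cid; have [s Es ns] := @Ebpf (val j) x Xx; exists s; split=> //.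
  apply: contra_notN ns => /eqP sx; apply/(vanishes_at (Eglob Es) _); last exact: sx.
  by case: bx => _; exact.
exists (tensor_sec (fun j => sval (h j))).
  by apply: linspan_sub; exists (fun j => sval (h j)) => // j; case: (svalP (h j)).
rewrite /tensor_sec asboolT //; apply/prodf_neq0 => j _.
by case: (svalP (h j)).
Qed.

Lemma kodaira_dual x : X x -> dual_proj W (kodaira W x).
Proof.
move=> Xx; have [b bx] := lb_cover LT Xx.
exists (fun f => f b x); split; [exact: eval_linear|exact: W_nonzero|exact: kodaira_ker].
Qed.

(** A homogeneous condition on the evaluation functionals is locally the
    vanishing of a regular function. *)
Lemma kodaira_dense (U : set P) G : open_in X U -> U !=set0 -> dual_proj_closed W G ->
  (forall x, U x -> G (kodaira W x)) -> forall x, X x -> G (kodaira W x).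
Proof.
move=> oU U0 [S [hS ->]] UG x Xx; split; first exact: kodaira_dual.
move=> l hl Hl F SF; have [b bx] := lb_cover LT Xx.
have hF := hS F SF; have [d0 [d [f [p [Wf hp FE]]]]] := hF.
apply: (homog_dual_fun_eq0 W_linear hF (eval_linear b x) hl).
- by rewrite -kodaira_ker // Hl.
- exact: W_nonzero.
rewrite FE; have := @regular_dense R n X Xirr (lb_open b) U (fun y => p.@[fun i => f i b y]).
apply=> //; first exact: lb_openP.
  by apply: regular_on_meval => i; case: (W_global (Wf i)).
move=> y byy Uy; have [_ h] := UG y Uy.
by have := h _ (eval_linear b y) (kodaira_ker byy) F SF; rewrite FE.
Qed.

Variables (a : forall i, lb_idx (L i)) (jp : forall i, 'I_(m i)) (q : {mpoly C[n.+1]}).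
Variable Xf : 'I_M -> ('I_n.+1 -> C) -> C.
Let D1 := cone X q.
Hypothesis Xf_rat : forall r, exists a b : {mpoly C[n.+1]},
  forall v, D1 v -> b.@[v] != 0 /\ Xf r v = a.@[v] / b.@[v].
Hypothesis chart : forall v x, q.@[v] != 0 -> X x -> hcoord x (rowv v) -> forall i,
  [/\ lb_open (a i) x, e i (jp i) (a i) x != 0 &
      forall j, Xf (idx j) v = e i j (a i) x / e i (jp i) (a i) x].
Hypothesis q_homog : exists d, q \is d.-homog.
Hypothesis cone0 : D1 !=set0.

Local Notation pt := ('I_(n.+1 + M) -> C).
Let D : set pt := cyl (M := M) D1.
Let piv i : 'I_M := idx (jp i).
Variables (V0 : set pt) (q' : {mpoly C[n.+1 + M]}).
Hypothesis cV0 : zclosed V0.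
Hypothesis DE : principal_open q' V0 = D.
Hypothesis Dirr : poly_irreducible D.
Variables (UF : set_system pt).
Hypothesis UU : UltraFilter UF.
Hypothesis UD : forall p : {mpoly C[n.+1 + M]},
  (exists2 x, D x & p.@[x] != 0) -> UF [set x | D x /\ p.@[x] != 0].

(** Outside the cylinder the value is an arbitrary point of [X], so that
    evaluation always takes place on [X]. *)
Definition base_point (z : pt) : P :=
  if pselect (exists2 x, X x & hcoord x (rowv (vpart z))) is left h then sval (cid2 h)
  else sval (cid (Xirr.1)).

Lemma base_pointX z : X (base_point z).
Proof. by rewrite /base_point; case: pselect => [h|_]; [case: cid2|case: cid]. Qed.

Lemma base_pointE z x : X x -> hcoord x (rowv (vpart z)) -> base_point z = x.
Proof.
move=> Xx xz; rewrite /base_point; case: pselect => [h|[]]; last by exists x.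
by case: cid2 => y Xy yz /=; exact: hcoord_inj yz xz.
Qed.

Let A : lb_idx LT := fun j : TJ => a (val j).
Let w0 x : C := \prod_(j : TJ) e (val j) (jp (val j)) (a (val j)) x.
Local Notation xf := (xfun (m := n.+1) (M := M) Xf).

(** Homogeneous coordinates of the Kodaira image; dividing by the product of the
    pivots turns local expressions of sections into functions of the [x_r]. *)
Definition evz (f : sec LT) (z : pt) : C := f A (base_point z) / w0 (base_point z).

Lemma D_chart z : D z -> forall i,
  [/\ lb_open (a i) (base_point z), e i (jp i) (a i) (base_point z) != 0 &
      forall j, xf (idx j) z = e i j (a i) (base_point z) / e i (jp i) (a i) (base_point z)].
Proof.
move=> [qz [x Xx xz]] i; rewrite (base_pointE Xx xz).
exact: chart.
Qed.

Lemma w0_neq0 z : D z -> w0 (base_point z) != 0.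
Proof. by move=> Dz; apply/prodf_neq0 => j _; case: (D_chart Dz (val j)). Qed.

Lemma A_open z : D z -> lb_open A (base_point z).
Proof. by move=> Dz; split; [exact: base_pointX|move=> j; case: (D_chart Dz (val j))]. Qed.

Lemma evz_linear z : linear_on W (evz ^~ z).
Proof.
by move=> c u v _ _; rewrite /evz -[(c *: u + v) A _]/(c * u A _ + v A _) mulrDl mulrA.
Qed.

Lemma kodaira_evz z : D z -> kodaira W (base_point z) = ker_on W (evz ^~ z).
Proof.
move=> Dz; rewrite (kodaira_ker (A_open Dz)); apply/seteqP; split=> f [Wf h]; split=> //.
  by rewrite /evz h mul0r.
by apply/eqP; move/eqP: h; rewrite mulf_eq0 invr_eq0 (negPf (w0_neq0 Dz)) orbF.
Qed.

Lemma evz_tensor (s : forall j : TJ, sec (LJ j)) z : D z ->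
  (forall j, E (val j) (s j)) ->
  evz (tensor_sec s) z = \prod_(j : TJ) \sum_l coord e (s j) l * xf (idx l) z.
Proof.
move=> Dz Es; rewrite /evz /tensor_sec asboolT; last exact: A_open.
rewrite /w0 -prodf_div; apply: eq_bigr => j _.
have [_ _ hx] := D_chart Dz (val j).
under eq_bigr do rewrite hx mulrA.
rewrite -mulr_suml; congr (_ / _); rewrite {1}(coordP Espan (Es j)).
elim/big_ind2: _ => [//|u c v d uc vd|//].
by rewrite -uc -vd.
Qed.

Lemma evz_basis (c : forall i, 'I_(m i)) z : D z ->
  evz (tensor_sec (fun j : TJ => e (val j) (c (val j)))) z =
  \prod_(j : TJ) xf (idx (c (val j))) z.
Proof.
move=> Dz; rewrite /evz /tensor_sec asboolT; last exact: A_open.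
rewrite /w0 -prodf_div; apply: eq_bigr => j _.
by have [_ _ ->] := D_chart Dz (val j).
Qed.

Lemma basis_W (c : forall i, 'I_(m i)) : W (tensor_sec (fun j : TJ => e (val j) (c (val j)))).
Proof.
apply: linspan_sub; exists (fun j : TJ => e (val j) (c (val j))) => // j.
exact: (mem_basis Espan).
Qed.

Lemma xf_piv i z : D z -> xf (piv i) z = 1.
Proof. by move=> Dz; have [_ n0 ->] := D_chart Dz i; rewrite divff. Qed.

Definition lJ : seq 'I_M := [seq r <- enum 'I_M | grp r \in J].
Local Notation SJ := [set y | y \in kvals UU xf lJ].

Lemma xf_rat r : rational D (xf r).
Proof. exact: (@rational_x _ n.+1 M D1 Xf Xf_rat r). Qed.

(** By multilinearity every member of the product series is, after division by
    the product of the pivots, a polynomial in the [x_r] of the blocks in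
    [J]. *)
Lemma evz_rational f : W f ->
  rational D (evz f) /\ acl (uconst UU) SJ (upi UU (evz f)).
Proof.
have SF := acl_subfield (uconst UU) SJ.
have [hC _ _] := SF.
pose T (f : sec LT) := rational D (evz f) /\ acl (uconst UU) SJ (upi UU (evz f)).
have ext (g1 g2 : pt -> C) : (forall z, D z -> g1 z = g2 z) ->
    rational D g1 /\ acl (uconst UU) SJ (upi UU g1) ->
    rational D g2 /\ acl (uconst UU) SJ (upi UU g2).
  move=> g12 [[p [r hpr]] ag]; split; first by exists p, r => z Dz; rewrite -g12 //; exact: hpr.
  by rewrite -(kappa_eq Dirr UU UD g12).
move: f; apply: linspan_ind => [|c u v [ru au] [rv av]|_ [s Es <-]].
- apply: (ext (fun=> 0)) => [z Dz|]; first by rewrite /evz mul0r.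
  by split; [exact: rational_const|exact: hC].
- apply: (ext (fun z => c * evz u z + evz v z)) => [z Dz|].
    by rewrite /evz -[(c *: u + v) A _]/(c * u A _ + v A _) mulrDl mulrA.
  split; first by apply: rationalD => //; apply: rationalM => //; exact: rational_const.
  by rewrite upiD upiM; apply: (is_subfieldD SF) => //; apply: (is_subfieldM SF) => //; exact: hC.
apply: (ext (fun z => \prod_(j : TJ) \sum_l coord e (s j) l * xf (idx l) z)) => [z Dz|].
  by rewrite evz_tensor.
split.
  apply: rational_prod => j; apply: rational_sum => l.
  by apply: rationalM; [exact: rational_const|exact: xf_rat].
elim: (index_enum _) => [|j r IH].
  rewrite (_ : upi UU _ = uconst UU 1); first exact: hC.
  by congr upi; apply/funext => z; rewrite big_nil.
rewrite (_ : upi UU _ = upi UU (fun z => \sum_l coord e (s j) l * xf (idx l) z) *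
   upi UU (fun z => \prod_(j <- r) \sum_l coord e (s j) l * xf (idx l) z)); last first.
  by rewrite -upiM; congr upi; apply/funext => z; rewrite big_cons.
apply: (is_subfieldM SF) => //; rewrite upi_sum.
elim: (index_enum _) => [|l r' IH']; first by rewrite big_nil; exact: (is_subfield0 SF).
rewrite big_cons; apply: (is_subfieldD SF) => //; rewrite upiM.
apply: (is_subfieldM SF); first exact: hC.
apply: sub_acl; apply: map_f; rewrite mem_filter mem_enum andbT grp_idx.
by case: (j).
Qed.

Lemma kodaira_dense_cone G : dual_proj_closed W G ->
  (forall z, D z -> G (kodaira W (base_point z))) -> forall x, X x -> G (kodaira W x).
Proof.
move=> cG DG; pose Zq := [set x : P | forall v : 'rV[C]_n.+1, hcoord x v -> q.@[v 0] = 0].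
have [d hq] := q_homog; have cZq : pclosed Zq by exact: proj_closed_homog hq.
apply: (@kodaira_dense (X `\` Zq)) => //; first by exists Zq.
  have [v [qv [x Xx xv]]] := cone0; exists x; split=> // /(_ _ xv)/eqP.
  by rewrite rowvE (negPf qv).
move=> x [Xx nZ]; have [v xv] := hcoord_ex x.
have qv : q.@[v 0] != 0.
  by apply: contra_notN nZ => /eqP qv w xw; exact: homog_eq0 hq xv xw qv.
pose z : pt := glue (v 0) (fun=> 0).
have xz : hcoord x (rowv (vpart z)) by rewrite vpart_glue rowvK.
rewrite -(base_pointE Xx xz); apply: DG; split; first by rewrite vpart_glue.
by exists x.
Qed.

(** The [x_r] of the blocks in [J] are ratios of two members of the product
    series, the product of the pivots and the same product with one pivot
    replaced by [e_r]; hence their level sets are cut out by hyperplanes. *)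
Lemma has_chain_tau :
  has_chain (dual_proj_closed W) (kodaira W @` X) (rk (uconst UU) set0 (kvals UU xf lJ)).
Proof.
have <- : kvals UU (fun i => xf (tnth (in_tuple lJ) i)) (enum 'I_(size lJ)) = kvals UU xf lJ.
  have lE := map_tnth_enum (in_tuple lJ).
  by rewrite /kvals -[X in _ = map _ X]lE -map_comp.
apply: (has_chain_of_rk cV0 DE Dirr UU UD (theta := fun z => kodaira W (base_point z))).
- by move=> i; exact: xf_rat.
- by move=> z Dz; exists (base_point z) => //; exact: base_pointX.
- move=> _ [S [hS ->]]; exists [set g | exists2 F, S F & g = fun z => F (evz ^~ z)].
    move=> _ [F SF ->]; have [d0 [d [f [p [Wf _ FE]]]]] := hS F SF.
    under eq_fun do rewrite FE.
    by apply: rational_meval => i; case: (evz_rational (Wf i)).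
  move=> z Dz; have [dH lE] := (kodaira_dual (base_pointX z), kodaira_evz Dz); split.
    by move=> [_ h] _ [F SF ->]; apply: h => //; exact: evz_linear.
  move=> h; split=> // l hl Hl F SF.
  apply: (homog_dual_fun_eq0 W_linear (hS F SF) (evz_linear z) hl).
  + by rewrite -lE.
  + have [f Wf fn] := W_nonzero (base_pointX z) (A_open Dz); exists f => //.
    by rewrite mulf_neq0 // invr_eq0 w0_neq0.
  + by apply: (h (fun z => F (evz ^~ z))); exists F.
- move=> S Sth; apply: dual_proj_closure => H /Sth[z Dz <-].
  by apply: kodaira_dual; exact: base_pointX.
move=> i c; set r := tnth _ i.
have rJ : grp r \in J by have := mem_tnth i (in_tuple lJ); rewrite -/r mem_filter => /andP[].
(* the pivots, except for [r] in its own block; going through [nat] avoids a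
   transport between ['I_(m i)] and ['I_(m (grp r))] *)
pose sel (i : 'I_k) : 'I_(m i) := if i == grp r then insubd (jp i) (val (pos r)) else jp i.
have selr : idx (sel (grp r)) = r.
  rewrite /sel eqxx -[RHS]idxK; congr idx; apply: val_inj.
  by rewrite val_insubd ltn_ord.
pose s1 := tensor_sec (fun j : TJ => e (val j) (sel (val j))).
pose s0 := tensor_sec (fun j : TJ => e (val j) (jp (val j))).
have Ws1 : W s1 by exact: basis_W.
have Ws0 : W s0 by exact: basis_W.
have ev0 z : D z -> evz s0 z = 1.
  by move=> Dz; rewrite evz_basis // big1 // => j _; exact: xf_piv.
have ev1 z : D z -> evz s1 z = xf r z.
  move=> Dz; rewrite evz_basis // (bigD1 (exist (fun j => j \in J) _ rJ : TJ)) //= selr.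
  rewrite big1 ?mulr1 // => j; rewrite -val_eqE /= => jr.
  by rewrite /sel (negPf jr) xf_piv.
pose F (l : sec LT -> C) := l s1 - c * l s0.
have hF : homog_dual_fun W F.
  exists 2%N, 1%N, (fun i : 'I_2 => if i == 0 then s1 else s0), ('X_0 - c *: 'X_1); split.
  - by move=> i0; case: ifP.
  - by apply: rpredB; [|apply: rpredZ]; rewrite dhomogX /= mdeg1.
  - by move=> l; rewrite mevalB mevalZ !mevalXU.
exists [set H | dual_proj W H /\ forall l, linear_on W l ->
            H = ker_on W l -> forall F', [set F] F' -> F' l = 0].
  by apply: dual_proj_closed_of => _ ->.
move=> z Dz; have [dH lE] := (kodaira_dual (base_pointX z), kodaira_evz Dz); split.
  move=> [_ /(_ _ (evz_linear z) lE F erefl)]; rewrite /F ev0 // ev1 // mulr1.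
  by move/eqP; rewrite subr_eq0 => /eqP.
move=> xc; split=> // l hl Hl _ ->.
apply: (homog_dual_fun_eq0 W_linear hF (evz_linear z) hl).
- by rewrite -lE.
- by exists s0; rewrite // ev0 // oner_eq0.
- by rewrite /F ev0 // ev1 // xc mulr1 subrr.
Qed.

(** The smallest member of the chain meets an affine chart, given by some [g];
    the independent functions found there are polynomials in the quotients
    [evz f / evz g], which are rational where [evz g] is nonzero. *)
Lemma chain_tau_le d : has_chain (dual_proj_closed W) (kodaira W @` X) d ->
  (d <= rk (uconst UU) set0 (kvals UU xf lJ))%N.
Proof.
move=> [Z [Z1 Z2]]; set Y := kodaira W @` X.
have Ydual : Y `<=` dual_proj W by move=> _ [x Xx <-]; exact: kodaira_dual.
have [[G0 cG0 ZE0] [[H0 Z0H0] _]] := Z1 0%N (leq0n _).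
have [g Wg oH0] : exists2 g, W g & off_g g H0.
  have YH0 : Y H0 by move: Z0H0; rewrite ZE0 => -[].
  have [l [hl [g Wg lg] HE]] := Ydual H0 YH0; exists g => //.
  by rewrite /off_g /= HE => -[_ /eqP]; apply/negP.
have [||||phi [Aphi iphi]] := @alg_indep_of_chain _ _ (dual_proj_closed W) Y (off_g g)
    (chart_fun Wg) _ _ _ d Z Z1 Z2.
- by move=> n0 phi P hphi; exact: chart_fun_poly.
- move=> phi /(chart_fun_closed W_linear)[G cG GP]; exists G => // H YH.
  exact: GP (Ydual H YH).
- move=> Z' H [G cG ->] YH oH nG.
  have [|phi [cphi phiG phiH]] := chart_fun_sep W_linear Wg cG (Ydual H YH) oH.
    by move=> GH; apply: nG.
  by exists phi; split=> // H' [_ GH']; exact: phiG.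
- by exists H0.
have /choice[nf hphi] := Aphi.
have hphi' i : {fp : ('I_(nf i) -> sec LT) * {mpoly C[nf i]} | (forall j, W (fp.1 j)) /\
     forall H, dual_proj W H -> off_g g H -> phi i H = fp.2.@[fun j => nrm Wg H (fp.1 j)]}.
  by apply: cid; have [f [p fp]] := hphi i; exists (f, p).
pose ff i := (sval (hphi' i)).1; pose pp i := (sval (hphi' i)).2.
have Wff i j : W (ff i j) by rewrite /ff; case: (svalP (hphi' i)).
have [rg ag] := evz_rational Wg.
have onD z : D z -> evz g z != 0 ->
    [/\ dual_proj W (kodaira W (base_point z)), off_g g (kodaira W (base_point z)) &
        forall i, phi i (kodaira W (base_point z)) =
          (pp i).@[fun j => evz (ff i j) z / evz g z]].
  move=> Dz gz; have lE := kodaira_evz Dz.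
  have dH := kodaira_dual (base_pointX z).
  have oH : off_g g (kodaira W (base_point z)).
    by rewrite /off_g /= lE => -[_ /eqP]; apply/negP.
  split=> // i; have [_ ->//] := svalP (hphi' i); apply: meval_eq => j.
  by rewrite lE nrmE //; [exact: W_linear|exact: evz_linear|exact: Wff].
have SF := acl_subfield (uconst UU) SJ.
have gD P : P != 0 -> exists2 z, D z & evz g z != 0 /\
    P.@[fun i => phi i (kodaira W (base_point z))] != 0.
  move=> P0; have [H [ZH oH PH]] := iphi P P0.
  have YH : Y H by have [[G _ ZE] _] := Z1 d (leqnn d); move: ZH; rewrite ZE => -[].
  have [G cG GP] := chart_fun_closed W_linear (chart_fun_poly P Aphi).
  apply: contrapT => nz; case: YH => x Xx xH.
  have GH : G H.
    rewrite -xH; apply: (kodaira_dense_cone cG _ Xx) => z Dz.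
    have dH := kodaira_dual (base_pointX z).
    apply/(GP _ dH) => oz; apply: contrapT => /eqP Pz; apply: nz; exists z => //; split=> //.
    by apply: contra_notN oz => /eqP gz; rewrite kodaira_evz.
  have dH : dual_proj W H by rewrite -xH; exact: kodaira_dual.
  by move: PH; rewrite (proj1 (GP H dH) GH oH) eqxx.
(* the part of the cylinder over the chart has the same generic point *)
have [z0 Dz0 [gz0 _]] := gD 1 (oner_neq0 _).
have [u [v uv]] := rg; pose D' := [set z | D z /\ u.@[z] != 0].
have D'g z : D z -> evz g z != 0 <-> D' z.
  move=> Dz; have [vz ->] := uv z Dz; rewrite mulf_eq0 invr_eq0 (negPf vz) orbF.
  by split=> [|[]].
have Dz0' : D' z0 by apply/D'g.
have Dirr' : poly_irreducible D'.
  by apply: poly_irreducible_open => //; exists z0 => //; case: Dz0'.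
have UD' := generic_open (a := u) UU UD.
pose psi i z := (pp i).@[fun j => evz (ff i j) z / evz g z].
have psi_on z : D' z -> forall i, phi i (kodaira W (base_point z)) = psi i z.
  by move=> D'z i; have [Dz _] := D'z; have [_ _ ->] := onD z Dz (proj2 (D'g z Dz) D'z).
have ratS f : rational D f -> rational D' f.
  by move=> [p [r h]]; exists p, r => z [/h].
have rpsi i : rational D' (psi i).
  apply: rational_meval => j; apply: rationalM.
    by apply: ratS; case: (evz_rational (Wff i j)).
  exists v, u => z [Dz uz]; have [vz ->] := uv z Dz.
  by rewrite invf_div.
apply: (@alg_indep_le_kvals _ _ D' UF UU UD' _ xf lJ d
  (fun i z => phi i (kodaira W (base_point z)))) => [P P0|i].
  have [z Dz [gz Pz]] := gD P P0; have D'z := proj1 (D'g z Dz) gz.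
  have rP : rational D' (fun z => P.@[fun i => psi i z]) by exact: rational_meval.
  have Pz' : P.@[fun i => psi i z] != 0.
    by apply: contraNneq Pz => <-; apply/eqP/meval_eq => i; exact: psi_on.
  have kP : upi UU (fun z => P.@[fun i => psi i z]) != 0.
    by apply: contraNneq Pz' => /(kappa_eq0 UD' rP) ->.
  have [p hp pP] := kappa_neq0 Dirr' UD' rP kP; exists p => // x D'x /(pP x D'x).
  by apply: contraNneq => <-; apply/eqP/meval_eq => i; rewrite psi_on.
rewrite (kappa_eq Dirr' UU UD' (g := psi i)); last by move=> z D'z; exact: psi_on.
rewrite -mmap_upi; have := @mmap_gen_subfield _ _ (uconst UU) _
  (fun j => upi UU (fun z => evz (ff i j) z / evz g z)) (pp i).
apply: gen_subfield_min => // _ [j _ <-]; rewrite upiM upiV.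
by case: SF => _ _ hD; apply: hD => //; case: (evz_rational (Wff i j)).
Qed.

Lemma tau_eq : tau E J = ((rk (uconst UU) set0 (kvals UU xf lJ))%:R)%:E.
Proof. exact: krull_dim_eq has_chain_tau chain_tau_le. Qed.

End Tau.

(** * The consistency variety *)

Section Consistency.
Variables (R : realType) (n k : nat) (X : set (proj_space R n)).
Variables (L : 'I_k -> line_bundle X) (E : forall i, set (sec (L i))).
Arguments E : clear implicits.
Local Notation C := (R[i]).
Local Notation P := (proj_space R n).
Local Notation pclosed := (@proj_closed R n).
Hypothesis Xqp : quasi_projective X.
Hypothesis Xirr : irreducible_set pclosed X.
Hypothesis Eglob : forall i, E i `<=` @global_section _ _ _ (L i).
Hypothesis Ebpf : forall i, base_point_free (E i).
Variables (m : 'I_k -> nat) (e : forall i, 'I_(m i) -> sec (L i)).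
Arguments e : clear implicits.
Hypothesis Espan : forall i s, E i s <-> exists c, s = \sum_j c j *: e i j.
Hypothesis Efree : forall i c, \sum_j c j *: e i j = 0 -> forall j, c j = 0.
Local Notation M := (nidx m).
Local Notation crd := (coords e).
Variables (a : forall i, lb_idx (L i)) (jp : forall i, 'I_(m i)) (q : {mpoly C[n.+1]}).
Variable Xf : 'I_M -> ('I_n.+1 -> C) -> C.
Let D1 := cone X q.
Hypothesis Xf_rat : forall r, exists a b : {mpoly C[n.+1]},
  forall v, D1 v -> b.@[v] != 0 /\ Xf r v = a.@[v] / b.@[v].
Hypothesis chart : forall v x, q.@[v] != 0 -> X x -> hcoord x (rowv v) -> forall i,
  [/\ lb_open (a i) x, e i (jp i) (a i) x != 0 &
      forall j, Xf (idx j) v = e i j (a i) x / e i (jp i) (a i) x].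
Hypothesis q_homog : exists d, q \is d.-homog.
Hypothesis cone0 : D1 !=set0.
Hypothesis cone_equations : exists S : set {mpoly C[n.+1]},
  (forall p, S p -> forall x v, X x -> hcoord x v -> p.@[v 0] = 0) /\
  (forall v : 'rV[C]_n.+1, q.@[v 0] != 0 -> (forall p, S p -> p.@[v 0] = 0) ->
    exists2 x, X x & hcoord x v).
Local Notation pt := ('I_(n.+1 + M) -> C).
Let D : set pt := cyl (M := M) D1.
Let piv i : 'I_M := idx (jp i).
Local Notation uf := (ufun (@grp k m) piv Xf).
Local Notation xf := (xfun (m := n.+1) (M := M) Xf).

Lemma sum_eval (i : 'I_k) (I : finType) (c : I -> C) (f : I -> sec (L i)) b x :
  (\sum_j c j *: f j) b x = \sum_j c j * f j b x.
Proof.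
elim/big_ind2: _ => [//|u v s t us vt|//].
by rewrite -us -vt.
Qed.

Lemma sect_sum (u : 'I_M -> C) i b x :
  sect e u i b x = \sum_j u (idx j) * e i j b x.
Proof. exact: sum_eval. Qed.

Lemma vanishes_sect (u : 'I_M -> C) (z : pt) x i : D z -> X x -> hcoord x (rowv (vpart z)) ->
  vanishes (sect e u i) x <->
  u (piv i) = - \sum_(r | blk (@grp k m) piv i r) u r * xf r z.
Proof.
move=> [qz _] Xx xz; have [ax ep hx] := chart qz Xx xz i.
have sE : E i (sect e u i) by apply: prod_sect Espan _ _.
rewrite (vanishes_at (Eglob sE) ax) sect_sum.
have -> : \sum_j u (idx j) * e i j (a i) x =
    (\sum_(r | grp r == i) u r * xf r z) * e i (jp i) (a i) x.
  rewrite big_grp mulr_suml; apply: eq_bigr => j _.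
  by rewrite /xfun hx mulrA divfK.
rewrite (bigD1 (piv i)) /=; last by rewrite /piv grp_idx.
have -> : xf (piv i) z = 1 by rewrite /xfun /piv hx divff.
rewrite mulr1; split=> [/eqP|->].
  by rewrite mulf_eq0 (negPf ep) orbF addr_eq0 => /eqP.
by rewrite addNr mul0r.
Qed.

Lemma ufun_root z x : D z -> X x -> hcoord x (rowv (vpart z)) ->
  forall i, vanishes (sect e (fun r => uf r z) i) x.
Proof.
move=> Dz Xx xz i; apply/(vanishes_sect _ i Dz Xx xz).
have hp j : grp (piv j) = j by rewrite /piv grp_idx.
rewrite ufun_piv //; congr (- _); apply: eq_bigr => r /andP[/eqP <- np].
by rewrite /ufun (negPf np).
Qed.

Lemma root_ufun (u : 'I_M -> C) x : X x -> (exists2 v : 'rV[C]_n.+1, hcoord x v & q.@[v 0] != 0) ->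
  (forall i, vanishes (sect e u i) x) -> exists2 z, D z & (fun r => uf r z) = u.
Proof.
move=> Xx [v xv qv] hu; pose z : pt := glue (v 0) u.
have xz : hcoord x (rowv (vpart z)) by rewrite vpart_glue rowvK.
have Dz : D z by split; [rewrite vpart_glue|exists x].
exists z => //; apply/funext => r.
have wE s : wfun s z = u s by rewrite /wfun /z wpart_glue.
rewrite /ufun; case: eqP => [rp|//].
rewrite [in RHS]rp; have /(vanishes_sect _ _ Dz Xx xz) -> := hu (grp r).
by congr (- _); apply: eq_bigr => s _; rewrite wE.
Qed.

Lemma consistency_prod : consistency_variety E `<=` prod_space E.
Proof.
move=> s; apply; split; last by move=> t [].
by exists set0; split=> //; apply/seteqP; split=> t //= [].
Qed.

Lemma root_consistency s : prod_space E s -> (exists2 x, X x & forall i, vanishes (s i) x) ->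
  consistency_variety E s.
Proof. by move=> Es hs A [_]; apply; split. Qed.

(** A system with a root at [x0] moves, as [x] moves away from [x0], in a
    family with root at [x]: subtract [s x / t x] times a section [t] that does
    not vanish at [x0]. *)
Lemma consistency_dominant (p : {mpoly C[M]}) :
  (exists2 s, consistency_variety E s & p.@[crd s] != 0) ->
  exists2 z, D z & p.@[fun r => uf r z] != 0.
Proof.
move=> [s1 Rs1 ps1]; apply: contrapT => nz.
have [s0 Es0 [[x0 Xx0 s0x] ps0]] : exists2 s, prod_space E s &
    (exists2 x, X x & forall i, vanishes (s i) x) /\ p.@[crd s] != 0.
  apply: contrapT => ns; move/eqP: ps1; apply.
  have [] := Rs1 [set s | prod_space E s /\ forall r, [set p] r -> r.@[crd s] = 0].
    split; first exact: prod_closed_zero.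
    move=> s [Es hs]; split=> // _ ->; apply: contrapT => /eqP ps.
    by apply: ns; exists s.
  by move=> _; apply.
have ht i : {tb : sec (L i) * lb_idx (L i) | [/\ E i tb.1, lb_open tb.2 x0 & tb.1 tb.2 x0 != 0]}.
  apply: cid; have [t Et nt] := @Ebpf i x0 Xx0.
  move/existsNP: nt => [b /not_implyP[bx /eqP tx]].
  by exists (t, b).
pose t i := (sval (ht i)).1; pose b i := (sval (ht i)).2.
have tP i : [/\ E i (t i), lb_open (b i) x0 & t i (b i) x0 != 0] by exact: (svalP (ht i)).
have [||q0 [g [h [S [[d0 hq0] nq0 hg loc _]]]]] :=
  @exists_chart R n X x0 'I_k (fun i => t i (b i)) (fun i => lb_open (b i)) Xqp Xx0.
- by move=> i; split; [exact: lb_openP|case: (tP i)].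
- by move=> i; have [Et _ _] := tP i; case: (Eglob Et).
have [d1 hd1] := homog_prod hg.
pose Q := q0 * \prod_i g i.
have hQ : Q \is (d0 + d1).-homog by exact: dhomogM.
pose ZQ := [set x : P | forall v : 'rV[C]_n.+1, hcoord x v -> Q.@[v 0] = 0].
have cZQ : pclosed ZQ by exact: proj_closed_homog hQ.
pose Nb := X `\` ZQ.
have nbhd x : Nb x -> forall i, lb_open (b i) x /\ t i (b i) x != 0.
  move=> [Xx nZ] i; have [v xv] := hcoord_ex x.
  have : Q.@[v 0] != 0.
    by apply: contra_notN nZ => /eqP Qv w xw; exact: homog_eq0 hQ xv xw Qv.
  rewrite mevalM mulf_eq0 negb_or => /andP[q0v /meval_prod_neq0 gv].
  have [bx hx ->] := loc x v Xx xv q0v i.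
  by split=> //; rewrite mulf_neq0 ?invr_eq0.
have Nx0 : Nb x0.
  split=> // Zx; have [v xv] := hcoord_ex x0.
  have /eqP := Zx v xv; rewrite mevalM mulf_eq0 (negPf (nq0 v xv)) /=.
  apply/negP; apply/meval_prod_neq0 => i.
  have [_ hx E'] := loc x0 v Xx0 xv (nq0 v xv) i.
  by have [_ _] := tP i; rewrite E' mulf_eq0 negb_or => /andP[].
(* the moving system has coefficients [w x] *)
pose ratio i x := s0 i (b i) x / t i (b i) x.
pose w x (r : 'I_M) := crd s0 r - ratio (grp r) x * crd t r.
have rw r : regular_on Nb (fun x => w x r).
  apply: (@regular_on_eq _ _ _ (fun x => crd s0 r + (- crd t r) * ratio (grp r) x)).
    by move=> x _; rewrite /w mulNr mulrC.
  apply: regular_onD; first exact: regular_on_cst.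
  apply: regular_onM; first exact: regular_on_cst.
  have sub : Nb `<=` lb_open (b (grp r)) by move=> x /nbhd/(_ (grp r))[].
  have [Et _ _] := tP (grp r).
  apply: regular_on_div; last by move=> x /nbhd/(_ (grp r))[].
    by apply: (regular_onS sub); case: (Eglob (Es0 (grp r))).
  by apply: (regular_onS sub); case: (Eglob Et).
have Et : prod_space E t by move=> i; case: (tP i).
have wroot x : Nb x -> forall i, vanishes (sect e (w x) i) x.
  move=> Nbx i; have [bx tx] := nbhd x Nbx i.
  have sE : E i (sect e (w x) i) by apply: prod_sect Espan _ _.
  apply/(vanishes_at (Eglob sE) bx); rewrite sect_sum.
  under eq_bigr do rewrite /w mulrBl grp_idx -mulrA.
  rewrite sumrB -mulr_sumr -!sect_sum !(sect_coords Espan) //.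
  by rewrite /ratio divfK // subrr.
pose Zq := [set x : P | forall v : 'rV[C]_n.+1, hcoord x v -> q.@[v 0] = 0].
have [d hq] := q_homog; have cZq : pclosed Zq by exact: proj_closed_homog hq.
have H1 : open_in X Nb by exists ZQ.
have H2 : open_in X (X `\` Zq) by exists Zq.
have H3 : X `\` Zq !=set0.
  have [v [qv [x Xx xv]]] := cone0; exists x; split=> // /(_ _ xv)/eqP.
  by rewrite rowvE (negPf qv).
have H4 x : Nb x -> (X `\` Zq) x -> p.@[fun r => w x r] = 0.
  move=> Nbx [Xx nZ]; apply: contrapT => /eqP pw.
  have qx : exists2 v : 'rV[C]_n.+1, hcoord x v & q.@[v 0] != 0.
    by apply: contrapT => nv; apply: nZ => v xv; apply: contrapT => /eqP qv; apply: nv; exists v.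
  have [z Dz zw] := root_ufun Xx qx (wroot x Nbx).
  by apply: nz; exists z => //; rewrite zw.
move: ps0; rewrite -(_ : (fun r => w x0 r) = crd s0); last first.
  apply/funext => r; rewrite /w /ratio; have [_ bx _] := tP (grp r).
  by rewrite (proj1 (vanishes_at (Eglob (Es0 (grp r))) bx) (s0x (grp r))) !mul0r subr0.
by rewrite (regular_dense Xirr H1 (regular_on_meval p rw) H2 H3 H4 Nx0) eqxx.
Qed.

Lemma min_defect_eq (tau' : {set 'I_k} -> nat) u N :
  (forall J, tau E J = ((tau' J)%:R)%:E) ->
  (forall J : {set 'I_k}, (u + #|J| <= N + tau' J)%N) ->
  (exists J : {set 'I_k}, (N + tau' J <= u + #|J|)%N) ->
  min_defect E = (u%:R - N%:R)%:E.
Proof.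
move=> tauE hle [J0 hge].
have defE J : defect E J = ((tau' J)%:R - (#|J|)%:R)%:E by rewrite /defect tauE EFinB.
have lb (J : {set 'I_k}) : u%:R - N%:R <= (tau' J)%:R - (#|J|)%:R :> R.
  by rewrite lerBlDr addrAC lerBrDr -!natrD ler_nat [(tau' J + N)%N]addnC.
apply/eqP; rewrite eq_le; apply/andP; split.
  rewrite /min_defect (bigD1 J0) //= ge_min; apply/orP; left.
  rewrite defE lee_fin lerBlDr addrAC lerBrDr -!natrD ler_nat addnC //.
rewrite /min_defect; elim/big_ind: _ => [|x y hx hy|J _]; first exact: leey.
  by rewrite le_min hx hy.
by rewrite defE lee_fin lb.
Qed.

(** Both dimensions are ranks in the same field: of all the coefficients for the
    product of the series, of the [ufun r] for the consistency variety. *)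
Lemma codim_consistency : codim E R (consistency_variety E) = (- min_defect E)%E.
Proof.
have Dirr : poly_irreducible D by exact: cylinder_irreducible.
have [S [SX XS]] := cone_equations.
have [V0 [q' [cV0 DE]]] := @cylinder_principal_open R n X q M S SX XS.
have [U [UU UD]] := generic_ultrafilter Dirr.
have h_piv i : grp (piv i) = i by rewrite /piv grp_idx.
have X_piv i v : D1 v -> Xf (piv i) v = 1.
  by move=> [qv [x Xx xv]]; have [_ n0 ->] := chart qv Xx xv i; rewrite divff.
have dimE : krull_dim R (prod_closed E) (prod_space E) = (M%:R)%:E.
  have := @krull_dim_prod _ _ D V0 q' cV0 DE Dirr U UU UD k _ E m e Espan Efree
    (prod_space E) (@wfun _ n.+1 M) _ _ _ _ R.
  rewrite (rk_wfun Dirr UU UD (enum_uniq _)) size_enum_ord; apply=> //.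
  - by move=> r; exact: rational_w.
  - by move=> z _; exact: prod_sect.
  move=> p [s Es ps]; have [v Dv] := cone0; exists (glue v (crd s)).
    by rewrite /D /cyl /= vpart_glue.
  by rewrite (_ : (fun r => _) = crd s) //; apply/funext => r; rewrite /wfun wpart_glue.
have dimR : krull_dim R (prod_closed E) (consistency_variety E) =
    ((u_rk (@grp k m) piv Xf UU)%:R)%:E.
  apply: (@krull_dim_prod _ _ D V0 q' cV0 DE Dirr U UU UD k _ E m e Espan Efree) => //.
  - exact: consistency_prod.
  - move=> r; rewrite (_ : uf r = if r == piv (grp r)
        then (fun z => - yfun (@grp k m) piv Xf (grp r) z) else wfun r); last first.
      by apply/funext => z; rewrite /ufun; case: ifP.
    case: ifP => _; last exact: rational_w.
    have := rationalM (@rational_const _ _ D (-1)) (rational_y (@grp k m) piv Xf_rat (grp r)).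
    by congr (rational _ _); apply/funext => z; rewrite mulN1r.
  - move=> z Dz; apply: root_consistency; first exact: prod_sect.
    have [_ [x Xx xz]] := Dz; exists x => //; exact: ufun_root.
  - exact: consistency_dominant.
have tauE J := tau_eq Xirr Eglob Ebpf Espan J Xf_rat chart q_homog cone0 cV0 DE Dirr UU UD.
rewrite /codim dimE dimR.
rewrite (min_defect_eq (u := u_rk (@grp k m) piv Xf UU) (N := M) tauE).
- by rewrite -EFinB -EFinN opprB.
- by move=> J; have := u_rk_le h_piv Xf UU J.
- by have := u_rk_ge h_piv Xf_rat X_piv Dirr UU UD.
Qed.

End Consistency.

(** * Codimension and defect *)

Theorem theorem2p4 (R : realType) (n k : nat) (X : set (proj_space R n))
    (L : 'I_k -> line_bundle X) (E : forall i : 'I_k, set (sec (L i))) :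
  quasi_projective X ->
  irreducible_set (@proj_closed R n) X ->
  (forall i, globally_generated (L i)) ->
  (forall i, linear_series (E i)) ->
  (forall i, base_point_free (E i)) ->
  codim E R (consistency_variety E) = (- min_defect E)%E.
Proof.
move=> Xqp Xirr _ Els Ebpf.
have Eglob i : E i `<=` @global_section _ _ _ (L i) by case: (Els i).
have hb i : {mb : {m : nat & 'I_m -> sec (L i)} | E i = linspan (range (projT2 mb)) /\
    forall c, \sum_j c j *: projT2 mb j = 0 -> forall j, c j = 0}.
  apply: cid; have [_ [m0 [f ->]]] := Els i.
  by have [m [b [bE bf]]] := linspan_basis f; exists (existT _ m b).
pose m i := projT1 (sval (hb i)).
pose e i : 'I_(m i) -> sec (L i) := projT2 (sval (hb i)).
have Espan i s : E i s <-> exists c, s = \sum_j c j *: e i j.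
  have [eE _] := svalP (hb i); have -> : E i s = linspan (range (e i)) s := congr1 (@^~ s) eE.
  exact: linspan_rangeP.
have Efree i c : \sum_j c j *: e i j = 0 -> forall j, c j = 0.
  by have [_ h] := svalP (hb i); exact: h.
have [[x1 Xx1] _] := Xirr.
have hp i : {ja : 'I_(m i) * lb_idx (L i) | lb_open ja.2 x1 /\ e i ja.1 ja.2 x1 != 0}.
  apply: cid; have [s Es ns] := Ebpf i x1 Xx1.
  apply: contrapT => nj; apply: ns => a ax; have [c ->] := (Espan i s).1 Es.
  rewrite sum_eval big1 // => j _; rewrite [X in _ * X](_ : _ = 0) ?mulr0 //.
  by apply: contrapT => /eqP ej; apply: nj; exists (j, a).
pose jp i := (sval (hp i)).1; pose a i := (sval (hp i)).2.
have hpP i : lb_open (a i) x1 /\ e i (jp i) (a i) x1 != 0 by exact: (svalP (hp i)).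
pose T := idx_type m.
pose f (t : T) := e (tag t) (tagged t) (a (tag t)).
have Ee (t : T) : E (tag t) (e (tag t) (tagged t)).
  exact: (mem_basis Espan).
have [||q0 [g [h [S [[d0 hq0] nq0 hg loc [SX XS]]]]]] :=
  @exists_chart R n X x1 T f (fun t => lb_open (a (tag t))) Xqp Xx1.
- by move=> t; split; [exact: lb_openP|case: (hpP (tag t))].
- by move=> t; case: (Eglob _ _ (Ee t)).
pose pv i : T := Tagged (fun i => 'I_(m i)) (jp i).
pose q := q0 * \prod_i g (pv i).
have [d1 hd1] : exists d, \prod_i g (pv i) \is d.-homog by apply: homog_prod => i; exact: hg.
have qE v : q.@[v] != 0 -> q0.@[v] != 0 /\ forall i, (g (pv i)).@[v] != 0.
  by rewrite mevalM mulf_eq0 negb_or => /andP[? /meval_prod_neq0].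
pose Xf (r : 'I_(nidx m)) (v : 'I_n.+1 -> R[i]) : R[i] := let t := enum_val r in
  (g t * h (pv (tag t))).@[v] / (h t * g (pv (tag t))).@[v].
apply: (@codim_consistency R n k X L E Xqp Xirr Eglob Ebpf m e Espan Efree a jp q Xf).
- move=> r; set t := enum_val r; exists (g t * h (pv (tag t))), (h t * g (pv (tag t))).
  move=> v [qv [x Xx xv]]; split=> //; have [q0v gv] := qE v qv.
  rewrite mevalM mulf_neq0 //.
  by have := loc x _ Xx xv; rewrite rowvE => /(_ q0v t)[].
- move=> v x qv Xx xv i; have [q0v gv] := qE v qv.
  have lc := loc x _ Xx xv; rewrite rowvE in lc.
  have [ax hpv fpv] := lc q0v (pv i).
  split=> //; first by rewrite -[X in X != 0]/(f (pv i) x) fpv mulf_neq0 // invr_eq0.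
  move=> j; pose t : T := Tagged (fun i => 'I_(m i)) j.
  have [_ ht ft] := lc q0v t.
  rewrite -[e i j (a i) x]/(f t x) -[e i (jp i) (a i) x]/(f (pv i) x) ft fpv.
  by rewrite /Xf /idx enum_rankK /= !mevalM invf_div mulf_div.
- by exists (d0 + d1)%N; exact: dhomogM.
- have [v xv] := hcoord_ex x1; exists (v 0); split; last by exists x1; rewrite // rowvK.
  rewrite mevalM mulf_neq0 ?nq0 //; apply/meval_prod_neq0 => i.
  have [_ _ fE] := loc x1 v Xx1 xv (nq0 v xv) (pv i).
  have [_ en] := hpP i; have : f (pv i) x1 != 0 by exact: en.
  by rewrite fE mulf_eq0 negb_or => /andP[].
exists S; split=> // v /qE[q0v _]; exact: XS.
Qed.
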